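(* Let $S$ be a connected Lie subgroup of the solvable part $AN$ of the Iwasawa decomposition associated with the real hyperbolic space $\mathbb{R}H^n$, where $AN$ carries the left-invariant metric making it isometric to $\mathbb{R}H^n$. Assume that $S$ is a Ricci soliton with the induced metric. Then $S$ is Einstein and isometric to a Euclidean space or to a real hyperbolic space.
   Context: A Riemannian manifold $(M,g)$ is a Ricci soliton if $\mathrm{Ric}=cg+\mathcal{L}_Xg$ for some $c\in\mathbb{R}$ and some smooth vector field $X$; it is Einstein if $\mathrm{Ric}$ is a constant multiple of $g$. The solvable part $AN$ of the Iwasawa decomposition associated with $\mathbb{R}H^n$ (the identity component of its isometry group being $SO^0(1,n)$) is the simply connected Lie group whose Lie algebra is $\mathbb{R}B\oplus\mathfrak{g}_\alpha$ with $\dim\mathfrak{g}_\alpha=n-1$, $\mathfrak{g}_\alpha$ abelian, $B$ a unit vector orthogonal to $\mathfrak{g}_\alpha$, and $[B,U]=\lambda U$ for all $U\in\mathfrak{g}_\alpha$, with $\lambda>0$ a constant fixed by the normalization of the curvature ($\mathbb{R}H^n$ then has constant curvature $-\lambda^2$). ''A real hyperbolic space'' means a complete simply connected Riemannian manifold of some constant negative sectional curvature. *)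

(* Defs.v *)
From HB Require Import structures.
From mathcomp Require Import all_boot all_order all_algebra.
From mathcomp Require Import all_classical all_reals all_analysis.

Set Implicit Arguments.
Unset Strict Implicit.
Unset Printing Implicit Defensive.

Import Order.TTheory GRing.Theory Num.Theory.
Import numFieldNormedType.Exports.

Local Open Scope classical_set_scope.
Local Open Scope ring_scope.

(* U is meant to be open: the derivatives are not relative to U. *)
Fixpoint Ck (R : realType) (V W : normedModType R) (r : nat) (U : set V)
    (f : V -> W) : Prop :=
  match r with
  | 0 => forall x, U x -> {for x, continuous f}
  | r'.+1 => (forall x, U x -> differentiable f x) /\
             forall v, Ck r' U (fun x => 'D_v f x)
  end.

Definition smooth_on (R : realType) (V W : normedModType R) (U : set V)
    (f : V -> W) : Prop :=
  forall r, Ck r U f.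

(* A topological space with coordinate charts; the axioms are in [manifold].
   For a chart c with domain [dom c], [crd c] is the coordinate map and [par c]
   its inverse; both are total functions, whose values outside [dom c] and
   outside [crd c @` dom c] are irrelevant. *)
Record charted (R : realType) := Charted {
  pts :> topologicalType;
  dim : nat;
  chart : Type;
  dom : chart -> set pts;
  crd : chart -> pts -> 'rV[R]_dim;
  par : chart -> 'rV[R]_dim -> pts }.

Definition manifold (R : realType) (M : charted R) : Prop :=
  [/\ hausdorff_space M,
      @second_countable M,
      (forall p : M, exists c : chart M, dom c p),
      (forall c : chart M,
        [/\ open (dom c), open (crd c @` dom c),
            (forall p, dom c p -> par c (crd c p) = p),
            {within dom c, continuous (crd c)} &
            {within crd c @` dom c, continuous (par c)}]) &
      (forall c d : chart M,
        smooth_on (crd c @` (dom c `&` dom d)) (crd d \o par c))].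

Definition smooth_map (R : realType) (M N : charted R) (f : M -> N) : Prop :=
  continuous f /\
  forall (c : chart M) (d : chart N),
    smooth_on (crd c @` (dom c `&` f @^-1` dom d)) (crd d \o f \o par c).

Definition diffeomorphism (R : realType) (M N : charted R) (f : M -> N) : Prop :=
  smooth_map f /\
  exists f' : N -> M, [/\ cancel f f', cancel f' f & smooth_map f'].

(* Tangent vectors are coordinate row vectors, so the differential of f acts by
   right multiplication by the Jacobian matrix. *)
Definition tangent_mx (R : realType) (M N : charted R) (f : M -> N)
    (c : chart M) (d : chart N) (p : M) : 'M[R]_(dim M, dim N) :=
  jacobian (crd d \o f \o par c) (crd c p).

Definition immersion (R : realType) (M N : charted R) (f : M -> N) : Prop :=
  smooth_map f /\
  forall (c : chart M) (d : chart N) p,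
    dom c p -> dom d (f p) -> row_free (tangent_mx f c d p).

Definition prod_charted (R : realType) (M N : charted R) : charted R :=
  @Charted R (M * N)%type (dim M + dim N)%N (chart M * chart N)%type
    (fun c => dom c.1 `*` dom c.2)
    (fun c p => row_mx (crd c.1 p.1) (crd c.2 p.2))
    (fun c x => (par c.1 (lsubmx x), par c.2 (rsubmx x))).

Definition euclidean (R : realType) (k : nat) : charted R :=
  @Charted R 'rV[R]_k k unit (fun=> setT) (fun=> id) (fun=> id).

Definition lie_group (R : realType) (G : charted R)
    (mul : G -> G -> G) (one : G) (inv : G -> G) : Prop :=
  [/\ manifold G,
      [/\ associative mul, left_id one mul, right_id one mul,
          left_inverse one inv mul & right_inverse one inv mul],
      smooth_map ((fun p => mul p.1 p.2) : prod_charted G G -> G) &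
      smooth_map inv].

(* Lie subgroups are immersed: S need not carry the subspace topology. *)
Definition lie_subgroup (R : realType) (S G : charted R)
    (mulS : S -> S -> S) (mulG : G -> G -> G) (iota : S -> G) : Prop :=
  [/\ injective iota, {morph iota : x y / mulS x y >-> mulG x y} &
      immersion iota].

(* Fields of bilinear forms and of vectors, by components in every chart;
   only the values on [crd c @` dom c] matter. *)
Definition bilinear_field (R : realType) (M : charted R) :=
  chart M -> 'rV[R]_(dim M) -> 'M[R]_(dim M).

Definition vector_field (R : realType) (M : charted R) :=
  chart M -> 'rV[R]_(dim M) -> 'rV[R]_(dim M).

Definition is_pullback (R : realType) (M N : charted R) (f : M -> N)
    (h : bilinear_field N) (g : bilinear_field M) : Prop :=
  forall (c : chart M) (d : chart N) p, dom c p -> dom d (f p) ->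
    g c (crd c p) =
      tangent_mx f c d p *m h d (crd d (f p)) *m (tangent_mx f c d p)^T.

(* [is_pullback idfun g g] is the transformation law under change of charts. *)
Definition riemannian_metric (R : realType) (M : charted R)
    (g : bilinear_field M) : Prop :=
  [/\ (forall c : chart M, smooth_on (crd c @` dom c) (g c)),
      (forall (c : chart M) p, dom c p ->
        (g c (crd c p))^T = g c (crd c p) /\
        forall v : 'rV[R]_(dim M), v != 0 ->
          0 < (v *m g c (crd c p) *m v^T) 0 0) &
      is_pullback (idfun : M -> M) g g].

Definition smooth_vector_field (R : realType) (M : charted R)
    (X : vector_field M) : Prop :=
  (forall c : chart M, smooth_on (crd c @` dom c) (X c)) /\
  forall (c d : chart M) p, dom c p -> dom d p ->
    X d (crd d p) = X c (crd c p) *m tangent_mx (idfun : M -> M) c d p.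

Definition isometric (R : realType) (M N : charted R)
    (g : bilinear_field M) (h : bilinear_field N) : Prop :=
  exists f : M -> N, diffeomorphism f /\ is_pullback f h g.

Section LocalFormulas.
Context (R : realType) (k : nat).
Implicit Types (g : 'rV[R]_k -> 'M[R]_k) (x u v : 'rV[R]_k).

Definition pd (i : 'I_k) (f : 'rV[R]_k -> R) x : R := 'D_(delta_mx 0 i) f x.

(* Gamma^l_{ij} *)
Definition christoffel g (l i j : 'I_k) x : R :=
  2^-1 * \sum_(m < k) invmx (g x) l m *
    (pd i (fun y => g y j m) x + pd j (fun y => g y i m) x
     - pd m (fun y => g y i j) x).

(* The l-th component of R(d_i, d_j) d_q, with the sign convention
   R(X, Y) Z = nabla_X nabla_Y Z - nabla_Y nabla_X Z - nabla_[X, Y] Z. *)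
Definition curvature g (l q i j : 'I_k) x : R :=
  pd i (christoffel g l j q) x - pd j (christoffel g l i q) x
  + \sum_(m < k) (christoffel g l i m x * christoffel g m j q x
                  - christoffel g l j m x * christoffel g m i q x).

(* Ric(Y, Z) is the trace of X |-> R(X, Y) Z. *)
Definition ricci g x : 'M[R]_k :=
  \matrix_(j, q) \sum_(l < k) curvature g l q l j x.

Definition lie_derivative (X : 'rV[R]_k -> 'rV[R]_k) g x : 'M[R]_k :=
  \matrix_(i, j) \sum_(l < k)
    (X x 0 l * pd l (fun y => g y i j) x
     + g x l j * pd i (fun y => X y 0 l) x
     + g x i l * pd j (fun y => X y 0 l) x).

Definition curvature_op g x u v : 'rV[R]_k -> 'rV[R]_k := fun w =>
  \row_(l < k) \sum_(i < k) \sum_(j < k) \sum_(q < k)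
    u 0 i * v 0 j * w 0 q * curvature g l q i j x.

Definition inner g x u v : R := (u *m g x *m v^T) 0 0.

Definition sectional g x u v : R :=
  inner g x (curvature_op g x u v v) u /
  (inner g x u u * inner g x v v - inner g x u v ^+ 2).

End LocalFormulas.

Definition ricci_soliton (R : realType) (M : charted R)
    (g : bilinear_field M) : Prop :=
  exists (a : R) (X : vector_field M), smooth_vector_field X /\
    forall (c : chart M) p, dom c p ->
      ricci (g c) (crd c p) =
        a *: g c (crd c p) + lie_derivative (X c) (g c) (crd c p).

Definition einstein (R : realType) (M : charted R)
    (g : bilinear_field M) : Prop :=
  exists a : R, forall (c : chart M) p, dom c p ->
    ricci (g c) (crd c p) = a *: g c (crd c p).

Definition constant_sectional_curvature (R : realType) (M : charted R)
    (g : bilinear_field M) (kappa : R) : Prop :=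
  forall (c : chart M) p, dom c p -> forall u v : 'rV[R]_(dim M),
    row_free (col_mx u v) -> sectional (g c) (crd c p) u v = kappa.

Definition geodesic (R : realType) (M : charted R) (g : bilinear_field M)
    (gamma : R -> M) : Prop :=
  continuous gamma /\
  forall c : chart M,
    smooth_on (gamma @^-1` dom c) (crd c \o gamma) /\
    forall t, dom c (gamma t) -> forall l,
      let x := crd c \o gamma in
      derive1n 2 x t 0 l + \sum_i \sum_j
        christoffel (g c) l i j (x t) * derive1 x t 0 i * derive1 x t 0 j = 0.

(* Every initial velocity is that of a geodesic defined on the whole line. *)
Definition complete_metric (R : realType) (M : charted R)
    (g : bilinear_field M) : Prop :=
  forall (c : chart M) (p : M) (v : 'rV[R]_(dim M)), dom c p ->
    exists gamma : R -> M,
      [/\ geodesic g gamma, gamma 0 = p & derive1 (crd c \o gamma) 0 = v].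

Definition simply_connected (R : realType) (M : topologicalType) : Prop :=
  [/\ [set: M] !=set0,
      (forall p q : M, exists gamma : R -> M,
        [/\ {within `[0, 1], continuous gamma}, gamma 0 = p & gamma 1 = q]) &
      (forall gamma : R -> M,
        {within `[0, 1], continuous gamma} -> gamma 0 = gamma 1 ->
        exists H : R * R -> M,
          [/\ {within `[0, 1] `*` `[0, 1], continuous H},
              (forall t, `[0, 1]%classic t -> H (0, t) = gamma t),
              (forall t, `[0, 1]%classic t -> H (1, t) = gamma 0) &
              (forall s, `[0, 1]%classic s ->
                H (s, 0) = gamma 0 /\ H (s, 1) = gamma 0)])].

(* In dimension at most 1 the curvature condition is void, hence [1 < dim M]. *)
Definition real_hyperbolic_space (R : realType) (M : charted R)
    (g : bilinear_field M) : Prop :=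
  [/\ manifold M, riemannian_metric g, simply_connected R M,
      complete_metric g &
      (1 < dim M)%N /\
      exists2 kappa : R, kappa < 0 & constant_sectional_curvature g kappa].

Definition euclidean_metric (R : realType) (k : nat) :
    bilinear_field (euclidean R k) :=
  fun _ _ => 1%:M.

(* AN for RH^n: the simply connected Lie group with Lie algebra R B (+) g_alpha, as the
   semidirect product of R and R^(n-1): [row_mx t x] stands for
   exp(x) exp(t B), the first coordinate vector at the identity is B, and the
   others form an orthonormal basis of g_alpha. *)
Definition AN (R : realType) (n : nat) : charted R := euclidean R (1 + n.-1).

Section IwasawaGroup.
Context (R : realType) (n : nat) (lambda : R).

Definition an_mul (a b : AN R n) : AN R n :=
  row_mx (lsubmx a + lsubmx b)
         (rsubmx a + expR (lambda * lsubmx a 0 0) *: rsubmx b).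

Definition an_one : AN R n := (0 : 'rV[R]_(1 + n.-1)).

Definition an_inv (a : AN R n) : AN R n :=
  row_mx (- lsubmx a) (- (expR (- (lambda * lsubmx a 0 0)) *: rsubmx a)).

(* The left-invariant metric whose value at the identity is the standard inner
   product: <u, v>_a = <dL_{a^-1} u, dL_{a^-1} v>. *)
Definition an_metric : bilinear_field (AN R n) := fun _ a =>
  let J := jacobian (an_mul (an_inv a) : 'rV[R]_(1 + n.-1) -> 'rV[R]_(1 + n.-1)) a in
  J *m J^T.

Lemma an_mulA : associative an_mul.
Proof.
move=> a b c; rewrite /an_mul !row_mxKl !row_mxKr addrA.
rewrite [(lsubmx a + _) 0 0]mxE mulrDr expRD.
by rewrite scalerDr scalerA addrA.
Qed.

Lemma an_mul1 : left_id an_one an_mul.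
Proof.
move=> a; rewrite /an_mul /an_one !linear0 !add0r [X in expR (_ * X)]mxE mulr0 expR0 scale1r.
by rewrite hsubmxK.
Qed.

Lemma an_mulV : left_inverse an_one an_inv an_mul.
Proof.
move=> a; rewrite /an_mul /an_inv !row_mxKl !row_mxKr addNr [(- lsubmx a) 0 0]mxE.
rewrite mulrN addNr.
by rewrite row_mx0.
Qed.

(* Ad(exp(t B)) acts on g_alpha by exp(lambda t), that is [B, U] = lambda U. *)
Lemma an_conj (t : R) (U : 'rV[R]_n.-1) :
  let b : AN R n := row_mx t%:M 0 in
  an_mul (an_mul b (row_mx 0 U)) (an_inv b) = row_mx 0 (expR (lambda * t) *: U).
Proof.
rewrite /an_mul /an_inv /= !row_mxKl !row_mxKr !scaler0 !oppr0 scaler0.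
by rewrite addr0 add0r addr0 subrr mxE eqxx mulr1n.
Qed.

End IwasawaGroup.

(* Main.v *)
(* The differential of the immersion iota : S -> AN at q is, up to an invertible factor, the
   differential at the identity followed by the left translation by iota q. So if the Lie
   algebra of S lies in g_alpha, the B-coordinate is constant on S, and iota followed by an
   orthogonal projection is an isometry onto R^k. Otherwise the Lie algebra is spanned by
   B + U and a subspace W of g_alpha orthogonal to U: the U-component of iota q is then the
   function (exp(lambda t) - 1) / lambda of its B-coordinate t, and
   (t, x) |-> (sqrt(1 + |U|^2) t, projection of x on W) is an isometric homomorphism from S to
   the group AN of lower dimension with lambda / sqrt(1 + |U|^2) in place of lambda. In both
   cases the image is open, hence everything. The curvature is computed in an arbitrary chart
   by the Gauss equation for the hyperboloid of Minkowski space, parametrised by AN, which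
   avoids the transformation law of the curvature tensor. *)

Require Import Defs.
From HB Require Import structures.
From mathcomp Require Import all_boot all_order all_algebra.
From mathcomp Require Import all_classical all_reals all_analysis.
From mathcomp Require Import ring lra.

Set Implicit Arguments.
Unset Strict Implicit.
Unset Printing Implicit Defensive.

Import Order.TTheory GRing.Theory Num.Theory.
Import numFieldNormedType.Exports.

Local Open Scope classical_set_scope.
Local Open Scope ring_scope.

(** * Smooth maps between normed spaces *)

(** All the geometry of [S] is carried by one matrix, the Jacobian [J0] of [iota] at the identity.
    Left invariance writes the differential elsewhere as [B *m (J0 *m scaling n s)], with [s] equal
    to lambda times the B-coordinate, and the metric of AN cancels the scaling: the induced metric
    is the Gram matrix of [B *m J0]. A constant matrix [N] compatible with the scalings that
    preserves the Gram matrix of [J0] therefore makes [iota q *m N] isometric, whatever [B] is. The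
    function (exp(lambda t) - 1) / lambda is a primitive: the derivative of the U-component is
    exp(lambda t) times that of t, and both components vanish at the identity. The factor sqrt(1 +
    |U|^2) is the length of B + U; multiplying t and dividing lambda by it preserves exp(lambda t),
    hence the group law. The charts of [S] are arbitrary, so the diffeomorphism must come from an
    injective immersion alone; a minimisation argument makes it open, and its inverse is smooth by
    bootstrapping. In the Gauss equation the Hessian is never computed: the position vector and its
    derivatives form a basis for reasons of dimension, and differentiating the quadric equation
    twice gives the normal component. *)

Section Calculus.
Context (R : realType).
Implicit Types (V W : normedModType R).

(** The expansion of [f] at [x] only sees values near [x], so it is also one of [g]; [diff_unique]
    then identifies its linear part with the differential of [g]. *)
Lemma near_eq_differentiable V W (f g : V -> W) x :
  {near x, f =1 g} -> differentiable f x -> differentiable g x.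
Proof.
move=> fg df.
have dg : g \o shift x = cst (g x) + 'd f x +o_ 0 id.
  have [_ /eqaddoP dfx] := (diff_locallyP x f).1 df.
  have fgx : \forall y \near 0, f (y + x) = g (y + x).
    by have := fg; rewrite (near_shift 0 x) /= subr0.
  apply/eqaddoP => e e0; move: (dfx e e0) fgx; apply: filterS2 => y + fgy.
  rewrite -[(_ - _) y]/(f (y + x) - (f x + 'd f x y)).
  by rewrite -[X in _ -> `|X| <= _]/(g (y + x) - (g x + 'd f x y)) fgy (nbhs_singleton fg).
have dgE : 'd g x = 'd f x :> (V -> W) by apply: diff_unique (diff_continuous df) dg.
apply/diff_locallyP; rewrite dgE; split => //; exact: diff_continuous.
Qed.

Lemma near_open V (U : set V) x : open U -> U x -> \forall y \near x, U y.
Proof. by move=> oU Ux; apply: open_nbhs_nbhs. Qed.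

Lemma eq_open_near V (T : Type) (U : set V) (f g : V -> T) x :
  open U -> U x -> (forall y, U y -> f y = g y) -> {near x, f =1 g}.
Proof. by move=> oU Ux fg; apply: filterS (near_open oU Ux). Qed.

(** Openness of [U] makes the derivatives of [f] and [g] agree on [U]. Most regularity proofs below
    use this to replace a function by a formula that is valid on [U] only. *)
Lemma Ck_eq V W r (U : set V) (f g : V -> W) : open U ->
  (forall x, U x -> f x = g x) -> Ck r U f -> Ck r U g.
Proof.
move=> oU; elim: r f g => [|r IH] f g fg /=.
  move=> fc x Ux; rewrite /prop_for /continuous_at -(fg x Ux).
  apply: cvg_trans (fc x Ux); apply: near_eq_cvg.
  by apply: filterS (near_open oU Ux) => y Uy; exact: fg.
move=> [df dfk]; split=> [x Ux|v].
  by apply: near_eq_differentiable (df x Ux); exact: eq_open_near oU Ux fg.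
apply: IH (dfk v) => x Ux; apply: near_eq_derive.
exact: eq_open_near oU Ux fg.
Qed.

Lemma CkW V W r (U : set V) (f : V -> W) : Ck r.+1 U f -> Ck r U f.
Proof.
elim: r f => [|r IH] f /= [df dfk].
  by move=> x Ux; apply: differentiable_continuous; exact: df.
by split=> // v; apply: IH.
Qed.

Lemma Ck_cst V W r (U : set V) (a : W) : Ck r U (fun=> a).
Proof.
elim: r a => [|r IH] a /=; first by move=> x _; exact: cst_continuous.
split=> [x _|v]; first exact: differentiable_cst.
by rewrite (_ : 'D_v _ = fun=> 0) //; apply/funext => x; rewrite derive_cst.
Qed.

Lemma CkD V W r (U : set V) (f g : V -> W) : open U ->
  Ck r U f -> Ck r U g -> Ck r U (fun x => f x + g x).
Proof.
move=> oU; elim: r f g => [|r IH] f g /=.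
  by move=> fc gc x Ux; apply: cvgD; [exact: fc | exact: gc].
move=> [df dfk] [dg dgk]; split=> [x Ux|v].
  by apply: differentiableD; [exact: df | exact: dg].
apply: Ck_eq (IH _ _ (dfk v) (dgk v)) => // x Ux.
by rewrite deriveD //; apply: diff_derivable; [exact: df | exact: dg].
Qed.

Lemma CkM V r (U : set V) (f g : V -> R) : open U ->
  Ck r U f -> Ck r U g -> Ck r U (fun x => f x * g x).
Proof.
move=> oU; elim: r f g => [|r IH] f g fk gk.
  by move=> x Ux; apply: cvgM; [exact: fk | exact: gk].
have [df dfk] := fk; have [dg dgk] := gk.
split=> [x Ux|v].
  by apply: differentiableM; [exact: df | exact: dg].
apply: (Ck_eq oU _ (CkD oU (IH _ _ (CkW fk) (dgk v)) (IH _ _ (CkW gk) (dfk v)))).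
move=> x Ux.
by rewrite deriveM //; apply: diff_derivable; [exact: df | exact: dg].
Qed.

Lemma CkV V r (U : set V) (f : V -> R) : open U -> (forall x, U x -> f x != 0) ->
  Ck r U f -> Ck r U (fun x => (f x)^-1).
Proof.
move=> oU f0; elim: r => [|r IH] fk.
  by move=> x Ux; apply: cvgV; [exact: f0 | exact: fk].
have [df dfk] := fk.
have fVk := IH (CkW fk).
split=> [x Ux|v]; first by apply: differentiableV; [exact: df | exact: f0].
have cN1 : Ck r U (fun=> -1 : R) by exact: Ck_cst.
(* The derivative of 1/f is - (1/f)^2 f', and 1/f is of class [r] by induction. *)
apply: (Ck_eq oU _ (CkM oU cN1 (CkM oU (CkM oU fVk fVk) (dfk v)))).
move=> x Ux; rewrite deriveV ?f0 //; last by apply: diff_derivable; exact: df.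
by rewrite mulN1r -mulNr -exprVn expr2.
Qed.

Lemma CkN V r (U : set V) (f : V -> R) : open U ->
  Ck r U f -> Ck r U (fun x => - f x).
Proof.
move=> oU fk; have cN1 : Ck r U (fun=> -1 : R) by exact: Ck_cst.
apply: (Ck_eq oU _ (CkM oU cN1 fk)).
by move=> x _; rewrite mulN1r.
Qed.

Lemma Ck_sum V W (I : Type) (s : seq I) (P : pred I) r (U : set V) (f : I -> V -> W) :
  open U -> (forall i, P i -> Ck r U (f i)) -> Ck r U (fun x => \sum_(i <- s | P i) f i x).
Proof.
move=> oU fk; elim: s => [|i s IH].
  by rewrite (_ : (fun x => _) = fun=> 0); [exact: Ck_cst|apply/funext => x; rewrite big_nil].
apply: (Ck_eq oU (f := fun x => (if P i then f i x else 0) + \sum_(j <- s | P j) f j x)).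
  by move=> x _; rewrite big_cons; case: ifP => // _; rewrite add0r.
by apply: CkD => //; case: (boolP (P i)) => [/fk//|_]; exact: Ck_cst.
Qed.

Lemma Ck_prod V (I : Type) (s : seq I) (P : pred I) r (U : set V) (f : I -> V -> R) :
  open U -> (forall i, P i -> Ck r U (f i)) -> Ck r U (fun x => \prod_(i <- s | P i) f i x).
Proof.
move=> oU fk; elim: s => [|i s IH].
  by rewrite (_ : (fun x => _) = fun=> 1); [exact: Ck_cst|apply/funext => x; rewrite big_nil].
apply: (Ck_eq oU (f := fun x => (if P i then f i x else 1) * \prod_(j <- s | P j) f j x)).
  by move=> x _; rewrite big_cons; case: ifP => // _; rewrite mul1r.
by apply: CkM => //; case: (boolP (P i)) => [/fk//|_]; exact: Ck_cst.
Qed.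

Lemma differentiable_mxP V m n (f : V -> 'M[R]_(m, n)) x :
  differentiable f x <-> forall i j, differentiable (fun y => f y i j) x.
Proof.
split=> [df i j|df].
  exact: (differentiable_comp df (differentiable_coord (f x) i j)).
rewrite (_ : f = \sum_i \sum_j (fun y => f y i j *: delta_mx i j)).
  by apply: differentiable_sum => i; apply: differentiable_sum => j;
    exact: differentiableZl.
apply/funext => y; rewrite [LHS]matrix_sum_delta fct_sumE.
by apply: eq_bigr => i _; rewrite fct_sumE.
Qed.

Lemma derive_mxE V m n (f : V -> 'M[R]_(m, n)) x v i j :
  differentiable f x -> ('D_v f x) i j = 'D_v (fun y => f y i j) x.
Proof. by move=> /diff_derivable df; rewrite derive_mx // mxE. Qed.

Lemma continuous_mxP (T : topologicalType) m n (f : T -> 'M[R]_(m, n)) x :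
  {for x, continuous f} <-> forall i j, {for x, continuous (fun y => f y i j)}.
Proof.
split=> [fc i j|fc].
  by apply: (@continuous_comp _ _ _ f (fun M : 'M[R]_(m, n) => M i j : R)) => //;
    exact: coord_continuous.
move=> A [B nB sB].
suff : \forall y \near x, forall i j, B i j (f y i j).
  by apply: filterS => y By; apply: sB.
apply: filter_forall => i; apply: filter_forall => j.
exact: fc.
Qed.

Lemma Ck_mxP V m n r (U : set V) (f : V -> 'M[R]_(m, n)) : open U ->
  Ck r U f <-> forall i j, Ck r U (fun x => f x i j).
Proof.
move=> oU; elim: r f => [|r IH] f.
  split=> [fc i j x Ux|fc x Ux].
    by have /continuous_mxP := fc x Ux; apply.
  by apply/continuous_mxP => i j; apply: fc.
split=> [[df dfk] i j|fk].
  split=> [x Ux|v]; first by have /differentiable_mxP := df x Ux; apply.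
  apply: Ck_eq ((IH _).1 (dfk v) i j) => // x Ux.
  by rewrite derive_mxE //; exact: df.
have df x : U x -> differentiable f x.
  by move=> Ux; apply/differentiable_mxP => i j; have [+ _] := fk i j; apply.
split=> // v; apply/IH => i j; have [_ /(_ v)] := fk i j.
by apply: Ck_eq => // x Ux; rewrite derive_mxE //; exact: df.
Qed.

Lemma Ck_coord m n r (U : set 'M[R]_(m, n)) i j : Ck r U (fun x : 'M[R]_(m, n) => x i j).
Proof.
case: r => [|r]; first by move=> x _; exact: coord_continuous.
split=> [x _|v]; first exact: differentiable_coord.
rewrite (_ : 'D_v _ = fun=> v i j); first exact: Ck_cst.
apply/funext => x; rewrite -[LHS](derive_mxE (f := id)) ?derive_id //.
Qed.

(** The chain rule in partial derivatives: each factor of the sum is a scalar function, so that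
    [CkM] and induction apply to it in [Ck_comp]. *)
Lemma derive_comp V n (g : 'rV[R]_n -> R) (f : V -> 'rV[R]_n) x v :
  differentiable f x -> differentiable g (f x) ->
  'D_v (fun y => g (f y)) x =
    \sum_i 'D_v (fun y => f y 0 i) x * 'D_(delta_mx 0 i) g (f x).
Proof.
move=> df dg; rewrite deriveE; last exact: (differentiable_comp df dg).
rewrite [X in X v](_ : _ = 'd g (f x) \o 'd f x); last exact: diff_comp.
rewrite /= -(deriveE v df) {1}['D_v f x]matrix_sum_delta big_ord1 linear_sum.
by apply: eq_bigr => i _; rewrite linearZ /= derive_mxE // (deriveE _ dg).
Qed.

Lemma Ck_comp V n r (U : set V) (U' : set 'rV[R]_n) (g : 'rV[R]_n -> R) (f : V -> 'rV[R]_n) :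
  open U -> (forall x, U x -> U' (f x)) ->
  Ck r U f -> Ck r U' g -> Ck r U (fun x => g (f x)).
Proof.
move=> oU fU; elim: r g => [|r IH] g fk gk.
  by move=> x Ux; apply: continuous_comp; [exact: fk | exact/gk/fU].
have [df dfk] := fk; have [dg dgk] := gk.
have df' x : U x -> differentiable (fun y => g (f y)) x.
  by move=> Ux; apply: (differentiable_comp (df x Ux)); exact/dg/fU.
split=> // v.
apply: (Ck_eq oU (f := fun x => \sum_i 'D_v (fun y => f y 0 i) x * 'D_(delta_mx 0 i) g (f x))).
  by move=> x Ux; rewrite derive_comp //; [exact: df | exact/dg/fU].
apply: Ck_sum => // i _; apply: CkM => //.
  by have [_] := (Ck_mxP r.+1 f oU).1 fk 0 i; apply.
exact: IH (CkW fk) (dgk _).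
Qed.

Lemma Ck_comp_mx V m n p r (U : set V) (U' : set 'rV[R]_n) (g : 'rV[R]_n -> 'M[R]_(m, p))
    (f : V -> 'rV[R]_n) :
  open U -> open U' -> (forall x, U x -> U' (f x)) ->
  Ck r U f -> Ck r U' g -> Ck r U (fun x => g (f x)).
Proof.
move=> oU oU' fU fk /(Ck_mxP r _ oU') gk; apply/(Ck_mxP r _ oU) => i j.
exact: Ck_comp fU fk (gk i j).
Qed.

Lemma Ck_mulmx V m n p r (U : set V) (f : V -> 'M[R]_(m, n)) (g : V -> 'M[R]_(n, p)) :
  open U -> Ck r U f -> Ck r U g -> Ck r U (fun x => f x *m g x).
Proof.
move=> oU /(Ck_mxP r _ oU) fk /(Ck_mxP r _ oU) gk; apply/(Ck_mxP r _ oU) => i j.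
apply: (Ck_eq oU (f := fun x => \sum_k f x i k * g x k j)).
  by move=> x _; rewrite mxE.
by apply: Ck_sum => // k _; exact: CkM.
Qed.

Lemma Ck_trmx V m n r (U : set V) (f : V -> 'M[R]_(m, n)) :
  open U -> Ck r U f -> Ck r U (fun x => (f x)^T).
Proof.
move=> oU /(Ck_mxP r _ oU) fk; apply/(Ck_mxP r _ oU) => i j.
by apply: Ck_eq (fk j i) => // x _; rewrite mxE.
Qed.

Lemma Ck_det V n r (U : set V) (f : V -> 'M[R]_n) :
  open U -> Ck r U f -> Ck r U (fun x => \det (f x)).
Proof.
move=> oU /(Ck_mxP r _ oU) fk; apply: Ck_sum => // s _.
by apply: CkM; [|exact: Ck_cst|apply: Ck_prod].
Qed.

Lemma Ck_invmx V n r (U : set V) (f : V -> 'M[R]_n) :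
  open U -> (forall x, U x -> f x \in unitmx) ->
  Ck r U f -> Ck r U (fun x => invmx (f x)).
Proof.
move=> oU fu fk; have := fk => /(Ck_mxP r _ oU) fijk; apply/(Ck_mxP r _ oU) => i j.
(* Cramer's rule reduces the claim to determinants and one scalar inverse. *)
apply: (Ck_eq oU (f := fun x => (\det (f x))^-1 * cofactor (f x) j i)).
  by move=> x Ux; rewrite /invmx fu // !mxE.
apply: CkM => //.
  by apply: CkV => //; [move=> x /fu; rewrite unitmxE unitfE | exact: Ck_det].
rewrite /cofactor; apply: CkM => //; first exact: Ck_cst.
apply: Ck_det => //; apply/(Ck_mxP r _ oU) => a b.
by apply: Ck_eq (fijk (lift j a) (lift i b)) => // x _; rewrite !mxE.
Qed.

Lemma derive_scalar_comp V (phi : R -> R) (d : R) (f : V -> R) x v :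
  differentiable f x -> is_derive (f x) (1 : R) phi d ->
  differentiable (fun y => phi (f y)) x /\ 'D_v (fun y => phi (f y)) x = d * 'D_v f x.
Proof.
move=> df [/derivable1_diffP dphi dE].
have dc : differentiable (phi \o f) x by exact: differentiable_comp.
split=> //; rewrite [LHS](deriveE v dc).
transitivity ('d phi (f x) ('d f x v)).
  by have /(congr1 (fun h => h v)) := diff_comp df dphi.
rewrite -(deriveE v df) -{1}['D_v f x]mulr1.
rewrite -['D_v f x * 1]/('D_v f x *: (1 : R)) linearZ /= -deriveE // dE.
exact: mulrC.
Qed.

(** The hypothesis on [dphi] may assume that phi(f) already has class [r']. This is what closes the
    induction for the exponential, where [dphi] is [phi], while for the logarithm [dphi] is handled
    by [CkV]. *)
Lemma Ck_scalar_comp V r (U : set V) (phi dphi : R -> R) (U' : set R) (f : V -> R) :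
  open U -> (forall x, U x -> U' (f x)) ->
  (forall t, U' t -> is_derive t (1 : R) phi (dphi t)) ->
  (forall r', (r' <= r)%N -> Ck r' U f -> Ck r' U (fun x => phi (f x)) ->
     Ck r' U (fun x => dphi (f x))) ->
  Ck r U f -> Ck r U (fun x => phi (f x)).
Proof.
move=> oU fU dphiE; elim: r => [|r IH] Hd fk.
  move=> x Ux; apply: continuous_comp; first exact: fk.
  apply: differentiable_continuous; apply/derivable1_diffP.
  by have [] := dphiE _ (fU x Ux).
have [df dfk] := fk.
have fk' : Ck r U (fun x => phi (f x)).
  by apply: IH (CkW fk) => r' r'r; apply: Hd; exact: leqW.
split=> [x Ux|v]; first by have [] := derive_scalar_comp 0 (df x Ux) (dphiE _ (fU x Ux)).
apply: (Ck_eq oU (f := fun x => 'D_v f x * dphi (f x))).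
  move=> x Ux; rewrite mulrC.
  by have [_ ->] := derive_scalar_comp v (df x Ux) (dphiE _ (fU x Ux)).
by apply: (CkM oU (dfk v)); apply: (Hd r (leqnSn r)) => //; exact: CkW.
Qed.

Lemma Ck_expR V r (U : set V) (f : V -> R) :
  open U -> Ck r U f -> Ck r U (fun x => expR (f x)).
Proof.
move=> oU; apply: (Ck_scalar_comp (U' := setT) (dphi := expR)) => // t _.
Qed.

Lemma Ck_ln V r (U : set V) (f : V -> R) :
  open U -> (forall x, U x -> 0 < f x) -> Ck r U f -> Ck r U (fun x => ln (f x)).
Proof.
move=> oU f0; apply: (Ck_scalar_comp (U' := [set t | 0 < t]) (dphi := fun t => t^-1)) => //.
- by move=> r' _ fk _; apply: CkV => // x /f0 /lt0r_neq0.
Qed.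

End Calculus.

(** * Restriction to lines and the symmetry of second derivatives *)

Section Lines.
Context (R : realType).
Implicit Types (V W : normedModType R).

Lemma is_derive_line V (f : V -> R) (y w : V) (s : R) :
  differentiable f (y + s *: w) ->
  is_derive s (1 : R) (fun t => f (y + t *: w)) ('D_w f (y + s *: w)).
Proof.
move=> df.
have dl : is_diff s (fun t : R => y + t *: w) (fun t : R => t *: w).
  have -> : (fun t : R => y + t *: w) = cst y + *:%R ^~ w by [].
  by apply: is_diff_eq; apply/funext => t; rewrite /= add0r.
have dfl : differentiable (f \o (fun t : R => y + t *: w)) s.
  by apply: differentiable_comp => //; exact: df.
split; first exact/diff_derivable.
rewrite deriveE // diff_comp //= (diff_val (is_diff_def := dl)) /= scale1r deriveE //.
Qed.

Lemma continuous_line V (f : V -> R) (y w : V) (s : R) :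
  differentiable f (y + s *: w) -> {for s, continuous (fun t : R => f (y + t *: w))}.
Proof.
move=> /is_derive_line [/derivable1_diffP + _]; exact: differentiable_continuous.
Qed.

Lemma MVT_line V (f : V -> R) (y w : V) (h : R) : 0 <= h ->
  (forall s : R, 0 <= s <= h -> differentiable f (y + s *: w)) ->
  exists2 s : R, 0 <= s <= h & f (y + h *: w) - f y = h * 'D_w f (y + s *: w).
Proof.
move=> h0 df.
have [|| c] := @MVT_segment R (fun t => f (y + t *: w)) (fun s => 'D_w f (y + s *: w)) 0 h h0.
- move=> s; rewrite in_itv /= => /andP[s0 sh].
  by apply/is_derive_line/df; rewrite !ltW.
- apply: continuous_in_subspaceT => s; rewrite inE /= in_itv /= => sh.
  exact/continuous_line/df.
- rewrite in_itv /= => c0h; rewrite scale0r addr0 subr0 => ->.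
  by exists c => //; rewrite mulrC.
Qed.

(** Two applications of the mean value theorem: along [u] to the difference f(y + hv) - f(y), then
    along [v] to the derivative of [f] in the direction [u]. The left-hand side is symmetric in [u]
    and [v], the right-hand side is not. *)
Lemma second_difference V (U : set V) (f : V -> R) (u v x : V) (h : R) :
  open U -> Ck 2 U f -> 0 < h ->
  (forall s t : R, 0 <= s <= h -> 0 <= t <= h -> U (x + s *: u + t *: v)) ->
  exists s t : R, [/\ 0 <= s <= h, 0 <= t <= h &
    f (x + h *: u + h *: v) - f (x + h *: u) - (f (x + h *: v) - f x) =
      h * (h * 'D_v ('D_u f) (x + s *: u + t *: v))].
Proof.
move=> oU [df ddf] h0 inU; have [ddu _] := ddf u.
have hh : 0 <= h <= h by rewrite lexx ltW.
have h00 : 0 <= (0 : R) <= h by rewrite lexx ltW.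
have inU0 (s : R) : 0 <= s <= h -> U (x + s *: u).
  by move=> sh; have := inU s 0 sh h00; rewrite scale0r addr0.
pose g := fun y => f (y + h *: v) - f y.
have dfs (s : R) : 0 <= s <= h -> differentiable (fun y => f (y + h *: v)) (x + s *: u).
  move=> sh; apply: (@differentiable_comp _ _ _ _ (fun y => y + h *: v)).
    by apply: differentiableD => //; exact: differentiable_cst.
  exact/df/inU.
have dfs' (s : R) : 0 <= s <= h ->
    'D_u (fun y => f (y + h *: v)) (x + s *: u) = 'D_u f (x + s *: u + h *: v).
  move=> sh; have d1 : differentiable (fun y => y + h *: v) (x + s *: u).
    by apply: differentiableD => //; exact: differentiable_cst.
  have d2 : differentiable f (x + s *: u + h *: v) by exact/df/inU.
  rewrite deriveE; last exact: dfs.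
  transitivity ('d f (x + s *: u + h *: v) ('d (fun y => y + h *: v) (x + s *: u) u)).
    by have /(congr1 (fun k => k u)) := diff_comp d1 d2.
  rewrite [X in 'd f _ X](_ : _ = u) ?deriveE //.
  rewrite -deriveE // deriveD // ?derive_id ?derive_cst ?addr0.
  by [].
have dg (s : R) : 0 <= s <= h -> differentiable g (x + s *: u).
  move=> sh; apply: differentiableB; first exact: dfs.
  exact/df/inU0.
have [s sh gE] := MVT_line (ltW h0) dg.
have [t th kE] := @MVT_line _ ('D_u f) (x + s *: u) v h (ltW h0)
   (fun t th => ddu _ (inU s t sh th)).
exists s, t; split => //; rewrite -[LHS]/(g _ - g _) gE -kE; congr (_ * _).
rewrite deriveB ?dfs' //; apply: diff_derivable; [exact: dfs | exact/df/inU0].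
Qed.

Lemma eq_of_common_approx (a b : R) :
  (forall e : R, 0 < e -> exists2 c : R, `|a - c| < e & `|b - c| < e) -> a = b.
Proof.
move=> ab; apply/eqP; rewrite -subr_eq0 -normr_le0; apply/ler_addgt0Pr => e e0.
rewrite add0r; have [c ac bc] := ab (e / 2) (divr_gt0 e0 (ltr0Sn _ 1)).
rewrite (_ : a - b = (a - c) - (b - c)); last by ring.
by rewrite (le_trans (ler_normB _ _)) // [e]splitr ltW // ltrD.
Qed.

Lemma continuous_near_dist V (f : V -> R) (x : V) (e : R) :
  {for x, continuous f} -> 0 < e -> \forall y \near x, `|f x - f y| < e.
Proof. by move=> /cvgrPdist_lt fc e0; exact: fc. Qed.

(** Schwarz's theorem: by [second_difference] in both orders, the two mixed derivatives take a
    common value at two points arbitrarily close to [x], and both are continuous there. *)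
Lemma derive_comm V (U : set V) (f : V -> R) (u v x : V) :
  open U -> Ck 2 U f -> U x -> 'D_u ('D_v f) x = 'D_v ('D_u f) x.
Proof.
move=> oU fk Ux; have [df ddf] := fk.
have cA : {for x, continuous ('D_u ('D_v f))} by have [_ /(_ u)] := ddf v; apply.
have cB : {for x, continuous ('D_v ('D_u f))} by have [_ /(_ v)] := ddf u; apply.
apply: eq_of_common_approx => e e0.
have nA := continuous_near_dist cA e0.
have nB := continuous_near_dist cB e0.
have /nbhs_ballP[d /= d0 dsub] : \forall y \near x,
    [/\ U y, `|'D_u ('D_v f) x - 'D_u ('D_v f) y| < e &
             `|'D_v ('D_u f) x - 'D_v ('D_u f) y| < e].
  apply: filterS3 (near_open oU Ux) nA nB => y Uy Ay By; exact: (And3 Uy Ay By).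
pose M := `|u| + `|v| + 1.
have M0 : 0 < M by rewrite ltr_wpDl ?addr_ge0.
(* For s, t in [0, h] the vector su + tv has norm at most hM = d/2 < d; the summand 1 in [M] keeps
   it positive when [u] and [v] vanish. *)
pose h := d / (2 * M).
have h0 : 0 < h by rewrite divr_gt0 ?mulr_gt0.
have small (s t : R) : 0 <= s <= h -> 0 <= t <= h -> ball x d (x + s *: u + t *: v).
  move=> /andP[s0 sh] /andP[t0 th].
  rewrite -ball_normE /= -addrA opprD addNKr normrN.
  rewrite (le_lt_trans (ler_normD _ _)) // !normrZ !ger0_norm //.
  rewrite (@le_lt_trans _ _ (h * M)) //.
    rewrite /M !mulrDr mulr1 -addrA lerD // ?ler_wpM2r //.
    by rewrite ler_wpDr ?ler_wpM2r // ltW.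
  by rewrite /h invfM mulrA mulfVK ?lt0r_neq0 // ltr_pdivrMr // ltr_pMr // ltr1n.
have [s [t [sh th E1]]] := second_difference oU fk h0
  (fun (s t : R) sh th => let: And3 H _ _ := dsub _ (small s t sh th) in H).
have small' (s' t' : R) : 0 <= s' <= h -> 0 <= t' <= h -> U (x + s' *: v + t' *: u).
  by move=> sh' th'; rewrite addrAC; have [] := dsub _ (small t' s' th' sh').
have [s' [t' [sh' th' E2]]] := second_difference oU fk h0 small'.
have : 'D_v ('D_u f) (x + s *: u + t *: v) = 'D_u ('D_v f) (x + s' *: v + t' *: u).
  apply: (mulfI (lt0r_neq0 h0)); apply: (mulfI (lt0r_neq0 h0)).
  have xvu : x + h *: v + h *: u = x + h *: u + h *: v by rewrite addrAC.
  rewrite xvu in E2; apply: (etrans (esym E1)); apply: etrans E2.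
  by move: (f (x + h *: u + h *: v)) (f (x + h *: u)) (f (x + h *: v)) (f x) => a b c k; ring.
have [_ _ nB'] := dsub _ (small s t sh th).
have [_ nA' _] := dsub _ (small t' s' th' sh').
rewrite [x + s' *: v + _]addrAC => E.
rewrite E in nB'.
exists ('D_u ('D_v f) (x + t' *: u + s' *: v)).
  exact: nA'.
exact: nB'.
Qed.

End Lines.

(** * The Gauss equation *)

Section DerivativeRules.
Context (R : realType) (V : normedModType R).
Implicit Types (f g : V -> R).

Lemma derive_add f g x v : differentiable f x -> differentiable g x ->
  'D_v (fun y => f y + g y) x = 'D_v f x + 'D_v g x.
Proof.
by move=> /diff_derivable df /diff_derivable dg; rewrite -deriveD.
Qed.

Lemma derive_mul f g x v : differentiable f x -> differentiable g x ->
  'D_v (fun y => f y * g y) x = 'D_v f x * g x + f x * 'D_v g x.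
Proof.
move=> /diff_derivable df /diff_derivable dg.
by rewrite addrC [_ * g x]mulrC; exact: (deriveM (df v) (dg v)).
Qed.

Lemma derive_cmul (c : R) f x v : differentiable f x ->
  'D_v (fun y => c * f y) x = c * 'D_v f x.
Proof.
by move=> df; rewrite derive_mul ?derive_cst ?mul0r ?add0r.
Qed.

Lemma differentiable_big (I : Type) (s : seq I) (h : I -> V -> R) x :
  (forall i, differentiable (h i) x) ->
  differentiable (fun y => \sum_(i <- s) h i y) x.
Proof.
move=> dh; elim: s => [|i s IH].
  rewrite (_ : (fun y => _) = cst 0); first exact: differentiable_cst.
  by apply/funext => y; rewrite big_nil.
rewrite (_ : (fun y => _) = h i + (fun y => \sum_(j <- s) h j y)).
  exact: differentiableD.
by apply/funext => y; rewrite big_cons.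
Qed.

Lemma derive_big (I : Type) (s : seq I) (h : I -> V -> R) x v :
  (forall i, differentiable (h i) x) ->
  'D_v (fun y => \sum_(i <- s) h i y) x = \sum_(i <- s) 'D_v (h i) x.
Proof.
move=> dh; elim: s => [|i s IH].
  rewrite big_nil (_ : (fun y => _) = cst 0) ?derive_cst //.
  by apply/funext => y; rewrite big_nil.
rewrite big_cons -IH -derive_add //; last exact: differentiable_big.
by congr ('D_v _ x); apply/funext => y; rewrite big_cons.
Qed.

Lemma derive_congr (U : set V) f g x v : open U -> U x ->
  (forall y, U y -> f y = g y) -> 'D_v f x = 'D_v g x.
Proof. by move=> oU Ux fg; apply: near_eq_derive; exact: eq_open_near fg. Qed.

End DerivativeRules.

Section GaussEquation.
Context (R : realType) (k m : nat).
Context (eta : 'I_m -> 'I_m -> R) (eta_sym : forall a c, eta a c = eta c a).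
Context (U : set 'rV[R]_k) (F : 'I_m -> 'rV[R]_k -> R) (g : 'rV[R]_k -> 'M[R]_k) (K : R).
Context (oU : open U) (F3 : forall a, Ck 3 U (F a)).

Definition form (u w : 'I_m -> R) : R := \sum_a \sum_c eta a c * (u a * w c).

(* The derivatives are named by variables, since comparing two of them up to
   conversion would unfold the limits that define them. *)
Context (D1 : 'I_k -> 'I_m -> 'rV[R]_k -> R) (D2 : 'I_k -> 'I_k -> 'I_m -> 'rV[R]_k -> R)
  (D3 : 'I_k -> 'I_k -> 'I_k -> 'I_m -> 'rV[R]_k -> R)
  (Gam : 'I_k -> 'I_k -> 'I_k -> 'rV[R]_k -> R)
  (dGam : 'I_k -> 'I_k -> 'I_k -> 'I_k -> 'rV[R]_k -> R).
Context (D1E : forall i a, pd i (F a) = D1 i a)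
  (D2E : forall i j a, pd i (D1 j a) = D2 i j a)
  (D3E : forall i j q a, pd i (D2 j q a) = D3 i j q a)
  (GamE : forall l i j, christoffel g l i j = Gam l i j)
  (dGamE : forall q l i j, pd q (Gam l i j) = dGam q l i j).

Local Notation d1 i x := (fun a : 'I_m => D1 i a x).
Local Notation d2 i j x := (fun a : 'I_m => D2 i j a x).
Local Notation d3 i j q x := (fun a : 'I_m => D3 i j q a x).

Context (g_gram : forall x, U x -> forall i j, g x i j = form (d1 i x) (d1 j x)).
Context (g_unit : forall x, U x -> g x \in unitmx).
(** The factor [K] lets one argument serve two cases: for K = 0, the flat one, the position vector
    need not be normal, and otherwise this is true normality to the hyperquadric. *)
Context (F_normal : forall x, U x -> forall i, K * form (F ^~ x) (d1 i x) = 0).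
Context (hessian_tangent : forall x, U x -> forall i j, exists c : 'I_k -> R,
  forall a, D2 i j a x = \sum_l c l * D1 l a x + K * g x i j * F a x).

Lemma formC u w : form u w = form w u.
Proof.
rewrite /form exchange_big; apply: eq_bigr => a _; apply: eq_bigr => c _.
by rewrite eta_sym [u c * _]mulrC.
Qed.

Lemma formD u v w : form (fun a => u a + v a) w = form u w + form v w.
Proof.
rewrite /form -big_split; apply: eq_bigr => a _.
by rewrite -big_split; apply: eq_bigr => c _; rewrite /= mulrDl mulrDr.
Qed.

Lemma formZ (s : R) u w : form (fun a => s * u a) w = s * form u w.
Proof.
rewrite /form mulr_sumr; apply: eq_bigr => a _.
by rewrite mulr_sumr; apply: eq_bigr => c _; rewrite -mulrA mulrCA.
Qed.

Lemma form_sum (I : finType) (u : I -> 'I_m -> R) w :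
  form (fun a => \sum_i u i a) w = \sum_i form (u i) w.
Proof.
rewrite /form [RHS]exchange_big; apply: eq_bigr => a _ /=.
rewrite [RHS]exchange_big; apply: eq_bigr => c _ /=.
by rewrite mulr_suml mulr_sumr.
Qed.

Lemma derive_form (u w : 'I_m -> 'rV[R]_k -> R) x v :
  (forall a, differentiable (u a) x) -> (forall a, differentiable (w a) x) ->
  'D_v (fun y => form (u ^~ y) (w ^~ y)) x =
  form (fun a => 'D_v (u a) x) (w ^~ x) + form (u ^~ x) (fun a => 'D_v (w a) x).
Proof.
move=> du dw; rewrite /form -big_split.
have duw a c : differentiable (fun y => u a y * w c y) x by exact: differentiableM.
have deuw a c : differentiable (fun y => eta a c * (u a y * w c y)) x.
  by apply: (differentiableM (differentiable_cst _ _)).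
rewrite derive_big => [|a]; last exact: differentiable_big.
apply: eq_bigr => a _; rewrite derive_big //= -big_split.
by apply: eq_bigr => c _; rewrite derive_cmul // derive_mul // mulrDr.
Qed.

Lemma gauss_Ck1 i a : Ck 2 U (D1 i a).
Proof. by rewrite -D1E; have [_] := F3 a; apply. Qed.

Lemma gauss_Ck2 i j a : Ck 1 U (D2 i j a).
Proof. by rewrite -D2E; have [_] := gauss_Ck1 j a; apply. Qed.

Lemma gauss_diff0 x a : U x -> differentiable (F a) x.
Proof. by move=> Ux; have [+ _] := F3 a; apply. Qed.

Lemma gauss_diff1 x i a : U x -> differentiable (D1 i a) x.
Proof. by move=> Ux; have [+ _] := gauss_Ck1 i a; apply. Qed.

Lemma hessianC x i j a : U x -> D2 i j a x = D2 j i a x.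
Proof.
move=> Ux; rewrite -!D2E -!D1E; exact: (derive_comm _ _ oU (CkW (F3 a)) Ux).
Qed.

Lemma third_derivativeC x i j q a : U x -> D3 i j q a x = D3 j i q a x.
Proof.
move=> Ux; rewrite -!D3E -!D2E; exact: (derive_comm _ _ oU (gauss_Ck1 q a) Ux).
Qed.

Lemma gram_derive x i j n : U x -> pd i (fun y => g y j n) x =
  form (d2 i j x) (d1 n x) + form (d2 i n x) (d1 j x).
Proof.
move=> Ux; rewrite [form (d2 i n x) _]formC.
transitivity (pd i (fun y => form (d1 j y) (d1 n y)) x).
  by apply: (derive_congr _ oU Ux) => y Uy; exact: g_gram.
rewrite -(funext (fun a => congr1 (fun h => h x) (D2E i j a))).
rewrite -(funext (fun a => congr1 (fun h => h x) (D2E i n a))).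
exact: derive_form (fun a => gauss_diff1 j a Ux) (fun a => gauss_diff1 n a Ux).
Qed.

(** By [gram_derive] the three derivatives of the metric give six products; since the Hessian is
    symmetric, four of them cancel and the other two are equal. *)
Lemma christoffel_form x l i j : U x -> Gam l i j x =
  \sum_n invmx (g x) l n * form (d2 i j x) (d1 n x).
Proof.
move=> Ux; rewrite -GamE /christoffel mulr_sumr; apply: eq_bigr => n _.
have E p q : form (d2 p q x) =1 form (d2 q p x).
  by move=> w; apply: eq_bigr => a _; apply: eq_bigr => c _; rewrite hessianC.
rewrite !gram_derive // (E j i) (E n i) (E n j); by field.
Qed.

Lemma gram_sym x i j : U x -> g x i j = g x j i.
Proof. by move=> Ux; rewrite !g_gram // formC. Qed.

(** The Gauss formula. Pairing the decomposition in [hessian_tangent] with the tangent vectors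
    removes the normal term, and the Gram matrix is invertible, so the coefficients must be the
    Christoffel symbols of [christoffel_form]. *)
Lemma hessian_christoffel x i j a : U x ->
  D2 i j a x = \sum_l Gam l i j x * D1 l a x + K * g x i j * F a x.
Proof.
move=> Ux; have [c hc] := hessian_tangent Ux i j.
suff cE l : Gam l i j x = c l.
  by rewrite hc; congr (_ + _); apply: eq_bigr => l _; rewrite cE.
have low n : form (d2 i j x) (d1 n x) = \sum_p c p * g x p n.
  rewrite (funext hc) formD formZ mulrAC F_normal // mul0r addr0 form_sum.
  by apply: eq_bigr => p _; rewrite formZ g_gram.
rewrite christoffel_form //.
transitivity (((\row_p c p) *m g x *m invmx (g x)) 0 l); last first.
  by rewrite mulmxK ?g_unit // mxE.
rewrite mxE; apply: eq_bigr => n _; rewrite low mulrC; congr (_ * _).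
  by rewrite mxE; apply: eq_bigr => p _; rewrite mxE.
suff /matrixP/(_ n l) : (invmx (g x))^T = invmx (g x) by rewrite mxE.
rewrite trmx_inv; congr invmx; apply/matrixP => p q; rewrite mxE; exact: gram_sym.
Qed.

Lemma gram_Ck : Ck 2 U g.
Proof.
apply/(Ck_mxP 2 g oU) => i j.
apply: (Ck_eq oU (f := fun y => form (d1 i y) (d1 j y))) => [y Uy|].
  by rewrite g_gram.
apply: Ck_sum => // a _; apply: Ck_sum => // c _.
apply: CkM => //; first exact: Ck_cst.
apply: CkM => //; exact: gauss_Ck1.
Qed.

Lemma christoffel_diff x l i j : U x -> differentiable (Gam l i j) x.
Proof.
move: x; suff [] : Ck 1 U (Gam l i j) by [].
apply: (Ck_eq oU (f := fun y => \sum_n invmx (g y) l n * form (d2 i j y) (d1 n y))).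
  by move=> y Uy; rewrite christoffel_form.
apply: Ck_sum => // n _; apply: CkM => //.
  exact: (Ck_mxP 1 _ oU).1 (Ck_invmx oU g_unit (CkW gram_Ck)) l n.
apply: Ck_sum => // a _; apply: Ck_sum => // c _.
apply: CkM => //; first exact: Ck_cst.
apply: CkM => //; first exact: gauss_Ck2.
exact: CkW (gauss_Ck1 n c).
Qed.

(** The Gauss formula is differentiated and paired with a tangent vector. The terms along [F]
    disappear, except that differentiating the factor [F] of the normal term produces the tangent
    vector [D1 i], whence the Kronecker delta. *)
Lemma third_derivative_form x i j q p : U x ->
  form (d3 i j q x) (d1 p x) =
  \sum_l (dGam i l j q x + \sum_n Gam l i n x * Gam n j q x
          + K * g x j q * (l == i)%:R) * g x l p.
Proof.
move=> Ux.
have gd : differentiable (fun y => g y j q) x.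
  by have [+ _] := (Ck_mxP 2 g oU).1 gram_Ck j q; apply.
pose dg := pd i (fun y => g y j q) x.
have E a : D3 i j q a x =
    \sum_l (dGam i l j q x * D1 l a x + Gam l j q x * D2 i l a x)
    + (K * dg * F a x + K * g x j q * D1 i a x).
  transitivity (pd i (fun y => \sum_l Gam l j q y * D1 l a y + K * g y j q * F a y) x).
    rewrite -D3E; apply: (derive_congr _ oU Ux) => y Uy; exact: hessian_christoffel.
  have dl l : differentiable (fun y => Gam l j q y * D1 l a y) x.
    by apply: differentiableM; [exact: christoffel_diff | exact: gauss_diff1].
  have dKg : differentiable (fun y => K * g y j q) x.
    exact: (differentiableM (differentiable_cst _ _)).
  have dF := gauss_diff0 a Ux.
  rewrite /pd derive_add; [|exact: differentiable_big|exact: differentiableM].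
  rewrite derive_big //; congr (_ + _).
    apply: eq_bigr => l _; rewrite -D2E -dGamE.
    exact: (derive_mul _ (christoffel_diff l j q Ux) (gauss_diff1 l a Ux)).
  by rewrite derive_mul // derive_cmul // -D1E.
rewrite (funext E) !formD !formZ mulrAC F_normal // mul0r add0r form_sum.
have hf l : form (d2 i l x) (d1 p x) = \sum_n Gam n i l x * g x n p.
  rewrite (funext (fun a => hessian_christoffel i l a Ux)).
  rewrite formD formZ mulrAC F_normal // mul0r addr0 form_sum.
  by apply: eq_bigr => n _; rewrite formZ g_gram.
transitivity (\sum_l (dGam i l j q x * g x l p
   + (\sum_n Gam l i n x * Gam n j q x) * g x l p
   + K * g x j q * (l == i)%:R * g x l p)); last first.
  by apply: eq_bigr => l _; rewrite !mulrDl.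
rewrite !big_split /=; congr (_ + _); last first.
  rewrite (bigD1 i) //= eqxx mulr1 big1 ?addr0 ?g_gram // => l /negPf ->.
  by rewrite mulr0 mul0r.
rewrite (eq_bigr (fun l => dGam i l j q x * g x l p
   + Gam l j q x * \sum_n Gam n i l x * g x n p)); last first.
  by move=> l _; rewrite formD !formZ hf g_gram.
rewrite big_split /=; congr (_ + _).
under eq_bigr do rewrite mulr_sumr.
rewrite exchange_big; apply: eq_bigr => l _ /=; rewrite mulr_suml.
by apply: eq_bigr => n _; ring.
Qed.

(** Third derivatives commute, so the bracket of [third_derivative_form] is symmetric in [i] and
    [j], the metric being invertible; its antisymmetric part is the curvature plus the terms in
    [K]. *)
Lemma gauss_curvature_aux x l q i j : U x -> curvature g l q i j x =
  - K * (g x j q * (l == i)%:R - g x i q * (l == j)%:R).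
Proof.
move=> Ux.
pose w i j l := dGam i l j q x + \sum_n Gam l i n x * Gam n j q x
          + K * g x j q * (l == i)%:R.
have : (\row_l (w i j l - w j i l)) *m g x = 0.
  apply/rowP => p; rewrite !mxE.
  under eq_bigr do rewrite mxE mulrBl.
  rewrite sumrB -!third_derivative_form //.
  by rewrite (funext (fun a => third_derivativeC i j q a Ux)) subrr.
move=> /(congr1 (mulmx^~ (invmx (g x)))); rewrite mulmxK ?g_unit // mul0mx.
move=> /rowP/(_ l); rewrite !mxE /w /curvature.
under [X in _ -> _ + X = _]eq_bigr do rewrite !GamE.
rewrite !GamE !dGamE sumrB => E.
apply/eqP; rewrite -subr_eq0 -[X in _ == X]E; apply/eqP; ring.
Qed.

End GaussEquation.

(** In this sign convention the sectional curvature is - K. *)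
Lemma gauss_curvature (R : realType) (k m : nat) (eta : 'I_m -> 'I_m -> R)
  (U : set 'rV[R]_k) (F : 'I_m -> 'rV[R]_k -> R) (g : 'rV[R]_k -> 'M[R]_k) (K : R) :
  (forall a c, eta a c = eta c a) -> open U -> (forall a, Ck 3 U (F a)) ->
  (forall x, U x -> forall i j,
     g x i j = form eta (fun a => pd i (F a) x) (fun a => pd j (F a) x)) ->
  (forall x, U x -> g x \in unitmx) ->
  (forall x, U x -> forall i, K * form eta (F ^~ x) (fun a => pd i (F a) x) = 0) ->
  (forall x, U x -> forall i j, exists c : 'I_k -> R, forall a,
     pd i (pd j (F a)) x = \sum_l c l * pd l (F a) x + K * g x i j * F a x) ->
  forall x l q i j, U x -> curvature g l q i j x =
    - K * (g x j q * (l == i)%:R - g x i q * (l == j)%:R).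
Proof.
move=> es oU F3 gg gu Fn h x l q i j Ux.
exact: (@gauss_curvature_aux R k m eta es U F g K oU F3
  (fun i a => pd i (F a)) (fun i j a => pd i (pd j (F a)))
  (fun i j q a => pd i (pd j (pd q (F a)))) (christoffel g)
  (fun q l i j => pd q (christoffel g l i j))).
Qed.

(** * Injective immersions between spaces of equal dimension *)

Section LinearApproximation.
Context (R : realType) (V W : normedModType R).

Lemma is_diff_linear (f : V -> W) (df : {linear V -> W}) x : continuous df ->
  (forall e : R, 0 < e -> \forall v \near 0, `|f (v + x) - (f x + df v)| <= e * `|v|) ->
  is_diff x f df.
Proof.
move=> dfc dfo; have fo : f \o shift x = cst (f x) + df +o_ 0 id.
  by apply/eqaddoP => e e0; exact: dfo.
have dE : 'd f x = df :> (V -> W) by exact: diff_unique fo.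
by apply: DiffDef => //; apply/diff_locallyP; rewrite dE.
Qed.

Lemma differentiable_near (f : V -> W) x (e : R) : differentiable f x -> 0 < e ->
  \forall v \near 0, `|f (v + x) - (f x + 'd f x v)| <= e * `|v|.
Proof. by move=> /diff_locallyP[_ /eqaddoP dfo] e0; exact: dfo. Qed.

Lemma continuous_center (h : V -> W) y :
  {for y, continuous h} -> h (w + y) - h y @[w --> 0] --> 0.
Proof.
move=> /cvgrPdist_le hc; apply/cvgrPdist_le => e e0.
have : \forall z \near y, `|h y - h z| <= e by exact: hc.
rewrite (near_shift 0 y) /= subr0; apply: filterS => w.
by rewrite sub0r normrN distrC.
Qed.

End LinearApproximation.

Section SquaredNorm.
Context (R : realType).

(** The norm of ['rV[R]_n] is the maximum norm, which is not differentiable; minimisation and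
    orthogonality require the Euclidean square. *)
Definition sqn n (v : 'rV[R]_n) : R := (v *m v^T) 0 0.

Lemma sqnE n (v : 'rV[R]_n) : sqn v = \sum_i v 0 i ^+ 2.
Proof. by rewrite /sqn mxE; apply: eq_bigr => i _; rewrite mxE expr2. Qed.

Lemma sqn_ge0 n (v : 'rV[R]_n) : 0 <= sqn v.
Proof. by rewrite sqnE sumr_ge0 // => i _; exact: sqr_ge0. Qed.

Lemma sqn_eq0 n (v : 'rV[R]_n) : (sqn v == 0) = (v == 0).
Proof.
apply/eqP/eqP => [|->]; last by rewrite /sqn mul0mx mxE.
rewrite sqnE => /eqP; rewrite psumr_eq0 => [/allP v0|i _]; last exact: sqr_ge0.
apply/rowP => i; rewrite mxE; apply/eqP.
by have := v0 i (mem_index_enum _); rewrite sqrf_eq0.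
Qed.

Lemma sqn_gt0 n (v : 'rV[R]_n) : (0 < sqn v) = (v != 0).
Proof. by rewrite lt0r sqn_eq0 sqn_ge0 andbT. Qed.

Lemma sqn_add_le n (u v : 'rV[R]_n) : sqn (u + v) <= 2 * sqn u + 2 * sqn v.
Proof.
rewrite !sqnE !mulr_sumr -big_split /=; apply: ler_sum => i _; rewrite mxE.
have := sqr_ge0 (u 0 i - v 0 i); set a := u 0 i; set b := v 0 i => ab; nra.
Qed.

Lemma differentiable_sqn (V : normedModType R) n (f : V -> 'rV[R]_n) x :
  differentiable f x -> differentiable (fun y => sqn (f y)) x.
Proof.
move=> /differentiable_mxP df.
rewrite (_ : (fun y => _) = fun y => \sum_i f y 0 i * f y 0 i); last first.
  by apply/funext => y; rewrite sqnE; apply: eq_bigr => i _; rewrite expr2.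
by apply: differentiable_big => i; apply: differentiableM; exact: df.
Qed.

Lemma derive_sqn (V : normedModType R) n (f : V -> 'rV[R]_n) x v :
  differentiable f x ->
  'D_v (fun y => sqn (f y)) x = 2 * ('D_v f x *m (f x)^T) 0 0.
Proof.
move=> df; have dfi i : differentiable (fun y => f y 0 i) x.
  by have /differentiable_mxP := df; apply.
rewrite (_ : (fun y => _) = fun y => \sum_i f y 0 i * f y 0 i); last first.
  by apply/funext => y; rewrite sqnE; apply: eq_bigr => i _; rewrite expr2.
rewrite derive_big => [|i]; last exact: differentiableM.
rewrite mxE mulr_sumr; apply: eq_bigr => i _.
rewrite derive_mul // mxE derive_mxE // [f x 0 i * _]mulrC; ring.
Qed.

Lemma row_free_ker0 k n (J : 'M[R]_(k, n)) :
  row_free J <-> forall v : 'rV_k, v *m J = 0 -> v = 0.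
Proof.
split=> [Jf v vJ|Jker]; first by apply: (row_free_inj Jf); rewrite vJ mul0mx.
rewrite -kermx_eq0; apply/eqP/row_matrixP => i; rewrite row0.
by apply: Jker; apply/sub_kermxP; exact: row_sub.
Qed.

Lemma gram_row_free_unit k n (J : 'M[R]_(k, n)) : row_free J -> J *m J^T \in unitmx.
Proof.
move=> /row_free_ker0 Jker; rewrite -row_free_unit; apply/row_free_ker0 => v vJJ.
apply: Jker; apply/eqP; rewrite -sqn_eq0 /sqn trmx_mul mulmxA -[_ *m J *m _]mulmxA vJJ.
by rewrite mul0mx mxE.
Qed.

End SquaredNorm.

Section Jacobian.
Context (R : realType).

Lemma jacobianE n m (f : 'rV[R]_n -> 'rV[R]_m) x i j : differentiable f x ->
  jacobian f x i j = 'D_(delta_mx 0 i) (fun y => f y 0 j) x.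
Proof.
by move=> df; rewrite -derive_mxE // deriveEjacobian // -rowE [RHS]mxE.
Qed.

Lemma jacobian_comp n m p (f : 'rV[R]_n -> 'rV[R]_m) (g : 'rV[R]_m -> 'rV[R]_p) x :
  differentiable f x -> differentiable g (f x) ->
  jacobian (g \o f) x = jacobian f x *m jacobian g (f x).
Proof.
move=> df dg; have dgf : differentiable (g \o f) x by exact: differentiable_comp.
apply/row_matrixP => i; rewrite !rowE mulmxA.
apply: (etrans (esym (deriveEjacobian _ dgf))); rewrite -(deriveEjacobian _ df).
apply: etrans (deriveEjacobian _ dg); rewrite (deriveE _ dgf) (deriveE _ df) (deriveE _ dg).
by have /(congr1 (fun h => h (delta_mx 0 i))) := diff_comp df dg.
Qed.

Lemma near_eq_jacobian n m (f g : 'rV[R]_n -> 'rV[R]_m) x :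
  {near x, f =1 g} -> differentiable f x -> jacobian f x = jacobian g x.
Proof.
move=> fg df; have dg := near_eq_differentiable fg df.
apply/matrixP => i j; apply: (etrans (jacobianE i j df)).
apply: etrans (esym (jacobianE i j dg)).
by apply: near_eq_derive; apply: filterS fg => y ->.
Qed.

Lemma jacobian_id n (x : 'rV[R]_n) : jacobian id x = 1%:M.
Proof.
apply/row_matrixP => i; by rewrite !rowE mulmx1 -deriveEjacobian ?derive_id.
Qed.

Lemma jacobian_Ck n m r (U : set 'rV[R]_n) (f : 'rV[R]_n -> 'rV[R]_m) :
  open U -> Ck r.+1 U f -> Ck r U (jacobian f).
Proof.
move=> oU fk; have [df dfk] := fk; apply/(Ck_mxP r _ oU) => i j.
have [_ /(_ (delta_mx 0 i))] := (Ck_mxP r.+1 f oU).1 fk 0 j.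
by apply: Ck_eq => // x Ux; rewrite jacobianE //; exact: df.
Qed.

(* For [z] near [f x], a minimiser of [y |-> |f y - z|^2] on a closed ball around [x]
   is interior because [f] is injective, hence a zero of [f y - z]. *)
Lemma injective_open k m (U : set 'rV[R]_k) (f : 'rV[R]_k -> 'rV[R]_m) (x : 'rV[R]_k) :
  open U -> U x ->
  (forall y z, U y -> U z -> f y = f z -> y = z) ->
  (forall y, U y -> differentiable f y) ->
  (forall y, U y -> row_full (jacobian f y)) ->
  nbhs (f x) (f @` U).
Proof.
move=> oU Ux injf df full.
have [r /= r0 rU] : exists2 r : R, 0 < r & closed_ball x r `<=` U.
  have /nbhs_closedballP[r] : nbhs x U by exact: open_nbhs_nbhs.
  by exists r%:num.
have {}rU (y : 'rV[R]_k) : `|x - y| <= r -> U y.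
  by move=> xy; apply: rU; rewrite closed_ballE.
have qC (z : 'rV[R]_m) y : U y -> {for y, continuous (fun y => sqn (f y - z))}.
  move=> Uy; apply: differentiable_continuous; apply: differentiable_sqn.
  by apply: differentiableB; [exact: df | exact: differentiable_cst].
have cball : compact [set y | `|x - y| <= r].
  apply: bounded_closed_compact; last exact: closed_closed_ball_.
  exists (`|x| + r); split; [exact: num_real|] => M ltM y /= xy.
  rewrite (le_trans _ (ltW ltM)) // -[y](subKr x).
  by rewrite (le_trans (ler_normB _ _)) // lerD2l.
have [d /= d0 dP] : exists2 d : R, 0 < d &
    forall y, `|x - y| = r -> d <= sqn (f y - f x).
  have csph : compact [set y | `|x - y| = r].
    apply: subclosed_compact cball _ => [|y /= ->//].
    have -> : [set y | `|x - y| = r] = [set y | `|x - y| <= r] `&` ~` ball x r.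
      rewrite -ball_normE; apply/seteqP; split=> y /= => [->|[xyr /negP]].
        by rewrite lexx ltxx.
      by rewrite -leNgt => rxy; apply/eqP; rewrite eq_le xyr.
    by apply: closedI; [exact: closed_closed_ball_ | exact/open_closedC/ball_open].
  (* The sphere is empty in dimension 0, and any positive [d] then works. *)
  have [[y0 y0r]|nosph] := pselect ([set y | `|x - y| = r] !=set0); last first.
    by exists 1 => // y yr; exfalso; apply: nosph; exists y.
  have [||c] := @EVT_min_rV R k (fun y => sqn (f y - f x)) _ _ csph.
  - by exists y0.
  - apply: continuous_in_subspaceT => y; rewrite inE /= => yr.
    by apply: qC; apply: rU; rewrite yr.
  - rewrite inE /= => cr cmin; exists (sqn (f c - f x)); last first.
      by move=> y yr; apply: cmin; rewrite inE.
    rewrite sqn_gt0 subr_eq0; apply/eqP => /(injf _ _ (rU c _) Ux) cx.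
    have {}cx : c = x by apply: cx; rewrite cr.
    by move: cr r0; rewrite cx subrr normr0 => <-; rewrite ltxx.
(* A minimiser [c] on the sphere would give, by [sqn_add_le], d <= 2 |f c - z|^2 + 2 |z - f x|^2 <=
   4 |f x - z|^2 < d. *)
have : \forall z \near f x, sqn (f x - z) < d / 4.
  have /cvgrPdist_lt : {for f x, continuous (fun z : 'rV[R]_m => sqn (f x - z))}.
    apply: differentiable_continuous; apply: differentiable_sqn.
    by apply: differentiableB; [exact: differentiable_cst | by []].
  move=> /(_ (d / 4) (divr_gt0 d0 (ltr0Sn _ 3))); apply: filterS => z.
  rewrite subrr (_ : sqn 0 = 0); last by apply/eqP; rewrite sqn_eq0.
  by rewrite sub0r normrN ger0_norm // sqn_ge0.
apply: filterS => z zd.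
have [||c] := @EVT_min_rV R k (fun y => sqn (f y - z)) _ _ cball.
- by exists x; rewrite /= subrr normr0 ltW.
- by apply: continuous_in_subspaceT => y; rewrite inE /= => /rU; exact: qC.
rewrite inE /= => cr cmin.
have Uc := rU c cr.
have cltr : `|x - c| < r.
  rewrite lt_neqAle cr andbT; apply/eqP => /dP dc.
  have : sqn (f c - z) <= sqn (f x - z) by apply: cmin; rewrite inE /= subrr normr0 ltW.
  have := sqn_add_le (f c - z) (z - f x); rewrite subrKA.
  have -> : sqn (z - f x) = sqn (f x - z).
    by rewrite !sqnE; apply: eq_bigr => i _; rewrite !mxE; ring.
  by move: dc zd; lra.
exists c => //; apply/eqP; rewrite -subr_eq0; apply/eqP.
suff Jw (v : 'rV[R]_k) : v *m jacobian f c *m (f c - z)^T = 0.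
  have /row_fullP[B BJ] := full c Uc.
  apply: trmx_inj; rewrite trmx0 -[_^T]mul1mx -BJ; apply/row_matrixP => i.
  by rewrite rowE !mulmxA Jw row0.
rewrite -deriveEjacobian; last exact: df.
have [e /= e0 einr] : exists2 e : R, 0 < e & forall t, `|t| < e -> `|x - (c + t *: v)| <= r.
  have vp : 0 < `|v| + 1 by rewrite ltr_wpDl.
  exists ((r - `|x - c|) / (`|v| + 1)); first by rewrite divr_gt0 // subr_gt0.
  move=> t; rewrite ltr_pdivlMr // => te.
  rewrite opprD addrA (le_trans (ler_normB _ _)) // normrZ.
  have : `|t| * `|v| <= `|t| * (`|v| + 1) by rewrite ler_wpM2l // lerDl.
  by move: te; lra.
have dfz : differentiable (fun y => f y - z) c.
  by apply: differentiableB; [exact: df | exact: differentiable_cst].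
have dz : 'D_v (fun y => f y - z) c = 'D_v f c.
  by rewrite deriveB ?derive_cst ?subr0 //; exact/diff_derivable/df.
have [_ D0] : is_derive (0 : R) (1 : R) (fun t => sqn (f (c + t *: v) - z)) 0.
  apply: (@derive1_at_min _ _ (- e) e).
  - by rewrite ge0_cp // ltW.
  - move=> t; rewrite in_itv /= -ltr_norml => te.
    apply: (@ex_derive _ _ _ _ _ _ ('D_v (fun y => sqn (f y - z)) (c + t *: v))).
    apply: (is_derive_line (f := fun y => sqn (f y - z))).
    apply: differentiable_sqn; apply: differentiableB; last exact: differentiable_cst.
    exact/df/rU/einr.
  - by rewrite in_itv /= oppr_lt0 e0.
  - move=> t; rewrite in_itv /= -ltr_norml => te; rewrite scale0r addr0.
    by apply: cmin; rewrite inE /=; exact: einr.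
have := @is_derive_line _ _ (fun y => sqn (f y - z)) c v 0.
rewrite scale0r addr0 => /(_ (differentiable_sqn dfz)) [_].
rewrite D0 derive_sqn // dz => /esym/eqP; rewrite mulf_eq0 pnatr_eq0 /= => /eqP E.
by apply/matrixP => i j; rewrite !ord1 E mxE.
Qed.

(** With v = h(y + w) - h(y), the expansion of [f] at h(y) reads w = vJ + o(v); multiplied by [L] it
    becomes v - wL = o(v). Continuity of [h] makes [v] small, and the same relation bounds |v| by a
    multiple of |w|. *)
Lemma inverse_differentiable k m (f : 'rV[R]_k -> 'rV[R]_m) (h : 'rV[R]_m -> 'rV[R]_k)
    (L : 'M[R]_(m, k)) (y : 'rV[R]_m) :
  differentiable f (h y) -> jacobian f (h y) *m L = 1%:M ->
  {for y, continuous h} -> (\forall z \near y, f (h z) = z) ->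
  is_diff y h (mulmxr L).
Proof.
move=> df JL hc fh.
have lc n p (A : 'M[R]_(n, p)) : continuous (mulmxr A : 'rV[R]_n -> 'rV[R]_p).
  move=> v; apply/continuous_mxP => i j.
  apply: (differentiable_continuous (f := fun u : 'rV[R]_n => (u *m A) i j)).
  rewrite (_ : (fun u => _) = fun u : 'rV[R]_n => \sum_l u i l * A l j).
    apply: differentiable_big => l; apply: differentiableM; last exact: differentiable_cst.
    exact: differentiable_coord.
  by apply/funext => u; rewrite mxE.
have [C C0 CL] := linear_lipschitz (lc _ _ L).
apply: is_diff_linear => [|e e0]; first exact: lc.
(* The first bound gives C b |v| <= |v| / 2, hence |v| <= 2 C |w|; the second then gives C b |v| <=
   e |w|. *)
pose b : R := Num.min (2 * C)^-1 (e / (2 * C ^+ 2)).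
have b0 : 0 < b.
  by rewrite lt_min invr_gt0 divr_gt0 ?mulr_gt0 ?exprn_gt0.
have nf : \forall v \near (0 : 'rV[R]_k),
    `|f (v + h y) - (f (h y) + v *m jacobian f (h y))| <= b * `|v|.
  by apply: filterS (differentiable_near df b0) => v; rewrite -deriveE // deriveEjacobian.
have hc0 := continuous_center hc.
have fh0 : \forall w \near (0 : 'rV[R]_m), f (h (w + y)) = w + y.
  by have := fh; rewrite (near_shift 0 y) /= subr0.
have fhy : f (h y) = y by exact: nbhs_singleton fh.
move: fh0 (hc0 _ nf); apply: filterS2 => w fhw /=.
rewrite subrK fhw fhy /=.
set v := h (w + y) - h y => vb.
have -> : h (w + y) - (h y + w *m L) = v - w *m L by rewrite /v opprD addrA.
have vE : v - w *m L = - ((w + y - (y + v *m jacobian f (h y))) *m L).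
  rewrite opprD addrA addrK mulmxBl -mulmxA JL mulmx1 opprB.
  by rewrite [v - _]addrC addrC.
have vb' : `|v - w *m L| <= C * (b * `|v|).
  rewrite vE normrN; apply: le_trans (CL _) _.
  by rewrite ler_wpM2l // ltW.
have v2 : `|v| <= 2 * (C * `|w|).
  have : `|v| <= `|v - w *m L| + `|w *m L| by rewrite -{1}[v](subrK (w *m L)) ler_normD.
  have wL : `|w *m L| <= C * `|w| by exact: CL.
  have bC : C * (b * `|v|) <= 2^-1 * `|v|.
    rewrite mulrA ler_wpM2r // -ler_pdivlMl //.
    have : b <= (2 * C)^-1 by rewrite ge_min lexx.
    by rewrite invfM mulrC.
  by move: vb' wL bC; lra.
apply: (le_trans vb'); apply: (@le_trans _ _ (C * (b * (2 * (C * `|w|))))).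
  by apply: ler_wpM2l (ltW C0) _ _ _; exact: ler_wpM2l (ltW b0) _ _ v2.
have -> : C * (b * (2 * (C * `|w|))) = (b * (2 * C ^+ 2)) * `|w| by ring.
rewrite ler_wpM2r // -ler_pdivlMr ?mulr_gt0 ?exprn_gt0 //.
by rewrite ge_min lexx orbT.
Qed.

(** Bootstrapping: the derivative of [h] in the direction [v] is v L(h(y)) with [L] of every class,
    so each class reached by [h] yields the next one. *)
Lemma inverse_Ck k m r (U : set 'rV[R]_k) (U' : set 'rV[R]_m)
    (f : 'rV[R]_k -> 'rV[R]_m) (h : 'rV[R]_m -> 'rV[R]_k) :
  open U -> open U' -> smooth_on U f -> (forall x, U x -> row_free (jacobian f x)) ->
  (forall y, U' y -> U (h y)) -> (forall y, U' y -> {for y, continuous h}) ->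
  (forall y, U' y -> f (h y) = y) -> Ck r U' h.
Proof.
move=> oU oU' fs Jf hU hc fh.
(* A right inverse given by a formula in the entries of [J], which makes sense even though [k] and
   [m] are distinct expressions and [J] is not formally square. *)
pose J := jacobian f; pose L x := (J x)^T *m invmx (J x *m (J x)^T).
have Jk s : Ck s U J by exact: jacobian_Ck.
have Lk s : Ck s U L.
  apply: Ck_mulmx => //; first exact: Ck_trmx.
  apply: Ck_invmx => // [x Ux|]; first exact/gram_row_free_unit/Jf.
  by apply: Ck_mulmx => //; exact: Ck_trmx.
have JL x : U x -> J x *m L x = 1%:M.
  by move=> Ux; rewrite mulmxA mulmxV //; exact/gram_row_free_unit/Jf.
have dh y : U' y -> is_diff y h (mulmxr (L (h y))).
  move=> U'y; apply: inverse_differentiable; [|exact/JL/hU|exact: hc|].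
    by have [+ _] := fs 1%N; apply; exact: hU.
  by apply: filterS (near_open oU' U'y) => z; exact: fh.
elim: r => [|r IH]; first exact: hc.
split=> [y U'y|v]; first by have [] := dh y U'y.
apply: (Ck_eq oU' (f := fun y => v *m L (h y))).
  move=> y U'y; have [dhy dE] := dh y U'y.
  by rewrite deriveE // dE.
apply: Ck_mulmx => //; first exact: Ck_cst.
exact: (Ck_comp_mx oU' oU hU IH (Lk r)).
Qed.

End Jacobian.

(** * Euclidean space as a manifold *)

Section EuclideanManifold.
Context (R : realType).

Lemma rV_second_countable k : @second_countable 'rV[R]_k.
Proof.
pose B := [set ball (map_mx ratr qn.1 : 'rV[R]_k) (qn.2.+1%:R^-1 : R)
            | qn in [set: 'rV[rat]_k * nat]].
exists B; first exact: sub_countable (card_image_le _ _) (countableP _).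
split=> [_ [qn _ <-]|x A /nbhs_ballP[e /= e0 eA]]; first exact: ball_open.
have e20 : 0 < e / 2 by rewrite divr_gt0.
have [n ne] : exists n : nat, n.+1%:R^-1 < e / 2 :> R.
  exists (Num.truncn (e / 2)^-1); rewrite invf_plt ?posrE //.
  by rewrite truncnS_gt.
have r0 : 0 < n.+1%:R^-1 :> R by rewrite invr_gt0.
have /choice[q qP] : forall i : 'I_k, exists q : rat, `|ratr q - x 0 i| < n.+1%:R^-1 :> R.
  move=> i; have xr : x 0 i < x 0 i + n.+1%:R^-1 by rewrite ltrDl.
  have [q] := rat_in_itvoo xr.
  rewrite in_itv /= => /andP[xq qx]; exists q.
  by rewrite gtr0_norm ?subr_gt0 // ltrBlDl.
pose c : 'rV[R]_k := map_mx ratr (\row_i q i).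
have xc : `|c - x| < n.+1%:R^-1.
  rewrite [ltLHS]/Num.Def.normr /= mx_normrE; apply/bigmax_ltP; split => // -[i j] _ /=.
  by rewrite !mxE ord1; exact: qP.
exists (ball c (n.+1%:R^-1)).
  split; last by rewrite -ball_normE.
  by exists (\row_i q i, n).
move=> y; rewrite -ball_normE /= => cy; apply: eA; rewrite -ball_normE /=.
rewrite -(subrKA c) (le_lt_trans (ler_normD _ _)) // distrC [e]splitr.
by rewrite ltrD // (lt_trans _ ne).
Qed.

Lemma euclidean_manifold k : manifold (euclidean R k).
Proof.
split.
- exact: norm_hausdorff.
- exact: rV_second_countable.
- by move=> p; exists tt.
- move=> c; split=> //=.
  + exact: openT.
  + by rewrite image_id; exact: openT.
  + by apply: continuous_subspaceT => x; exact: cvg_id.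
  + by apply: continuous_subspaceT => x; exact: cvg_id.
- move=> c d r /=; rewrite setIid image_id.
  by apply/(Ck_mxP r _ openT) => i j; exact: Ck_coord.
Qed.

Lemma tangent_euclidean_id k c d (p : euclidean R k) :
  tangent_mx (idfun : euclidean R k -> euclidean R k) c d p = 1%:M.
Proof. exact: jacobian_id. Qed.

Lemma normed_simply_connected (V : normedModType R) : simply_connected R V.
Proof.
have segC (p q : V) : continuous (fun t : R => (1 - t) *: p + t *: q).
  move=> t; apply: cvgD; last by apply: cvgZr_tmp; exact: cvg_id.
  by apply: cvgZr_tmp; apply: cvgB; [exact: cvg_cst | exact: cvg_id].
split.
- by exists 0.
- move=> p q; exists (fun t => (1 - t) *: p + t *: q); split.
  + by apply: continuous_subspaceT; exact: segC.
  + by rewrite subr0 scale1r scale0r addr0.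
  + by rewrite subrr scale0r scale1r add0r.
move=> gamma gc g01.
exists (fun st => (1 - st.1) *: gamma st.2 + st.1 *: gamma 0); split.
(* The homotopy is the straight one to the base point; [gamma] is continuous on [0, 1] only, so
   limits are taken within the square. *)
- apply/subspace_continuousP => -[s t] [/= s01 t01].
  have fstC : (fun st : R * R => st.1) @ within (`[0, 1] `*` `[0, 1]) (nbhs (s, t)) --> s.
    by apply: cvg_trans (@cvg_fst _ _ (nbhs s) (nbhs t) _); apply: cvg_app; exact: cvg_within.
  have gC : (fun st : R * R => gamma st.2) @ within (`[0, 1] `*` `[0, 1]) (nbhs (s, t)) --> gamma t.
    have /subspace_continuousP/(_ t t01) gt := gc.
    move=> A /gt gA; exists (setT, [set u | `[0, 1]%classic u -> A (gamma u)]).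
      by split; [exact: filterT | exact: gA].
    by move=> [u v] /= [_ Av] [_ v01]; exact: Av.
  apply: cvgD; last by apply: cvgZr_tmp.
  by apply: cvgZ => //; apply: cvgB => //; exact: cvg_cst.
- by move=> t _ /=; rewrite subr0 scale1r scale0r addr0.
- by move=> t _ /=; rewrite subrr scale0r scale1r add0r.
- move=> s _ /=; rewrite -g01; split.
    by rewrite -scalerDl subrK scale1r.
  by rewrite -scalerDl subrK scale1r.
Qed.

End EuclideanManifold.

(** * The group AN and completeness of its metric *)

Section RealDerivatives.
Context (R : realType).
Implicit Types (f g : R -> R) (x : R).

Local Notation isD x f d := (is_derive x (1 : R) f d).

Lemma Ck_id (V : normedModType R) r (U : set V) : Ck r U id.
Proof.
case: r => [|r]; first by move=> x _; exact: cvg_id.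
split=> // v; rewrite (_ : 'D_v id = fun=> v); first exact: Ck_cst.
by apply/funext => x; rewrite derive_id.
Qed.

Lemma isD_cst (c x : R) : isD x (fun=> c) 0.
Proof. exact: is_derive_cst. Qed.

Lemma isD_add f g x (f' g' : R) : isD x f f' -> isD x g g' -> isD x (fun y => f y + g y) (f' + g').
Proof. by move=> df dg; exact: (is_deriveD df dg). Qed.

Lemma isD_mul f g x (f' g' : R) : isD x f f' -> isD x g g' ->
  isD x (fun y => f y * g y) (f' * g x + f x * g').
Proof.
by move=> df dg; apply: (is_derive_eq (is_deriveM df dg)); rewrite addrC [f' * _]mulrC.
Qed.

Lemma isD_cmul (c : R) f x (f' : R) : isD x f f' -> isD x (fun y => c * f y) (c * f').
Proof. by move=> df; apply: (is_derive_eq (isD_mul (isD_cst c x) df)); rewrite mul0r add0r. Qed.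

Lemma isD_comp (phi : R -> R) f x (d f' : R) : isD (f x) phi d -> isD x f f' ->
  isD x (fun y => phi (f y)) (d * f').
Proof.
move=> dphi [/derivable1_diffP df <-].
have [/derivable1_diffP dc <-] := derive_scalar_comp (1 : R) df dphi.
exact: DeriveDef.
Qed.

Lemma isD_inv f x (f' : R) : f x != 0 -> isD x f f' -> isD x (fun y => (f y)^-1) (- f' / f x ^+ 2).
Proof.
move=> fx0 [df <-]; apply: DeriveDef; first exact: derivableV.
by rewrite deriveV // /GRing.scale /= mulNr mulrC mulNr.
Qed.

Lemma isD_expR_cmul (c x : R) : isD x (fun y => expR (c * y)) (c * expR (c * x)).
Proof.
apply: (is_derive_eq (isD_comp (is_derive_expR _) (isD_cmul c (is_derive_id x 1)))).
by rewrite mulr1 mulrC.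
Qed.

Lemma derive1_row k (gamma gamma' : R -> 'rV[R]_k) :
  (forall s i, isD s (fun t => gamma t 0 i) (gamma' s 0 i)) -> derive1 gamma = gamma'.
Proof.
move=> dg; apply/funext => s; rewrite derive1E.
have d : derivable gamma s 1.
  by apply/derivable_mxP => i j; rewrite ord1; have [] := dg s j.
by rewrite derive_mx //; apply/rowP => i; rewrite mxE; have [_ ->] := dg s i.
Qed.

(* [D] and [E] are the solutions of [y'' = (lambda c)^2 y] with [c^2 = v0^2 + Q], [D 0 = 1],
   [D' 0 = - lambda v0], [E 0 = 0] and [E' 0 = 1]. *)
Lemma geodesic_functions (lambda v0 Q : R) : 0 < lambda -> 0 <= Q ->
  exists D D1 D2 E E1 : R -> R,
    [/\ [/\ forall s, isD s D (D1 s), forall s, isD s D1 (D2 s) & forall s, isD s E (E1 s)],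
        [/\ forall s, 0 < D s, forall s, E1 s * D s - E s * D1 s = 1 &
            forall s, D2 s * D s - D1 s ^+ 2 = lambda ^+ 2 * Q],
        [/\ D 0 = 1, D1 0 = - lambda * v0 & E 0 = 0],
        forall r, Ck r setT D & forall r, Ck r setT E].
Proof.
move=> l0 Q0; have := addr_ge0 (sqr_ge0 v0) Q0.
rewrite le0r => /orP[|c20].
  (* The degenerate case c = 0, that is zero velocity: the equation is y'' = 0. *)
  rewrite paddr_eq0 ?sqr_ge0 // sqrf_eq0 => /andP[/eqP -> /eqP ->].
  exists (fun=> 1), (fun=> 0), (fun=> 0), id, (fun=> 1); split.
  - by split=> s; [exact: isD_cst | exact: isD_cst | exact: is_derive_id].
  - by split=> s //; ring.
  - by split; ring.
  - by move=> r; exact: Ck_cst.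
  - by move=> r; exact: Ck_id.
pose c := Num.sqrt (v0 ^+ 2 + Q).
have c0 : 0 < c by rewrite sqrtr_gt0.
have cE : c ^+ 2 = v0 ^+ 2 + Q by rewrite sqr_sqrtr // ltW.
pose a := v0 / c.
have acE : a * c = v0 by rewrite /a mulfVK // lt0r_neq0.
have a1 : a ^+ 2 <= 1.
  rewrite /a exprMn exprVn ler_pdivrMr ?exprn_gt0 // mul1r cE lerDl //.
pose mu := lambda * c.
have mu0 : 0 < mu by rewrite mulr_gt0.
pose P s := expR (mu * s); pose N s := expR (- mu * s).
have P0 s : 0 < P s by exact: expR_gt0.
have N0 s : 0 < N s by exact: expR_gt0.
have PN s : P s * N s = 1 by rewrite /P /N -expRD mulNr subrr expR0.
have P00 : P 0 = 1 by rewrite /P mulr0 expR0.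
have N00 : N 0 = 1 by rewrite /N mulr0 expR0.
pose comb u w s := u * P s + w * N s.
have dcomb u w s : isD s (comb u w) (comb (u * mu) (w * - mu) s).
  have := isD_add (isD_cmul u (isD_expR_cmul mu s)) (isD_cmul w (isD_expR_cmul (- mu) s)).
  by move=> dc; apply: (is_derive_eq dc); rewrite /comb !mulrA.
have kcomb u w r : Ck r setT (comb u w).
  apply: CkD openT _ _; apply: CkM openT (Ck_cst _ _ _) _; apply: Ck_expR openT _;
    exact: CkM openT (Ck_cst _ _ _) (Ck_id _ _).
(* [D] is cosh(mu s) - a sinh(mu s) and [E] is sinh(mu s) / mu. Since |a| <= 1, the two exponential
   coefficients of [D] are nonnegative with sum 1, whence its positivity. *)
exists (comb ((1 - a) / 2) ((1 + a) / 2)),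
  (comb ((1 - a) / 2 * mu) ((1 + a) / 2 * - mu)),
  (comb ((1 - a) / 2 * mu * mu) ((1 + a) / 2 * - mu * - mu)),
  (comb (2 * mu)^-1 (- (2 * mu)^-1)),
  (comb ((2 * mu)^-1 * mu) (- (2 * mu)^-1 * - mu)).
have m0 := lt0r_neq0 mu0.
split; [| | |by move=> r; exact: kcomb|by move=> r; exact: kcomb].
- split; first exact: (dcomb ((1 - a) / 2) ((1 + a) / 2)).
    exact: (dcomb ((1 - a) / 2 * mu) ((1 + a) / 2 * - mu)).
  exact: (dcomb (2 * mu)^-1 (- (2 * mu)^-1)).
- split=> s; rewrite /comb.
  + have Ps := P0 s; have Ns := N0 s.
    have : 0 <= 1 - a /\ 0 <= 1 + a by split; nra.
    move=> [am ap]; have [a0|a0] := leP a 0.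
      apply: ltr_pwDl; first by apply: mulr_gt0 => //; lra.
      by apply: mulr_ge0; [lra | exact: ltW].
    apply: ltr_wpDl; last by apply: mulr_gt0 => //; lra.
    by apply: mulr_ge0; [lra | exact: ltW].
  + transitivity (P s * N s); last exact: PN.
    by field.
  + transitivity ((1 - a ^+ 2) * mu ^+ 2 * (P s * N s)); first by field.
    have -> : (1 - a ^+ 2) * mu ^+ 2 = lambda ^+ 2 * (c ^+ 2 - (a * c) ^+ 2).
      by rewrite /mu; ring.
    by rewrite PN acE cE; ring.
- rewrite /comb P00 N00 -acE; split; [by field | by rewrite /mu; field | by rewrite !mulr1 subrr].
Qed.

End RealDerivatives.

(** * The left-invariant metric in coordinates, its Christoffel symbols and geodesics *)

Section ModelSpace.
Context (R : realType).

Lemma jacobian_affine k m (b : 'rV[R]_m) (A : 'M[R]_(k, m)) x :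
  jacobian (fun y => b + y *m A) x = A.
Proof.
have dA i j : is_derive x (delta_mx 0 i : 'rV_k) (fun y : 'rV_k => (b + y *m A) 0 j) (A i j).
  have E : (fun y : 'rV[R]_k => (b + y *m A) 0 j) = fun y => b 0 j + \sum_l y 0 l * A l j.
    by apply/funext => y; rewrite !mxE.
  have dc l : differentiable (fun y : 'rV[R]_k => y 0 l) x by exact: differentiable_coord.
  have dcA l : differentiable (fun y : 'rV[R]_k => y 0 l * A l j) x.
    by apply: differentiableM => //; exact: differentiable_cst.
  have dE : differentiable (fun y : 'rV[R]_k => \sum_l y 0 l * A l j) x.
    exact: differentiable_big.
  rewrite E; apply: DeriveDef.
    by apply: diff_derivable; apply: differentiableD => //; exact: differentiable_cst.
  rewrite derive_add // derive_cst add0r derive_big //.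
  rewrite (bigD1 i) //= big1 ?addr0 => [|l li].
    rewrite derive_mul // derive_cst mulr0 addr0.
    by rewrite -(derive_mxE (f := id)) // derive_id mxE !eqxx mul1r.
  rewrite derive_mul // derive_cst mulr0 addr0.
  by rewrite -(derive_mxE (f := id)) // derive_id mxE (negPf li) andbF mul0r.
apply/matrixP => i j; rewrite jacobianE; first by have [_ ->] := dA i j.
apply/differentiable_mxP => i' j'; rewrite ord1.
rewrite (_ : (fun y : 'rV[R]_k => (b + y *m A) 0 j') = fun y => b 0 j' + \sum_l y 0 l * A l j').
  apply: differentiableD; first exact: differentiable_cst.
  apply: differentiable_big => l; apply: differentiableM; last exact: differentiable_cst.
  exact: differentiable_coord.
by apply/funext => y; rewrite !mxE.
Qed.

Lemma affine_Ck k m r (U : set 'rV[R]_k) (b : 'rV[R]_m) (A : 'M[R]_(k, m)) : open U ->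
  Ck r U (fun y => b + y *m A).
Proof.
move=> oU; apply: CkD => //; first exact: Ck_cst.
apply: Ck_mulmx => //; last exact: Ck_cst.
by apply/(Ck_mxP r _ oU) => i j; exact: Ck_coord.
Qed.

Context (n : nat) (lambda : R).
Local Notation p := n.-1.
Implicit Types (a b x : 'rV[R]_(1 + p)) (s : R).

Definition i0 : 'I_(1 + p) := lshift p ord0.

Definition wt s (i : 'I_(1 + p)) : R := if i == i0 then 1 else expR s.

(** These are the differentials of the left translations: the B-direction is fixed and g_alpha is
    multiplied by exp(s). They form a one-parameter group. *)
Definition scaling s : 'M[R]_(1 + p) := diag_mx (\row_i wt s i).

Lemma wt0 s : wt s i0 = 1. Proof. by rewrite /wt eqxx. Qed.

Lemma wt_gt0 s i : 0 < wt s i.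
Proof. by rewrite /wt; case: ifP => _ //; exact: expR_gt0. Qed.

Lemma wtD s t i : wt s i * wt t i = wt (s + t) i.
Proof. by rewrite /wt; case: ifP => _; rewrite ?mulr1 // expRD. Qed.

Lemma scalingD s t : scaling s *m scaling t = scaling (s + t).
Proof.
rewrite /scaling mulmx_diag; congr diag_mx; apply/rowP => i; rewrite !mxE; exact: wtD.
Qed.

Lemma scaling0 : scaling 0 = 1%:M.
Proof.
rewrite /scaling -diag_const_mx; congr diag_mx; apply/rowP => i.
by rewrite !mxE /wt expR0; case: ifP.
Qed.

Lemma tr_scaling s : (scaling s)^T = scaling s.
Proof. exact: tr_diag_mx. Qed.

Lemma an_mulE a b : an_mul lambda a b = a + b *m scaling (lambda * a 0 i0).
Proof.
have l0 : lsubmx a 0 0 = a 0 i0 by rewrite mxE.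
rewrite /an_mul l0 mul_mx_diag; apply/rowP => i.
case: (split_ordP i) => j ->.
  by rewrite row_mxEl !mxE /wt ord1 /i0 -[ord0]/(0 : 'I_1) eqxx mulr1.
by rewrite row_mxEr !mxE /wt /i0 eq_rlshift mulrC.
Qed.

Lemma an_inv0 a : an_inv lambda a 0 i0 = - a 0 i0.
Proof. by rewrite /an_inv /i0 row_mxEl !mxE. Qed.

Lemma jacobian_an_mul a x : jacobian (an_mul lambda a : 'rV_(1 + p) -> 'rV_(1 + p)) x =
  scaling (lambda * a 0 i0).
Proof.
rewrite (_ : an_mul _ _ = fun b => a + b *m scaling (lambda * a 0 i0)).
  exact: jacobian_affine.
by apply/funext => b; rewrite an_mulE.
Qed.

Lemma an_metricE c a : @an_metric R n lambda c a = scaling (- (2 * lambda * a 0 i0)).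
Proof.
rewrite /an_metric jacobian_an_mul an_inv0 tr_scaling scalingD; congr scaling; ring.
Qed.

Lemma an_metric_inner c a (u v : 'rV[R]_(1 + p)) :
  (u *m @an_metric R n lambda c a *m v^T) 0 0 =
  \sum_i wt (- (2 * lambda * a 0 i0)) i * (u 0 i * v 0 i).
Proof.
rewrite an_metricE mul_mx_diag mxE; apply: eq_bigr => i _; rewrite !mxE; ring.
Qed.

Lemma wt_Ck (V : normedModType R) r (U : set V) (f : V -> R) i : open U ->
  Ck r U f -> Ck r U (fun z => wt (f z) i).
Proof.
by move=> oU fk; rewrite /wt; case: (i == i0); [exact: Ck_cst | exact: Ck_expR].
Qed.

Lemma an_metric_riemannian : riemannian_metric (@an_metric R n lambda).
Proof.
split=> [c r|c q _|].
- rewrite image_id; apply: (Ck_eq openT (f := fun a => scaling (- (2 * lambda * a 0 i0)))).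
    by move=> a _; rewrite an_metricE.
  apply/(Ck_mxP r _ openT) => i j.
  apply: (Ck_eq openT (f := fun a => wt (- (2 * lambda * a 0 i0)) i * (i == j)%:R)).
    by move=> a _; rewrite !mxE mulr_natr; case: eqP => // ->.
  apply: CkM (openT) _ (Ck_cst _ _ _).
  apply: wt_Ck (openT) _; apply: CkN (openT) _; apply: CkM (openT) (Ck_cst _ _ _) _.
  exact: Ck_coord.
- split=> [|v v0]; first by rewrite an_metricE tr_scaling.
  have ge0 i : 0 <= wt (- (2 * lambda * q 0 i0)) i * (v 0 i * v 0 i).
    by rewrite mulr_ge0 ?(ltW (wt_gt0 _ _)) // -expr2 sqr_ge0.
  rewrite an_metric_inner lt0r sumr_ge0 // andbT; apply: contra v0.
  rewrite psumr_eq0 // => /allP v0; apply/eqP/rowP => i; rewrite mxE; apply/eqP.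
  have := v0 i (mem_index_enum _).
  by rewrite /= mulf_eq0 (negPf (lt0r_neq0 (wt_gt0 _ _))) /= mulf_eq0 orbb.
- move=> c d q _ _ ; rewrite tangent_euclidean_id mul1mx trmx1 mulmx1.
  by case: c; case: d.
Qed.

Lemma scalingE s i j : scaling s i j = (i == j)%:R * wt s i.
Proof. by rewrite !mxE; case: (i == j); rewrite ?mul1r ?mul0r. Qed.

Lemma pd_coord_i0 m x : pd m (fun y : 'rV[R]_(1 + p) => y 0 i0) x = (m == i0)%:R.
Proof. by rewrite /pd -(derive_mxE (f := id)) // derive_id mxE eqxx eq_sym. Qed.

Lemma an_metric_pd c (m i j : 'I_(1 + p)) x : pd m (fun y => @an_metric R n lambda c y i j) x =
  (i == j)%:R * (i != i0)%:R * (m == i0)%:R * (- (2 * lambda) * wt (- (2 * lambda * x 0 i0)) i).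
Proof.
have dx : differentiable (fun y : 'rV[R]_(1 + p) => y 0 i0) x by exact: differentiable_coord.
have dlx : differentiable (fun y : 'rV[R]_(1 + p) => - (2 * lambda) * y 0 i0) x.
  by apply: differentiableM => //; exact: differentiable_cst.
have dlE : 'D_(delta_mx 0 m) (fun y : 'rV[R]_(1 + p) => - (2 * lambda) * y 0 i0) x =
    - (2 * lambda) * (m == i0)%:R.
  by rewrite derive_cmul // -[X in _ * X = _]/(pd m (fun y : 'rV[R]_(1 + p) => y 0 i0) x) pd_coord_i0.
have [de deE] := derive_scalar_comp (delta_mx 0 m) dlx (is_derive_expR _).
have -> : (fun y => @an_metric R n lambda c y i j) =
    fun y : 'rV[R]_(1 + p) => (i == j)%:R * wt (- (2 * lambda) * y 0 i0) i.
  apply/funext => y; by rewrite an_metricE scalingE mulNr.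
rewrite /wt; case: (i == i0).
  by rewrite /pd derive_cst /= mulr0 !mul0r.
rewrite /pd derive_cmul // deE dlE mulNr /=; ring.
Qed.

Lemma an_metric_invmx c x (l m : 'I_(1 + p)) : invmx (@an_metric R n lambda c x) l m =
  (l == m)%:R * wt (2 * lambda * x 0 i0) l.
Proof.
rewrite an_metricE.
have -> : invmx (scaling (- (2 * lambda * x 0 i0))) = scaling (2 * lambda * x 0 i0).
  have E : scaling (2 * lambda * x 0 i0) *m scaling (- (2 * lambda * x 0 i0)) = 1%:M.
    by rewrite scalingD subrr scaling0.
  have [_ u] := mulmx1_unit E.
  by rewrite -[RHS]mulmx1 -(mulmxV u) mulmxA E mul1mx.
exact: scalingE.
Qed.

(** The metric is dt^2 + exp(-2 lambda t) |dx|^2, with index [i0] for t. Its nonzero symbols are -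
    lambda, with upper index l and lower indices t and l, and lambda exp(-2 lambda t), with upper
    index t and lower indices l and l, for l other than t; the deltas encode this distinction. *)
Lemma an_christoffel c (l i j : 'I_(1 + p)) x : christoffel (@an_metric R n lambda c) l i j x =
  - lambda * ((j == l)%:R * (l != i0)%:R * (i == i0)%:R + (i == l)%:R * (l != i0)%:R * (j == i0)%:R
    - (i == j)%:R * (i != i0)%:R * (l == i0)%:R * wt (- (2 * lambda * x 0 i0)) i).
Proof.
rewrite /christoffel (bigD1 l) //= big1 ?addr0 => [|m ml]; last first.
  by rewrite an_metric_invmx eq_sym (negPf ml) !mul0r.
rewrite an_metric_invmx eqxx mul1r !an_metric_pd.
have [ll|ll] := eqVneq l i0; last first.
  rewrite /= !mulr1 !mulr0 !mul0r !subr0.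
  have wl : wt (2 * lambda * x 0 i0) l * wt (- (2 * lambda * x 0 i0)) l = 1.
    by rewrite wtD subrr /wt expR0; case: ifP.
  have -> : (j == l)%:R * (j != i0)%:R = (j == l)%:R :> R.
    by case: eqP => [->|_]; rewrite ?ll ?mulr1 ?mul0r.
  have -> : (i == l)%:R * (i != i0)%:R = (i == l)%:R :> R.
    by case: eqP => [->|_]; rewrite ?ll ?mulr1 ?mul0r.
  have jE : (j == l)%:R * wt (- (2 * lambda * x 0 i0)) j =
            (j == l)%:R * wt (- (2 * lambda * x 0 i0)) l.
    by case: eqP => [->|_]; rewrite ?mul0r.
  have iE : (i == l)%:R * wt (- (2 * lambda * x 0 i0)) i =
            (i == l)%:R * wt (- (2 * lambda * x 0 i0)) l.
    by case: eqP => [->|_]; rewrite ?mul0r.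
  transitivity (2^-1 * (wt (2 * lambda * x 0 i0) l * (- (2 * lambda)) *
    ((i == i0)%:R * ((j == l)%:R * wt (- (2 * lambda * x 0 i0)) j) +
     (j == i0)%:R * ((i == l)%:R * wt (- (2 * lambda * x 0 i0)) i)))); first by ring.
  rewrite jE iE.
  transitivity (2^-1 * 2 * - lambda * (wt (2 * lambda * x 0 i0) l * wt (- (2 * lambda * x 0 i0)) l) *
    ((i == i0)%:R * (j == l)%:R + (j == i0)%:R * (i == l)%:R)); first by ring.
  by rewrite wl; field.
subst l; rewrite wt0 /= !mulr1 !mulr0 !mul0r mul1r.
have z k : (k == i0)%:R * (k != i0)%:R = 0 :> R by case: eqP; rewrite ?mul0r ?mulr0.
by rewrite !z !mul0r; field.
Qed.

Lemma an_geodesic_term c x (u : 'rV[R]_(1 + p)) (l : 'I_(1 + p)) :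
  \sum_i \sum_j christoffel (@an_metric R n lambda c) l i j x * u 0 i * u 0 j =
  if l == i0 then lambda * expR (- (2 * lambda * x 0 i0)) * \sum_(i | i != i0) u 0 i ^+ 2
  else - (2 * lambda) * u 0 i0 * u 0 l.
Proof.
have [->|ll] := eqVneq l i0.
  rewrite (bigD1 i0) //= big1 ?add0r => [|j _]; last first.
    rewrite an_christoffel !eqxx /=; ring.
  rewrite mulr_sumr; apply: eq_bigr => i ii0.
  rewrite (bigD1 i) //= big1 ?addr0 => [|j ji]; last first.
    rewrite an_christoffel !eqxx /= [i == j]eq_sym (negPf ji) /=; ring.
  by rewrite an_christoffel !eqxx ii0 /wt (negPf ii0) /=; ring.
rewrite (eq_bigr (fun i => - lambda * u 0 i * ((i == i0)%:R * u 0 l + (i == l)%:R * u 0 i0))).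
  rewrite (bigD1 l) //= (bigD1 i0) /=; last by rewrite eq_sym.
  rewrite big1 => [|i /andP[il ii0]].
    by rewrite !eqxx [i0 == l]eq_sym !(negPf ll) /=; ring.
  by rewrite (negPf il) (negPf ii0) /=; ring.
move=> i _; rewrite (bigD1 l) //= (bigD1 i0) /=; last by rewrite eq_sym.
rewrite big1 => [|j /andP[jl ji0]].
  by rewrite !an_christoffel !eqxx [i0 == l]eq_sym !(negPf ll) /=; ring.
by rewrite !an_christoffel (negPf jl) (negPf ji0) (negPf ll) /=; ring.
Qed.

(** By [an_geodesic_term] the equations are t'' + lambda exp(-2 lambda t) |x'|^2 = 0 and x'' = 2
    lambda t' x'. They are solved by t = t0 - ln(D) / lambda and x = x0 + (E / D) v: the Wronskian
    E'D - ED' = 1 gives x' = v / D^2, and D''D - D'^2 matches the quadratic term. *)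
Lemma an_complete : 0 < lambda -> complete_metric (@an_metric R n lambda).
Proof.
move=> l0 c q v _.
have l0' := lt0r_neq0 l0.
(* The squared length at [q] of the g_alpha-part of the velocity; it plays the part of [Q] in
   [geodesic_functions]. *)
pose W := expR (- (2 * lambda * q 0 i0)) * \sum_(i | i != i0) v 0 i ^+ 2.
have W0 : 0 <= W.
  by rewrite mulr_ge0 ?expR_ge0 // sumr_ge0 // => i _; exact: sqr_ge0.
have [D [D1 [D2 [E [E1 [[dD dD1 dE] [D0 ED DD] [D00 D10 E00] Dk Ek]]]]]] :=
  geodesic_functions (v 0 i0) l0 W0.
have Dn s : D s != 0 by exact: lt0r_neq0.
pose gam s : 'rV[R]_(1 + p) := \row_i (if i == i0 then q 0 i + - lambda^-1 * ln (D s)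
   else q 0 i + (E s * (D s)^-1) * v 0 i).
pose gam1 s : 'rV[R]_(1 + p) := \row_i (if i == i0 then - lambda^-1 * ((D s)^-1 * D1 s)
   else ((D s)^-1 * (D s)^-1) * v 0 i).
pose gam2 s : 'rV[R]_(1 + p) := \row_i (if i == i0 then - lambda^-1 * ((D2 s * D s - D1 s ^+ 2) / D s ^+ 2)
   else (- 2 * D1 s / D s ^+ 3) * v 0 i).
have dgam : derive1 gam = gam1.
  apply: derive1_row => s i; rewrite !mxE.
  under eq_fun do rewrite mxE.
  case: (i == i0).
    apply: (is_derive_eq (isD_add (isD_cst _ _)
      (isD_cmul (- lambda^-1) (isD_comp (is_derive1_ln (D0 s)) (dD s))))).
    by rewrite add0r.
  apply: (is_derive_eq (isD_add (isD_cst _ _)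
      (isD_mul (isD_mul (dE s) (isD_inv (Dn s) (dD s))) (isD_cst _ _)))).
  rewrite mulr0 addr0 add0r; congr (_ * _).
  transitivity ((E1 s * D s - E s * D1 s) / D s ^+ 2); first by field.
  by rewrite ED; field.
have dgam1 : derive1 gam1 = gam2.
  apply: derive1_row => s i; rewrite !mxE.
  under eq_fun do rewrite mxE.
  have dDV := isD_inv (Dn s) (dD s).
  case: (i == i0).
    apply: (is_derive_eq (isD_cmul (- lambda^-1) (isD_mul dDV (dD1 s)))).
    by congr (_ * _); field.
  apply: (is_derive_eq (isD_mul (isD_mul dDV dDV) (isD_cst _ _))).
  by rewrite mulr0 addr0; congr (_ * _); field.
have kgam r : Ck r setT gam.
  apply/(Ck_mxP r gam openT) => i j; rewrite ord1.
  apply: (Ck_eq openT (f := fun s => if j == i0 then q 0 j + - lambda^-1 * ln (D s)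
   else q 0 j + (E s * (D s)^-1) * v 0 j)); first by move=> s _; rewrite mxE.
  case: (j == i0); apply: CkD openT (Ck_cst _ _ _) _.
    by apply: CkM openT (Ck_cst _ _ _) _; apply: Ck_ln openT _ (Dk r) => s _.
  apply: CkM openT _ (Ck_cst _ _ _); apply: CkM openT (Ek r) _.
  by apply: CkV openT _ (Dk r) => s _.
have dgE : derive1 (crd c \o gam) = gam1 by [].
exists gam; split; last 1 first.
- apply/rowP => i; rewrite dgE mxE D00 D10; case: eqP => [->|_].
    by field.
  by rewrite invr1 !mul1r.
- split; first by move=> s; apply: (kgam 0%N).
  move=> d; split; first by move=> r; exact: kgam.
  move=> s _ l /=; rewrite /derive1n /= dgam dgam1.
  rewrite (an_geodesic_term d (gam s) (gam1 s) l).
  have [->|ll] := eqVneq l i0.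
    have -> : \sum_(i | i != i0) gam1 s 0 i ^+ 2 = (D s)^-1 ^+ 4 * \sum_(i | i != i0) v 0 i ^+ 2.
      rewrite mulr_sumr; apply: eq_bigr => i ii0; rewrite mxE (negPf ii0); ring.
    rewrite !mxE eqxx DD /W.
    have -> : - (2 * lambda * (q 0 i0 + - lambda^-1 * ln (D s))) =
       - (2 * lambda * q 0 i0) + (ln (D s) + ln (D s)) by field.
    rewrite !expRD lnK ?posrE //.
    move: (\sum_(i | i != i0) v 0 i ^+ 2) (expR (- (2 * lambda * q 0 i0))) => a b.
    by field; rewrite l0' Dn.
  rewrite !mxE eqxx (negPf ll).
  by field; rewrite l0' Dn.
- by apply/rowP => i; rewrite mxE D00 E00 ln1 mulr0 !mul0r !addr0; case: eqP.
Qed.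

End ModelSpace.

(** * Curvature of pullbacks of the flat and hyperbolic metrics *)

Section Hyperquadric.
Context (R : realType) (k m : nat) (eta : 'I_m -> 'I_m -> R).
Context (eta_sym : forall a c, eta a c = eta c a).

(** An invertible Gram matrix makes the [k] vectors independent, hence a basis as m = k. *)
Lemma tangent_span (d : 'I_k -> 'I_m -> R) (g : 'M[R]_k) (w : 'I_m -> R) :
  m = k -> g \in unitmx -> (forall i j, g i j = form eta (d i) (d j)) ->
  exists c : 'I_k -> R, forall a, w a = \sum_l c l * d l a.
Proof.
move=> mk gu gE; pose T := \matrix_(l, a) d l a.
have Tfull : row_full T.
  suff : row_free T by move=> /eqP rT; apply/eqP; rewrite rT; exact: esym mk.
  apply/row_free_ker0 => v vT.
  suff : v *m g = 0 by move=> /(congr1 (mulmx^~ (invmx g))); rewrite mulmxK // mul0mx.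
  apply/rowP => j; rewrite !mxE.
  have E : (fun a => \sum_i v 0 i * d i a) = fun=> 0.
    apply/funext => a; have /rowP/(_ a) := vT; rewrite !mxE => vTa; rewrite -[RHS]vTa.
    by apply: eq_bigr => i _; rewrite mxE.
  transitivity (form eta (fun a => \sum_i v 0 i * d i a) (d j)).
    by rewrite form_sum; apply: eq_bigr => i _; rewrite formZ gE.
  by rewrite E /form big1 // => a _; rewrite big1 // => c _; rewrite mul0r mulr0.
have /submxP[c cE] : (\row_a w a <= T)%MS by exact: submx_full.
exists (c 0) => a; have /rowP/(_ a) := cE; rewrite !mxE => ->.
by apply: eq_bigr => l _; rewrite mxE.
Qed.

(** The vector [f] is orthogonal to the [d i] and not isotropic, so together they are 1 + k
    independent vectors. The coefficient of [f] is found by pairing [w] with [f], whose square is -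
    1/K. *)
Lemma hyperquadric_span (f : 'I_m -> R) (d : 'I_k -> 'I_m -> R) (g : 'M[R]_k)
    (K : R) (w : 'I_m -> R) :
  m = (1 + k)%N -> g \in unitmx -> (forall i j, g i j = form eta (d i) (d j)) ->
  K != 0 -> form eta f f = - K^-1 -> (forall i, form eta f (d i) = 0) ->
  exists c : 'I_k -> R, forall a, w a = \sum_l c l * d l a + K * - form eta w f * f a.
Proof.
move=> mk gu gE K0 ff fd.
pose T : 'M[R]_(1 + k, m) := col_mx (\row_a f a) (\matrix_(l, a) d l a).
have rowE (v : 'rV[R]_(1 + k)) a : (v *m T) 0 a =
    lsubmx v 0 0 * f a + \sum_l rsubmx v 0 l * d l a.
  rewrite -{1}[v]hsubmxK mul_row_col mxE; congr (_ + _).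
    by rewrite mxE big_ord1 [in X in _ * X]mxE.
  by rewrite mxE; apply: eq_bigr => l _; rewrite [in X in _ * X]mxE.
have pair (s : R) (c : 'I_k -> R) u :
    form eta (fun a => s * f a + \sum_l c l * d l a) u = s * form eta f u + \sum_l c l * form eta (d l) u.
  by rewrite formD formZ form_sum; congr (_ + _); apply: eq_bigr => l _; rewrite formZ.
have df i : form eta (d i) f = 0 by rewrite formC.
have Tfull : row_full T.
  suff : row_free T by move=> /eqP rT; apply/eqP; rewrite rT; exact: esym mk.
  apply/row_free_ker0 => v vT.
  have E : (fun a => lsubmx v 0 0 * f a + \sum_l rsubmx v 0 l * d l a) = fun=> 0.
    by apply/funext => a; rewrite -rowE vT mxE.
  have Z u : form eta (fun=> 0) u = 0.
    by rewrite /form big1 // => a _; rewrite big1 // => c _; rewrite mul0r mulr0.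
  have v0 : lsubmx v 0 0 = 0.
    have := pair (lsubmx v 0 0) (rsubmx v 0) f; rewrite E Z ff big1 ?addr0.
      by move=> /esym/eqP; rewrite mulf_eq0 oppr_eq0 invr_eq0 (negPf K0) orbF => /eqP.
    by move=> l _; rewrite df mulr0.
  have v1 : rsubmx v = 0.
    suff : rsubmx v *m g = 0 by move=> /(congr1 (mulmx^~ (invmx g))); rewrite mulmxK // mul0mx.
    apply/rowP => j; rewrite !mxE.
    have := pair (lsubmx v 0 0) (rsubmx v 0) (d j); rewrite E Z fd mulr0 add0r => E2; rewrite [RHS]E2.
    by apply: eq_bigr => i _; rewrite gE.
  rewrite -[v]hsubmxK v1 (_ : lsubmx v = 0) ?row_mx0 //.
  by apply/matrixP => i j; rewrite !ord1 v0 mxE.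
have /submxP[c cE] : (\row_a w a <= T)%MS by exact: submx_full.
have wE a : w a = lsubmx c 0 0 * f a + \sum_l rsubmx c 0 l * d l a.
  by rewrite -rowE -cE mxE.
exists (rsubmx c 0) => a; rewrite [LHS]wE addrC; congr (_ + _ * _).
rewrite (funext wE) pair ff big1 ?addr0; last by move=> l _; rewrite df mulr0.
by field.
Qed.

End Hyperquadric.

(** The Gauss equation with K = 0 and the Euclidean form: in equal dimensions every Hessian is
    tangent. *)
Lemma flat_curvature (R : realType) (k m : nat) (U : set 'rV[R]_k)
    (F : 'I_m -> 'rV[R]_k -> R) (g : 'rV[R]_k -> 'M[R]_k) :
  m = k -> open U -> (forall a, Ck 3 U (F a)) ->
  (forall x, U x -> forall i j, g x i j = \sum_a pd i (F a) x * pd j (F a) x) ->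
  (forall x, U x -> g x \in unitmx) ->
  forall x l q i j, U x -> curvature g l q i j x = 0.
Proof.
move=> mk oU F3 gE gu x l q i j Ux.
pose eta (a c : 'I_m) : R := (a == c)%:R.
have es a c : eta a c = eta c a by rewrite /eta eq_sym.
have formE u w : form eta u w = \sum_a u a * w a.
  apply: eq_bigr => a _; rewrite (bigD1 a) //= /eta eqxx mul1r big1 ?addr0 // => c ca.
  by rewrite eq_sym (negPf ca) mul0r.
have gE' y : U y -> forall i j, g y i j = form eta (fun a => pd i (F a) y) (fun a => pd j (F a) y).
  by move=> Uy i' j'; rewrite gE // formE.
rewrite (gauss_curvature (K := 0) es oU F3 gE' gu) // ?oppr0 ?mul0r // => y Uy i'.
  by rewrite mul0r.
move=> j'; have [c cE] := tangent_span (fun a => pd i' (pd j' (F a)) y) mk (gu y Uy) (gE' y Uy).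
by exists c => a; rewrite !mul0r addr0.
Qed.

(** Differentiating <F, F> = - 1/K once shows that [F] is normal, and differentiating <dF, F> = 0
    shows that the Hessian pairs with [F] to - g. By [hyperquadric_span] its normal part is then K g
    F, as the Gauss equation requires. *)
Lemma hyperquadric_curvature (R : realType) (k m : nat) (eta : 'I_m -> 'I_m -> R)
    (U : set 'rV[R]_k) (F : 'I_m -> 'rV[R]_k -> R) (g : 'rV[R]_k -> 'M[R]_k) (K : R) :
  (forall a c, eta a c = eta c a) -> m = (1 + k)%N -> K != 0 ->
  open U -> (forall a, Ck 3 U (F a)) ->
  (forall x, U x -> form eta (F ^~ x) (F ^~ x) = - K^-1) ->
  (forall x, U x -> forall i j,
     g x i j = form eta (fun a => pd i (F a) x) (fun a => pd j (F a) x)) ->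
  (forall x, U x -> g x \in unitmx) ->
  forall x l q i j, U x -> curvature g l q i j x =
    - K * (g x j q * (l == i)%:R - g x i q * (l == j)%:R).
Proof.
move=> es mk K0 oU F3 FF gE gu x l q i j Ux.
have dF y a : U y -> differentiable (F a) y.
  by move=> Uy; have [+ _] := F3 a; apply.
have ddF y i' a : U y -> differentiable (pd i' (F a)) y.
  by move=> Uy; have [_ /(_ (delta_mx 0 i')) [+ _]] := F3 a; apply.
have Fd y : U y -> forall i', form eta (F ^~ y) (fun a => pd i' (F a) y) = 0.
  move=> Uy i'.
  have D0 : pd i' (fun z => form eta (F ^~ z) (F ^~ z)) y = 0.
    rewrite /pd -[RHS](derive_cst (- K^-1) y (delta_mx 0 i')).
    by apply: (derive_congr _ oU Uy) => z Uz; exact: FF.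
  have := derive_form eta (delta_mx 0 i') (fun a => dF y a Uy) (fun a => dF y a Uy).
  move=> E; move: E; rewrite -[LHS]/(pd i' (fun z => form eta (F ^~ z) (F ^~ z)) y) D0.
  rewrite (formC es) => /esym/eqP; rewrite -mulr2n mulrn_eq0 /= => /eqP.
  exact.
have ddFF y i' j' : U y ->
    form eta (fun a => pd i' (pd j' (F a)) y) (F ^~ y) = - g y i' j'.
  move=> Uy.
  have D0 : pd i' (fun z => form eta (fun a => pd j' (F a) z) (F ^~ z)) y = 0.
    rewrite /pd -[RHS](derive_cst (0 : R) y (delta_mx 0 i')).
    by apply: (derive_congr _ oU Uy) => z Uz; rewrite (formC es); exact: Fd.
  have := derive_form eta (delta_mx 0 i') (fun a => ddF y j' a Uy) (fun a => dF y a Uy).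
  move=> E; move: E.
  rewrite -[LHS]/(pd i' (fun z => form eta (fun a => pd j' (F a) z) (F ^~ z)) y) D0.
  move=> /esym/eqP; rewrite addr_eq0 => /eqP; rewrite (formC es (fun a => pd j' (F a) y)).
  by rewrite (gE y Uy).
apply: (gauss_curvature es oU F3 gE gu _ _ _ _ _ _ Ux) => y Uy i'.
  by rewrite Fd ?mulr0.
move=> j'; have [c cE] := hyperquadric_span es (fun a => pd i' (pd j' (F a)) y)
   mk (gu y Uy) (gE y Uy) K0 (FF y Uy) (Fd y Uy).
by exists c => a; rewrite [LHS]cE ddFF // opprK.
Qed.

(** * The hyperboloid in horospherical coordinates *)

Section HyperbolicCoordinates.
Context (R : realType) (n : nat) (lambda : R) (l0 : 0 < lambda).
Local Notation p := n.-1.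
Local Notation e0 := (i0 n).

(* Minkowski form on [R^(2 + p)] in light-cone coordinates [Q], [P] for the first two
   slots, the form being [- dP dQ + |dz|^2]; the slot of [P] is indexed by [i0]. *)
Definition light_cone (a c : 'I_(1 + (1 + p))) : R :=
  match fintype.split a, fintype.split c with
  | inl _, inl _ => 0
  | inl _, inr b => if b == e0 then - 2^-1 else 0
  | inr b, inl _ => if b == e0 then - 2^-1 else 0
  | inr b, inr b' => if (b == b') && (b != e0) then 1 else 0
  end.

Lemma light_coneC a c : light_cone a c = light_cone c a.
Proof.
rewrite /light_cone; case: (fintype.split a) => b; case: (fintype.split c) => b' //.
by rewrite [b == b']eq_sym; case: eqP => //= ->.
Qed.

Lemma split_lshift (j : 'I_1) : fintype.split (lshift (1 + p) j) = inl j.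
Proof. by rewrite -[lshift _ j]/(unsplit (inl j)) unsplitK. Qed.

Lemma split_rshift (j : 'I_(1 + p)) : fintype.split (rshift 1 j) = inr j.
Proof. by rewrite -[rshift _ j]/(unsplit (inr j)) unsplitK. Qed.

Lemma light_cone_form u w : form light_cone u w =
  - 2^-1 * (u (lshift _ ord0) * w (rshift 1 e0) + u (rshift 1 e0) * w (lshift _ ord0)) +
  \sum_(b | b != e0) u (rshift 1 b) * w (rshift 1 b).
Proof.
have row_inl (w' : 'I_(1 + p) -> R) : \sum_(b : 'I_(1 + p)) (if b == e0 then - 2^-1 else 0) * w' b = - 2^-1 * w' e0.
  by rewrite (bigD1 e0) //= big1 ?addr0 // => b /negPf ->; exact: mul0r.
rewrite /form big_split_ord /= big_ord1 big_split_ord /= big_ord1.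
rewrite /light_cone !split_lshift mul0r add0r.
under eq_bigr do rewrite split_rshift.
rewrite row_inl.
transitivity (- 2^-1 * (u (lshift (1 + p) ord0) * w (rshift 1 e0)) +
  \sum_(b : 'I_(1 + p)) ((if b == e0 then - 2^-1 else 0) * (u (rshift 1 b) * w (lshift _ ord0))
     + if b != e0 then u (rshift 1 b) * w (rshift 1 b) else 0)).
  congr (_ + _); apply: eq_bigr => b _; rewrite big_split_ord /= big_ord1 split_lshift split_rshift; congr (_ + _).
  rewrite (bigD1 b) //= split_rshift eqxx /= big1 ?addr0 => [|b' b'b].
    by case: ifP => _; rewrite ?mul1r ?mul0r.
  by rewrite split_rshift eq_sym (negPf b'b) mul0r.
rewrite big_split /= row_inl -big_mkcond /=; ring.
Qed.

Context (k : nat) (U : set 'rV[R]_k) (phi : 'rV[R]_k -> 'rV[R]_(1 + p)) (g : 'rV[R]_k -> 'M[R]_k).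
Context (kn : k = (1 + p)%N) (oU : open U) (phi3 : Ck 3 U phi).
Context (gE : forall x, U x -> forall i j, g x i j =
  \sum_b wt (- (2 * lambda * phi x 0 e0)) b *
    (pd i (fun y => phi y 0 b) x * pd j (fun y => phi y 0 b) x)).
Context (gu : forall x, U x -> g x \in unitmx).

(** For (t, y) = phi x this is P = exp(- lambda t), z = exp(- lambda t) y, and [Q] is then forced by
    - PQ + |z|^2 = - 1 / lambda^2. The map [phi] is kept arbitrary so that any chart can be used. *)
Definition hyperboloid (a : 'I_(1 + (1 + p))) (x : 'rV[R]_k) : R :=
  match fintype.split a with
  | inl _ => (lambda ^+ 2)^-1 * expR (lambda * phi x 0 e0) +
      expR (- lambda * phi x 0 e0) * \sum_(b | b != e0) phi x 0 b * phi x 0 b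
  | inr b => expR (- lambda * phi x 0 e0) * (if b == e0 then 1 else phi x 0 b)
  end.

Lemma hyperboloidQ x : hyperboloid (lshift _ ord0) x =
  (lambda ^+ 2)^-1 * expR (lambda * phi x 0 e0) +
    expR (- lambda * phi x 0 e0) * \sum_(b | b != e0) phi x 0 b * phi x 0 b.
Proof. by rewrite /hyperboloid split_lshift. Qed.

Lemma hyperboloidP b x : hyperboloid (rshift 1 b) x =
  expR (- lambda * phi x 0 e0) * (if b == e0 then 1 else phi x 0 b).
Proof. by rewrite /hyperboloid split_rshift. Qed.

Lemma phi_coord_Ck b : Ck 3 U (fun x => phi x 0 b).
Proof. exact: (Ck_mxP 3 phi oU).1 phi3 0 b. Qed.

Lemma hyperboloid_Ck a : Ck 3 U (hyperboloid a).
Proof.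
have ke c : Ck 3 U (fun x => expR (c * phi x 0 e0)).
  by apply: Ck_expR oU _; apply: CkM oU (Ck_cst _ _ _) (phi_coord_Ck _).
rewrite /hyperboloid; case: (fintype.split a) => b.
  apply: CkD oU (CkM oU (Ck_cst _ _ _) (ke _)) (CkM oU (ke _) _).
  by apply: Ck_sum oU _ => c _; exact: CkM oU (phi_coord_Ck _) (phi_coord_Ck _).
apply: CkM oU (ke _) _; case: (b == e0); [exact: Ck_cst | exact: phi_coord_Ck].
Qed.

Lemma hyperboloid_norm x : form light_cone (hyperboloid ^~ x) (hyperboloid ^~ x) = - (lambda ^+ 2)^-1.
Proof.
rewrite light_cone_form hyperboloidQ hyperboloidP eqxx.
rewrite [X in _ + X](eq_bigr (fun b => expR (- lambda * phi x 0 e0) * expR (- lambda * phi x 0 e0) *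
    (phi x 0 b * phi x 0 b))); last first.
  by move=> b /negPf be; rewrite hyperboloidP be mulrACA.
rewrite -mulr_sumr.
have : expR (lambda * phi x 0 e0) * expR (- lambda * phi x 0 e0) = 1.
  by rewrite -expRD mulNr subrr expR0.
move: (expR (lambda * phi x 0 e0)) (expR (- lambda * phi x 0 e0)) (\sum_(b | b != e0) _) => P N S PN.
transitivity (- (lambda ^+ 2)^-1 * (P * N)); last by rewrite PN mulr1.
by field; rewrite lt0r_neq0.
Qed.

Lemma hyperboloid_pd x i (u := fun b => pd i (fun y => phi y 0 b) x)
    (N := expR (- lambda * phi x 0 e0)) : U x ->
  pd i (hyperboloid (lshift _ ord0)) x =
    lambda^-1 * expR (lambda * phi x 0 e0) * u e0
    - lambda * N * u e0 * \sum_(b | b != e0) phi x 0 b * phi x 0 b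
    + 2 * N * \sum_(b | b != e0) phi x 0 b * u b /\
  forall b, pd i (hyperboloid (rshift 1 b)) x =
    if b == e0 then - lambda * N * u e0 else N * (u b - lambda * u e0 * phi x 0 b).
Proof.
move=> Ux.
have dphi b : differentiable (fun y => phi y 0 b) x by have [+ _] := phi_coord_Ck b; apply.
have dlphi (c : R) : differentiable (fun y => c * phi y 0 e0) x.
  by apply: differentiableM => //; exact: differentiable_cst.
have dexp (c : R) : differentiable (fun y => expR (c * phi y 0 e0)) x /\
    pd i (fun y => expR (c * phi y 0 e0)) x = c * expR (c * phi x 0 e0) * u e0.
  have [d dE] := derive_scalar_comp (delta_mx 0 i) (dlphi c) (is_derive_expR _).
  split=> //; rewrite /pd dE derive_cmul //; rewrite -/(pd i (fun y => phi y 0 e0) x) -/(u e0); ring.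
have [dP PE] := dexp lambda; have [dN NE] := dexp (- lambda).
have dphi2 b : differentiable (fun y => phi y 0 b * phi y 0 b) x by exact: differentiableM.
split=> [|b].
  rewrite [hyperboloid _](funext hyperboloidQ).
  (* The condition on the index is moved into the list, because [derive_big] treats sums over a list
     without predicate. *)
  pose S y := \sum_(b <- [seq b <- index_enum 'I_(1 + p) | b != e0]) phi y 0 b * phi y 0 b.
  have SE y : \sum_(b | b != e0) phi y 0 b * phi y 0 b = S y by rewrite /S big_filter.
  have dS : differentiable S x by exact: differentiable_big.
  have dSE : pd i S x = 2 * \sum_(b | b != e0) phi x 0 b * u b.
    rewrite /pd derive_big // big_filter mulr_sumr; apply: eq_bigr => b _.
    rewrite derive_mul // -/(pd i (fun y => phi y 0 b) x) -/(u b); ring.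
  under eq_fun do rewrite SE.
  rewrite SE /pd derive_add; [|exact: differentiableM (differentiable_cst _ _) dP|exact: differentiableM].
  rewrite derive_cmul // derive_mul //.
  rewrite -/(pd i (fun y => expR (lambda * phi y 0 e0)) x) PE.
  rewrite -/(pd i (fun y => expR (- lambda * phi y 0 e0)) x) NE -/(pd i S x) dSE -/N.
  by field; rewrite lt0r_neq0.
rewrite [hyperboloid _](funext (hyperboloidP b)).
case: (b == e0).
  by rewrite /pd derive_mul // derive_cst mulr0 addr0 mulr1 -NE.
rewrite /pd derive_mul // -/(pd i (fun y => expR (- lambda * phi y 0 e0)) x) NE.
rewrite -/(pd i (fun y => phi y 0 b) x) -/(u b) -/N; ring.
Qed.

(** The algebra of [hyperboloid_gram], with [P] and [N] standing for exp(lambda t) and exp(- lambda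
    t): the left side is the metric of AN, the right side the Minkowski form on derivatives, and all
    terms containing [y] cancel. *)
Lemma gram_identity (P N : R) (y u v : 'I_(1 + p) -> R)
    (S := \sum_(b | b != e0) y b * y b)
    (yu := \sum_(b | b != e0) y b * u b) (yv := \sum_(b | b != e0) y b * v b) :
  P * N = 1 ->
  u e0 * v e0 + N * N * \sum_(b | b != e0) u b * v b =
  - 2^-1 * ((lambda^-1 * P * u e0 - lambda * N * u e0 * S + 2 * N * yu) * (- lambda * N * v e0)
    + (- lambda * N * u e0) * (lambda^-1 * P * v e0 - lambda * N * v e0 * S + 2 * N * yv))
  + \sum_(b | b != e0) (N * (u b - lambda * u e0 * y b)) * (N * (v b - lambda * v e0 * y b)).
Proof.
move=> PN.
rewrite [X in _ = _ + X](_ : _ = N * N * \sum_(b | b != e0) u b * v b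
  - N * N * lambda * v e0 * yu - N * N * lambda * u e0 * yv
  + N * N * lambda ^+ 2 * u e0 * v e0 * S); last first.
  rewrite /yu /yv /S !mulr_sumr -!sumrB -big_split; apply: eq_bigr => b _ /=; ring.
have -> : u e0 * v e0 = P * N * (u e0 * v e0) by rewrite PN mul1r.
field; exact: lt0r_neq0.
Qed.

Lemma hyperboloid_gram x i j : U x -> g x i j =
  form light_cone (fun a => pd i (hyperboloid a) x) (fun a => pd j (hyperboloid a) x).
Proof.
move=> Ux; rewrite light_cone_form.
have [Qi Pi] := hyperboloid_pd i Ux; have [Qj Pj] := hyperboloid_pd j Ux.
have PN : expR (lambda * phi x 0 e0) * expR (- lambda * phi x 0 e0) = 1.
  by rewrite -expRD mulNr subrr expR0.
have NN : expR (- lambda * phi x 0 e0) * expR (- lambda * phi x 0 e0) =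
    expR (- (2 * lambda * phi x 0 e0)).
  by rewrite -expRD; congr expR; ring.
rewrite gE // Qi Qj !Pi !Pj eqxx (bigD1 e0) //= wt0 mul1r.
rewrite (eq_bigr (fun b => expR (- (2 * lambda * phi x 0 e0)) *
    (pd i (fun y => phi y 0 b) x * pd j (fun y => phi y 0 b) x))); last first.
  by move=> b /negPf be; rewrite /wt be.
rewrite -mulr_sumr -NN; apply: (etrans (gram_identity (fun b => phi x 0 b)
  (fun b => pd i (fun y => phi y 0 b) x) (fun b => pd j (fun y => phi y 0 b) x) PN)).
congr (_ + _); apply: eq_bigr => b /negPf be.
by rewrite Pi Pj be.
Qed.

Lemma an_pullback_curvature x l q i j : U x -> curvature g l q i j x =
  - lambda ^+ 2 * (g x j q * (l == i)%:R - g x i q * (l == j)%:R).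
Proof.
have mk : (1 + (1 + p) = 1 + k)%N by rewrite kn.
have K0 : lambda ^+ 2 != 0 by rewrite expf_neq0 // lt0r_neq0.
have FF y : U y -> form light_cone (hyperboloid ^~ y) (hyperboloid ^~ y) = - (lambda ^+ 2)^-1.
  by move=> _; exact: hyperboloid_norm.
have gram y : U y -> forall i' j', g y i' j' =
  form light_cone (fun a => pd i' (hyperboloid a) y) (fun a => pd j' (hyperboloid a) y).
  by move=> Uy i' j'; exact: hyperboloid_gram.
exact: (hyperquadric_curvature light_coneC mk K0 oU hyperboloid_Ck FF gram gu).
Qed.

End HyperbolicCoordinates.

(** * Ricci tensor and sectional curvature of a curvature tensor of constant type *)

Section ConstantCurvature.
Context (R : realType) (k : nat) (g : 'rV[R]_k -> 'M[R]_k) (x : 'rV[R]_k) (K : R).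
Context (gK : forall l q i j, curvature g l q i j x =
  - K * (g x j q * (l == i)%:R - g x i q * (l == j)%:R)).

Lemma constant_curvature_ricci : (g x)^T = g x -> ricci g x = (- K * (k%:R - 1)) *: g x.
Proof.
move=> gT; apply/matrixP => j q; rewrite !mxE.
under eq_bigr do rewrite gK.
rewrite -mulr_sumr sumrB -mulr_sumr -mulrA; congr (_ * _).
rewrite (eq_bigr (fun=> 1)) => [|l _]; last by rewrite eqxx.
rewrite sumr_const card_ord (bigD1 j) //= eqxx mulr1 big1 ?addr0 => [|l /negPf ->]; last exact: mulr0.
by rewrite mulrBl mul1r mulrC.
Qed.

Lemma inner_curvature_op u v : (g x)^T = g x ->
  inner g x (curvature_op g x u v v) u =
  - K * (inner g x u u * inner g x v v - inner g x u v ^+ 2).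
Proof.
move=> gT.
have innerE a b : inner g x a b = \sum_i \sum_j a 0 i * b 0 j * g x i j.
  rewrite /inner mxE exchange_big; apply: eq_bigr => j _ /=; rewrite mxE mulr_suml.
  by apply: eq_bigr => i _; rewrite !mxE; ring.
have gS i j : g x i j = g x j i by rewrite -[in LHS]gT mxE.
have innerC a b : inner g x a b = inner g x b a.
  rewrite !innerE exchange_big; apply: eq_bigr => j _; apply: eq_bigr => i _ /=.
  by rewrite gS [a 0 _ * _]mulrC.
have innerD (s t : R) a b c : inner g x (s *: a + t *: b) c = s * inner g x a c + t * inner g x b c.
  by rewrite /inner !mulmxDl -!scalemxAl !mxE.
suff -> : curvature_op g x u v v = (- K * inner g x v v) *: u + (K * inner g x u v) *: v.
  by rewrite innerD [inner g x v u]innerC; ring.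
apply/rowP => l; rewrite !mxE !innerE.
transitivity (\sum_i \sum_j \sum_q (- K * (v 0 j * v 0 q * g x j q) * ((l == i)%:R * u 0 i)
   + K * (u 0 i * v 0 q * g x i q) * ((l == j)%:R * v 0 j))).
  apply: eq_bigr => i _; apply: eq_bigr => j _; apply: eq_bigr => q _; rewrite gK; ring.
rewrite (eq_bigr (fun i => (- K * \sum_j \sum_q v 0 j * v 0 q * g x j q) * ((l == i)%:R * u 0 i)
   + (K * \sum_q u 0 i * v 0 q * g x i q) * v 0 l)); last first.
  move=> i _; under eq_bigr do rewrite big_split /=.
  rewrite big_split /=; congr (_ + _).
    rewrite mulr_sumr mulr_suml; apply: eq_bigr => j _.
    by rewrite mulr_sumr mulr_suml.
  rewrite (bigD1 l) //= [X in _ + X]big1 ?addr0 => [|j /negPf jl]; last first.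
    by rewrite big1 // => q _; rewrite [l == j]eq_sym jl mul0r mulr0.
  rewrite mulr_sumr mulr_suml; apply: eq_bigr => q _; by rewrite eqxx mul1r.
rewrite big_split /=; congr (_ + _).
  rewrite -mulr_sumr; congr (_ * _).
  rewrite (bigD1 l) //= eqxx mul1r big1 ?addr0 // => i /negPf il.
  by rewrite [l == i]eq_sym il mul0r.
by rewrite -mulr_suml -mulr_sumr.
Qed.

(* The denominator of [sectional] is the Gram determinant of [u] and [v], positive since
   [g x] is positive definite. *)
Lemma constant_curvature_sectional u v : (g x)^T = g x ->
  (forall w : 'rV[R]_k, w != 0 -> 0 < (w *m g x *m w^T) 0 0) ->
  row_free (col_mx u v) -> sectional g x u v = - K.
Proof.
move=> gT gpos uvf; rewrite /sectional inner_curvature_op //.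
rewrite mulfK //.
pose a := inner g x u u; pose b := inner g x u v; pose c := inner g x v v.
have lin (s t : R) : s *: u + t *: v = 0 -> s = 0 /\ t = 0.
  move=> E; have : row_mx s%:M t%:M *m col_mx u v = 0 by rewrite mul_row_col !mul_scalar_mx.
  have /row_free_ker0 ker := uvf; move=> /ker /eqP; rewrite row_mx_eq0 => /andP[/eqP s0 /eqP t0].
  have /matrixP/(_ 0 0) := s0; have /matrixP/(_ 0 0) := t0.
  by rewrite !mxE !eqxx !mulr1n.
have vn0 : v != 0.
  apply/eqP => v0; have [|_ /eqP] := lin 0 1; first by rewrite v0 scale0r scaler0 addr0.
  by rewrite oner_eq0.
have c0 : 0 < c by exact: gpos.
have innerC : inner g x v u = b.
  transitivity ((v *m g x *m u^T)^T 0 0); first by rewrite /inner [RHS]mxE.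
  by rewrite !trmx_mul trmxK gT mulmxA.
pose w : 'rV[R]_k := c *: u + (- b) *: v.
have w0 : w != 0.
  apply/eqP => E; have [|c00 _] := lin c (- b); first exact: E.
  by move: c0; rewrite c00 ltxx.
have := gpos w w0.
have -> : (w *m g x *m w^T) 0 0 = c * (a * c - b ^+ 2).
  have bl (s t : R) y z r : inner g x (s *: y + t *: z) r = s * inner g x y r + t * inner g x z r.
    by rewrite /inner !mulmxDl -!scalemxAl !mxE.
  have br (s t : R) y z r : inner g x r (s *: y + t *: z) = s * inner g x r y + t * inner g x r z.
    have tr : (s *: y + t *: z)^T = s *: y^T + t *: z^T by apply/matrixP => i j; rewrite !mxE.
    by rewrite /inner tr mulmxDr -!scalemxAr !mxE.
  by rewrite -[LHS]/(inner g x w w) /w bl !br innerC -/a -/b -/c; ring.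
by rewrite pmulr_rgt0 // => /lt0r_neq0.
Qed.

End ConstantCurvature.

Section PullbackCurvature.
Context (R : realType) (n : nat) (lambda : R) (l0 : 0 < lambda).
Local Notation p := n.-1.

(** A square root of the metric, so that pullbacks become Gram matrices of Jacobians. *)
Lemma an_metric_sqr c a : @an_metric R n lambda c a =
  scaling n (- (lambda * a 0 (i0 n))) *m (scaling n (- (lambda * a 0 (i0 n))))^T.
Proof. by rewrite an_metricE tr_scaling scalingD; congr scaling; ring. Qed.

Lemma scaling_unit s : scaling (R := R) n s \in unitmx.
Proof.
have E : scaling n s *m scaling n (- s) = 1%:M :> 'M[R]_(1 + p).
  by rewrite scalingD subrr scaling0.
by have [] := mulmx1_unit E.
Qed.

Context (k : nat) (U : set 'rV[R]_k) (phi : 'rV[R]_k -> 'rV[R]_(1 + p)) (g : 'rV[R]_k -> 'M[R]_k).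
Context (kn : k = (1 + p)%N) (oU : open U) (phis : smooth_on U phi).
Context (Jfree : forall x, U x -> row_free (jacobian phi x)).
Context (gE : forall x, U x -> g x =
  jacobian phi x *m @an_metric R n lambda tt (phi x) *m (jacobian phi x)^T).

Lemma an_pullback_constant_curvature x l q i j : U x -> curvature g l q i j x =
  - lambda ^+ 2 * (g x j q * (l == i)%:R - g x i q * (l == j)%:R).
Proof.
move=> Ux; apply: (@an_pullback_curvature R n lambda l0 k U phi g kn oU (phis 3)) Ux => y Uy.
  have dphi : differentiable phi y by have [+ _] := phis 1%N; apply.
  move=> i' j'; rewrite gE //.
  have -> : (jacobian phi y *m @an_metric R n lambda tt (phi y) *m (jacobian phi y)^T) i' j' =
     (row i' (jacobian phi y) *m @an_metric R n lambda tt (phi y) *m (row j' (jacobian phi y))^T) 0 0.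
    rewrite -row_mul tr_row; rewrite !mxE; apply: eq_bigr => b _; rewrite !mxE.
    by congr (_ * _); rewrite mxE.
  rewrite an_metric_inner; apply: eq_bigr => b _.
  have rE i'' : row i'' (jacobian phi y) 0 b = pd i'' (fun z => phi z 0 b) y.
    by rewrite [LHS]mxE; exact: jacobianE.
  by rewrite !rE.
rewrite gE // an_metric_sqr !mulmxA -mulmxA -trmx_mul.
apply: gram_row_free_unit; rewrite /row_free mxrankMfree ?Jfree //.
  exact: Jfree.
by rewrite row_free_unit scaling_unit.
Qed.

End PullbackCurvature.

Lemma an_hyperbolic (R : realType) (n : nat) (lambda : R) : (1 < n)%N -> 0 < lambda ->
  real_hyperbolic_space (@an_metric R n lambda).
Proof.
move=> n1 l0; have posdef := an_metric_riemannian n lambda.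
split; [exact: euclidean_manifold | by [] | exact: normed_simply_connected | exact: an_complete |].
split; first by rewrite /= add1n prednK // ltnW.
exists (- lambda ^+ 2); first by rewrite oppr_lt0 exprn_gt0.
move=> c q _ u v uv; have [_ /(_ c q I) [gT gpos] _] := posdef.
apply: constant_curvature_sectional => // l r i j.
have ids : smooth_on setT (id : 'rV[R]_(1 + n.-1) -> 'rV[R]_(1 + n.-1)).
  by move=> s; exact: Ck_id.
have Jfree (x : 'rV[R]_(1 + n.-1)) : [set: 'rV[R]_(1 + n.-1)] x -> row_free (jacobian id x).
  by move=> _; rewrite jacobian_id row_free_unit unitmx1.
have gE (x : 'rV[R]_(1 + n.-1)) : [set: 'rV[R]_(1 + n.-1)] x -> @an_metric R n lambda c x =
    jacobian id x *m @an_metric R n lambda tt (id x) *m (jacobian id x)^T.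
  by move=> _; rewrite jacobian_id mul1mx trmx1 mulmx1; case: c {gT gpos}.
exact: (an_pullback_constant_curvature l0 erefl openT ids Jfree gE l r i j I).
Qed.

(** * Immersed subgroups of full dimension *)

(** An open and closed set is restricted to the line through one of its points and an arbitrary
    point; the real line is connected. *)
Lemma normed_connected (R : realType) (V : normedModType R) : connected [set: V].
Proof.
move=> B [x0 Bx0] [C oC] + [D cD]; rewrite !setTI => BC BD.
apply/seteqP; split=> // z _.
pose l (t : R) := x0 + t *: (z - x0).
have lC : continuous l.
  by move=> t; apply: cvgD; [exact: cvg_cst | apply: cvgZr_tmp; exact: cvg_id].
have Rc : connected [set: R] by apply/connected_intervalP => x y _ _ t _.
have lB : l @^-1` B = [set: R].
  apply: Rc.
  - by exists 0; rewrite /= /l scale0r addr0.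
  - exists (l @^-1` C); last by rewrite setTI BC.
    by apply: open_comp => // t _; exact: lC.
  - exists (l @^-1` D); last by rewrite setTI BD.
    by apply: closed_comp => // t _; exact: lC.
have : (l @^-1` B) 1 by rewrite lB.
by rewrite /= /l scale1r addrC subrK.
Qed.

Section Charts.
Context (R : realType) (M : charted R) (Mm : manifold M).
Implicit Types (c : chart M) (q : M).

Definition cdom c : set 'rV[R]_(Defs.dim M) := crd c @` dom c.

Lemma chart_at q : exists c, dom c q.
Proof. by have [_ _ /(_ q) + _ _] := Mm. Qed.

Lemma dom_open c : open (dom c).
Proof. by have [_ _ _ /(_ c)[+ _ _ _ _] _] := Mm. Qed.

Lemma cdom_open c : open (cdom c).
Proof. by have [_ _ _ /(_ c)[_ + _ _ _] _] := Mm. Qed.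

Lemma crdK c q : dom c q -> par c (crd c q) = q.
Proof. by have [_ _ _ /(_ c)[_ _ + _ _] _] := Mm; apply. Qed.

Lemma parK c x : cdom c x -> crd c (par c x) = x.
Proof. by move=> [q cq <-]; rewrite crdK. Qed.

Lemma crd_cdom c q : dom c q -> cdom c (crd c q).
Proof. by move=> cq; exists q. Qed.

Lemma crd_continuous c q : dom c q -> {for q, continuous (crd c)}.
Proof.
move=> cq; have [_ _ _ /(_ c)[oc _ _ + _] _] := Mm.
by rewrite continuous_open_subspace // => /(_ q); apply; rewrite inE.
Qed.

Lemma par_continuous c x : cdom c x -> {for x, continuous (par c)}.
Proof.
move=> cx; have [_ _ _ /(_ c)[_ oc _ _ +] _] := Mm.
by rewrite continuous_open_subspace // => /(_ x); apply; rewrite inE.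
Qed.

Lemma smooth_in_chart m (f : M -> euclidean R m) c :
  smooth_map f -> smooth_on (cdom c) (f \o par c).
Proof.
move=> [_ /(_ c tt)]; rewrite /= (_ : dom c `&` f @^-1` setT = dom c) //.
by rewrite preimage_setT setIT.
Qed.

Lemma locally_constant_in_charts (h : M -> R) :
  (forall c x, cdom c x -> differentiable (h \o par c) x) ->
  (forall c x v, cdom c x -> 'D_v (h \o par c) x = 0) ->
  forall q, \forall q' \near q, h q' = h q.
Proof.
move=> dh h0 q; have [c cq] := chart_at q.
have [r /= r0 rU] : exists2 r : R, 0 < r & ball (crd c q) r `<=` cdom c.
  have /nbhs_ballP[r /= r0 rU] : nbhs (crd c q) (cdom c).
    by apply: open_nbhs_nbhs; split; [exact: cdom_open | exact: crd_cdom].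
  by exists r.
have nc : \forall q' \near q, ball (crd c q) r (crd c q').
  by apply: (crd_continuous cq); exact: nbhsx_ballx.
have nd : \forall q' \near q, dom c q' by apply: open_nbhs_nbhs; split => //; exact: dom_open.
move: nc nd; apply: filterS2 => q'; rewrite -ball_normE /= => rq' cq'.
pose w := crd c q' - crd c q.
have seg (s : R) : 0 <= s <= 1 -> cdom c (crd c q + s *: w).
  move=> /andP[s0 s1]; apply: rU; rewrite -ball_normE /= opprD addNKr normrN normrZ ger0_norm //.
  rewrite /w distrC (le_lt_trans _ rq') // ler_piMl //.
have [s s01] := MVT_line (f := h \o par c) ler01 (fun s s01 => dh c _ (seg s s01)).
rewrite h0; last exact: seg.
rewrite scale1r mulr0 /w [crd c q + _]addrC subrK /= !crdK // => /eqP.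
by rewrite subr_eq0 => /eqP.
Qed.

(** Level sets are open by [locally_constant_in_charts], and so are their complements. This is how
    connectedness of [S] is used. *)
Lemma constant_of_derive0 (h : M -> R) : connected [set: M] ->
  (forall c x, cdom c x -> differentiable (h \o par c) x) ->
  (forall c x v, cdom c x -> 'D_v (h \o par c) x = 0) ->
  forall q q', h q = h q'.
Proof.
move=> Mc dh h0 q q'; have lc := locally_constant_in_charts dh h0.
have oA (B : set R) : open (h @^-1` B).
  rewrite openE => z /= Bz; apply: filterS (lc z) => z' /= ->; exact: Bz.
have : h @^-1` [set h q'] = [set: M].
  apply: Mc; first by exists q'.
    by exists (h @^-1` [set h q']); rewrite ?setTI.
  exists (h @^-1` [set h q']); rewrite ?setTI //.
  by rewrite -[h @^-1` _]setCK; apply: open_closedC; exact: (oA (~` [set h q'])).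
by move=> /seteqP[_ /(_ q)]; apply.
Qed.

End Charts.

(** * Two-sided group laws from the left-sided ones *)

Section OpenSubgroup.
Context (T : Type) (op : T -> T -> T) (e : T) (iv : T -> T).
Context (opA : associative op) (op1 : left_id e op) (opV : left_inverse e iv op).

Lemma group_mulVr : right_inverse e iv op.
Proof.
move=> x; rewrite -[LHS]op1 -(opV (iv x)) -opA [op (iv x) _]opA opV op1 opV //.
Qed.

Lemma group_mul1r : right_id e op.
Proof. by move=> x; rewrite -(opV x) opA group_mulVr op1. Qed.

End OpenSubgroup.

Section LocalDiffeomorphism.
Context (R : realType) (M : charted R) (Mm : manifold M) (m : nat).
Context (f : M -> euclidean R m) (fs : smooth_map f) (finj : injective f).
Context (Jfree : forall c x, cdom c x -> row_free (jacobian (f \o par c) x)).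
Context (Mdim : Defs.dim M = m).

(** In a chart this is [injective_open]; with equal dimensions the row-free Jacobian is row-full. *)
Lemma immersion_open q (W : set M) : nbhs q W -> nbhs (f q) (f @` W).
Proof.
move=> Wq; have [c cq] := chart_at Mm q.
pose V := [set x | cdom c x /\ W (par c x)].
have nV : nbhs (crd c q) V.
  have cx := crd_cdom cq.
  apply: filterI; first by apply: open_nbhs_nbhs; split => //; exact: cdom_open.
  by apply: (par_continuous Mm cx); rewrite crdK.
pose U := interior V.
have UV : U `<=` V by exact: interior_subset.
have Uc y : U y -> cdom c y by move=> /UV[].
have : nbhs (f (par c (crd c q))) ((f \o par c) @` U).
  apply: (@injective_open R _ _ U (f \o par c)).
  - exact: open_interior.
  - exact: nV.
  - move=> y z /Uc cy /Uc cz /= /finj E.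
    by rewrite -(parK Mm cy) E parK.
  - move=> y /Uc cy; have [d _] := smooth_in_chart c fs 1%N; exact: d cy.
  - move=> y /Uc cy; have := Jfree cy; rewrite /row_free /row_full => /eqP ->.
    by rewrite Mdim.
rewrite crdK //; apply: filterS => _ [y Uy <-].
by exists (par c y) => //; have [] := UV y Uy.
Qed.

(** The image is a subgroup, open by [immersion_open]. An open subgroup is closed, since its
    complement is a union of cosets, and the target is connected. *)
Lemma homomorphism_surjective (mul : M -> M -> M) (one : M) (inv : M -> M)
    (op : 'rV[R]_m -> 'rV[R]_m -> 'rV[R]_m) (e : 'rV[R]_m) (iv : 'rV[R]_m -> 'rV[R]_m) :
  associative op -> left_id e op -> left_inverse e iv op ->
  (forall z, continuous (op z)) ->
  f one = e -> left_inverse one inv mul ->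
  {morph f : x y / mul x y >-> op x y} ->
  forall z, exists q, f q = z.
Proof.
move=> opA op1 opV opC f1 mulV fM.
have op1r := group_mul1r opA op1 opV; have opVr := group_mulVr opA op1 opV.
pose H := [set z | exists q, f q = z].
have oH : open H.
  rewrite openE => _ [q <-]; have nT : nbhs q setT by exact: filterT.
  have := immersion_open nT.
  by apply: filterS => _ [q' _ <-]; exists q'.
have finv q : f (inv q) = iv (f q).
  have : op (f (inv q)) (f q) = e by rewrite -fM mulV.
  by move=> /(congr1 (fun w => op w (iv (f q)))); rewrite -opA opVr op1r op1.
have cH : closed H.
  rewrite -[H]setCK; apply: open_closedC; rewrite openE => z Hz /=.
  (* The coset zH is a neighbourhood of [z]; if it met [H] at [w], then z = w (z^-1 w)^-1 would lie
     in [H]. *)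
  have : nbhs (op (iv z) z) H by rewrite opV; apply: open_nbhs_nbhs; split => //; exists one.
  move=> /(opC (iv z) z) nz; suff : nbhs z (~` H) by [].
  have nz' : nbhs z [set w | H (op (iv z) w)] by exact: nz.
  apply: (@filterS _ (nbhs z) _ _ _ _ nz') => w [h hE] [q qE]; apply: Hz.
  exists (mul q (inv h)); rewrite fM finv qE hE.
  have : op z (op (iv z) w) = w by rewrite opA opVr op1.
  move: (op (iv z) w) => u <-; by rewrite -opA opVr op1r.
have : H = [set: 'rV[R]_m].
  apply: normed_connected; first by exists (f one); exists one.
    by exists H; rewrite ?setTI.
  by exists H; rewrite ?setTI.
by move=> /seteqP[_ +] z => /(_ z); apply.
Qed.

(** Openness of [f] is continuity of the inverse, the hypothesis from which [inverse_Ck] derives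
    smoothness. *)
Lemma bijective_immersion_diffeomorphism : (forall z, exists q, f q = z) -> diffeomorphism f.
Proof.
move=> /choice[f' ff']; split=> //; exists f'.
have f'f : cancel f f' by move=> q; apply: finj; rewrite ff'.
have f'C : continuous f'.
  move=> z W nW; have := immersion_open nW; rewrite ff'; apply: filterS => _ [q Wq <-].
  by rewrite /= f'f.
split=> //; split=> // c d r.
have -> : crd c @` (dom c `&` f' @^-1` dom d) = f' @^-1` dom d.
  by rewrite /= setTI image_id.
have oU' : open (f' @^-1` dom d) by apply: open_comp => [z _|]; [exact: f'C | exact: dom_open].
have -> : (crd d \o f') \o par c = crd d \o f' by [].
apply: (@inverse_Ck R _ _ r (cdom d) _ (f \o par d)) => //.
- exact: cdom_open.
- exact: smooth_in_chart.
- exact: Jfree.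
- by move=> y; exact: crd_cdom.
- by move=> y dy; apply: continuous_comp; [exact: f'C | exact: crd_continuous].
- by move=> y dy /=; rewrite crdK.
Qed.

End LocalDiffeomorphism.

(** * Subgroups of AN *)

Section LeftInvariance.
Context (R : realType) (n : nat) (lambda : R) (S : charted R)
  (mul : S -> S -> S) (one : S) (inv : S -> S) (iota : S -> AN R n).
Context (SG : lie_group mul one inv) (Ssub : lie_subgroup mul (@an_mul R n lambda) iota).

Lemma lie_manifold : manifold S. Proof. by have [] := SG. Qed.

Lemma iota_smooth : smooth_map iota. Proof. by have [_ _ []] := Ssub. Qed.

Lemma iota_one : iota one = an_one R n.
Proof.
have [_ [_ mul1 _ _ _] _ _] := SG; have [_ iM _] := Ssub.
have E : an_mul lambda (iota one) (iota one) = iota one by rewrite -iM mul1.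
rewrite -(an_mulV lambda (iota one)) -[in X in an_mul _ _ X]E an_mulA an_mulV an_mul1 //.
Qed.

(** Smoothness is assumed for the multiplication on the product, so the left translation is written
    as its restriction to a slice; in the product chart the slice is the affine map y |-> (a, y). *)
Lemma translation_differentiable p (c d : chart S) : dom c one -> dom d p ->
  differentiable (crd c \o mul (inv p) \o par d) (crd d p).
Proof.
move=> c1 dp; have [Sm [_ _ _ mulV _] [_ muls] _] := SG.
have [e ep] := chart_at Sm (inv p).
have [dm _] := muls (e, d) c 1%N.
pose A : 'M[R]_(Defs.dim S, Defs.dim S + Defs.dim S) := row_mx 0 1%:M.
pose a := crd e (inv p).
have rowE y : row_mx a 0 + y *m A = row_mx a y.
  by rewrite /A mul_mx_row mulmx0 mulmx1 add_row_mx addr0 add0r.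
have -> : crd c \o mul (inv p) \o par d =
    (crd c \o (fun q => mul q.1 q.2) \o @par R (prod_charted S S) (e, d)) \o (fun y => row_mx a 0 + y *m A).
  apply/funext => y /=; rewrite rowE row_mxKl row_mxKr.
  by rewrite /a crdK.
have dA : differentiable (fun y : 'rV[R]_(Defs.dim S) => row_mx a 0 + y *m A) (crd d p).
  by have [+ _] := @affine_Ck R _ _ 1 setT (row_mx a 0) A openT; apply.
apply: (differentiable_comp dA); rewrite rowE; apply: dm.
exists (inv p, p) => //; split=> //=.
by rewrite mulV.
Qed.

(** Near [p], [iota] is left translation by p^-1 in [S], then [iota] near the identity, then left
    translation by [iota p] in AN. The first map has Jacobian [B]; only its existence is stated, and
    rank information is recovered later from the metric. *)
Lemma left_invariant_tangent p (c d : chart S) : dom c one -> dom d p ->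
  exists B, jacobian (iota \o par d) (crd d p) =
    B *m (jacobian (iota \o par c) (crd c one) *m scaling n (lambda * iota p 0 (i0 n))).
Proof.
move=> c1 dp; have [Sm [mulA mul1 _ mulV mulVr] [mulC _] _] := SG.
have [_ iM _] := Ssub.
pose psi := crd c \o mul (inv p) \o par d.
have dpsi : differentiable psi (crd d p) by exact: translation_differentiable.
have psi1 : psi (crd d p) = crd c one by rewrite /psi /= crdK // mulV.
have diota (c' : chart S) x : cdom c' x -> differentiable (iota \o par c') x.
  by move=> cx; have [+ _] := smooth_in_chart c' iota_smooth 1%N; apply.
pose L := (an_mul lambda (iota p) : 'rV[R]_(1 + n.-1) -> 'rV[R]_(1 + n.-1)).
have dL x : differentiable L x.
  rewrite /L (_ : an_mul _ _ = fun b => iota p + b *m scaling n (lambda * iota p 0 (i0 n))).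
    by have [+ _] := @affine_Ck R _ _ 1 setT (iota p) (scaling n (lambda * iota p 0 (i0 n))) openT; apply.
  by apply/funext => b; rewrite an_mulE.
have near_id : {near crd d p, L \o (iota \o par c) \o psi =1 iota \o par d}.
  have np : \forall q \near p, dom c (mul (inv p) q).
    have mp : {for p, continuous (mul (inv p))}.
      apply: (@continuous_comp _ _ _ (fun q => (inv p, q)) (fun q => mul q.1 q.2)); last exact: mulC.
      by apply: cvg_pair; [exact: cvg_cst | exact: cvg_id].
    apply: mp; apply: open_nbhs_nbhs; split; first exact: dom_open.
    by rewrite mulV.
  have nx : \forall x \near crd d p, dom c (mul (inv p) (par d x)).
    have npar : nbhs (par d (crd d p)) [set q | dom c (mul (inv p) q)] by rewrite crdK.
    exact: (par_continuous Sm (crd_cdom dp)) _ npar.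
  apply: filterS nx => x cx /=; rewrite crdK // /L -iM.
  by rewrite mulA mulVr mul1.
exists (jacobian psi (crd d p)).
have dip : differentiable (iota \o par c) (psi (crd d p)).
  by rewrite psi1; apply: diota; exact: crd_cdom.
rewrite -(near_eq_jacobian near_id).
  rewrite -[_ \o psi]/((L \o (iota \o par c)) \o psi) jacobian_comp //.
    by rewrite jacobian_comp // jacobian_an_mul psi1.
  exact: differentiable_comp.
apply: differentiable_comp => //; exact: differentiable_comp.
Qed.

End LeftInvariance.

(** * Orthonormal bases adapted to the Lie algebra of the subgroup *)

Section GramSchmidt.
Context (R : realType) (n : nat).

(** Gram-Schmidt starting from the last row. The coefficient matrix of the lower rows is invertible,
    so a zero remainder [w] would make the first row depend on them. *)
Lemma row_free_orthonormal r (V : 'M[R]_(r, n)) : row_free V ->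
  exists Q : 'M[R]_(r, n), exists C : 'M[R]_r, Q *m Q^T = 1%:M /\ V = C *m Q.
Proof.
elim: r V => [|r IH] V Vfree.
  by exists 0, 0; split; apply/matrixP => -[].
move: V Vfree; rewrite -[r.+1]/(1 + r)%N => V Vfree.
pose v : 'rV[R]_n := usubmx V; pose V' : 'M[R]_(r, n) := dsubmx V.
have VE : V = col_mx v V' by rewrite vsubmxK.
have ker (s : R) (u : 'rV[R]_r) : s *: v + u *m V' = 0 -> s = 0 /\ u = 0.
  move=> E; have : row_mx s%:M u *m V = 0.
    by rewrite VE mul_row_col mul_scalar_mx.
  have /row_free_ker0 k0 := Vfree; move=> /k0/eqP; rewrite row_mx_eq0 => /andP[/eqP s0 /eqP u0].
  by have /matrixP/(_ 0 0) := s0; rewrite !mxE eqxx mulr1n.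
have V'free : row_free V'.
  apply/row_free_ker0 => u uV; have [|_ ->] := ker 0 u; last by [].
  by rewrite scale0r add0r.
have [Q [C [QQ V'E]]] := IH V' V'free.
have Cu : C \in unitmx.
  rewrite -row_free_unit; apply/row_free_ker0 => u uC.
  have /row_free_ker0 k0 := V'free; apply: k0; by rewrite V'E mulmxA uC mul0mx.
pose w := v - v *m Q^T *m Q.
have w0 : w != 0.
  apply/eqP => w0; have [|/eqP] := ker 1 (- (v *m Q^T *m invmx C)).
    by rewrite scale1r mulNmx V'E mulmxA mulmxKV.
  by rewrite oner_eq0.
have wQ : w *m Q^T = 0 by rewrite mulmxBl -[_ *m Q *m _]mulmxA QQ mulmx1 subrr.
pose s := Num.sqrt (sqn w).
have s0 : 0 < s by rewrite sqrtr_gt0 sqn_gt0.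
have ss : s * s = sqn w by rewrite -expr2 sqr_sqrtr // sqn_ge0.
exists (col_mx (s^-1 *: w) Q), (block_mx s%:M (v *m Q^T) 0 C).
split.
  rewrite [X in _ *m X]tr_col_mx mul_col_row QQ.
  have -> : (s^-1 *: w) *m Q^T = 0 by rewrite -scalemxAl wQ scaler0.
  have -> : Q *m (s^-1 *: w)^T = 0.
    by apply: trmx_inj; rewrite trmx_mul trmxK trmx0 -scalemxAl wQ scaler0.
  have -> : (s^-1 *: w) *m (s^-1 *: w)^T = 1%:M.
    apply/matrixP => i j; rewrite !ord1 -[LHS]/(sqn (s^-1 *: w)) mxE eqxx.
    have -> : sqn (s^-1 *: w) = s^-1 ^+ 2 * sqn w.
      by rewrite !sqnE mulr_sumr; apply: eq_bigr => l _; rewrite mxE exprMn.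
    rewrite -ss /=; field; exact: lt0r_neq0.
  by rewrite -scalar_mx_block.
rewrite [LHS]VE [RHS]mul_block_col mul0mx add0r -V'E; congr col_mx.
by rewrite mul_scalar_mx scalerA mulfV ?scale1r ?lt0r_neq0 // /w subrK.
Qed.

Lemma orthonormal_basis k (X : 'M[R]_(k, n)) :
  exists Q : 'M[R]_(\rank X, n), exists C : 'M[R]_(k, \rank X),
    Q *m Q^T = 1%:M /\ X = C *m Q.
Proof.
have [Q [C [QQ CE]]] := row_free_orthonormal (row_base_free X).
have /submxP[D DE] : (X <= row_base X)%MS by rewrite eq_row_base.
by exists Q, (D *m C); split=> //; rewrite -mulmxA -CE.
Qed.

(* [tau] is the component along [B] of a basis of the tangent space at the identity; when
   it is not zero this space is spanned by [(1, U)] and by the rows of [(0, Q)]. *)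
Lemma transversal_basis k (tau : 'cV[R]_k) (Y : 'M[R]_(k, n)) :
  tau != 0 -> row_free (row_mx tau Y) ->
  exists (r : nat) (Q : 'M[R]_(r, n)) (C : 'M[R]_(k, r)) (U : 'rV[R]_n),
    [/\ k = (1 + r)%N, Q *m Q^T = 1%:M, U *m Q^T = 0 & Y = tau *m U + C *m Q].
Proof.
move=> tau0 Yfree.
have [a atau] : exists a : 'rV[R]_k, a *m tau = 1%:M.
  have /matrix0Pn[i [j]] := tau0; rewrite ord1 => taui.
  exists ((tau i 0)^-1 *: delta_mx 0 i); rewrite -scalemxAl -rowE.
  by apply/matrixP => i' j'; rewrite !ord1 !mxE eqxx mulVf.
(* (1, U0) is a tangent vector, and subtracting multiples of it from the given basis leaves vectors
   (0, Z) in g_alpha. [U] will be the part of [U0] orthogonal to the row space of [Z]. *)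
pose U0 := a *m Y; pose Z := Y - tau *m U0.
have aX : a *m Z = 0 by rewrite mulmxBr mulmxA atau mul1mx subrr.
have [Q [C0 [QQ ZE]]] := orthonormal_basis Z.
have YE : Y = tau *m (U0 - U0 *m Q^T *m Q) + (C0 + tau *m U0 *m Q^T) *m Q.
  have YX : Y = tau *m U0 + Z by rewrite /Z addrC subrK.
  apply: (etrans YX); by rewrite mulmxBr mulmxDl -ZE !mulmxA addrACA addNr addr0.
exists (\rank Z), Q, (C0 + tau *m U0 *m Q^T), (U0 - U0 *m Q^T *m Q); split=> //.
  (* The basis factors through 1 + rank Z vectors, whence one inequality; the other holds because
     the nonzero row [a] annihilates [Z]. *)
  apply/eqP; rewrite eqn_leq; apply/andP; split.
    apply: (@leq_trans (\rank (row_mx tau Y))); first by rewrite (eqP Yfree).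
    rewrite YE.
    have -> : row_mx tau (tau *m (U0 - U0 *m Q^T *m Q) + (C0 + tau *m U0 *m Q^T) *m Q) =
       row_mx tau (C0 + tau *m U0 *m Q^T) *m block_mx 1%:M (U0 - U0 *m Q^T *m Q) 0 Q.
      by rewrite mul_row_block !mulmx1 mulmx0 addr0.
    by apply: leq_trans (mxrankM_maxl _ _) _; exact: rank_leq_col.
  rewrite add1n ltn_neqAle rank_leq_row andbT.
  apply/negP => /row_free_ker0/(_ a aX) a0.
  by move: atau; rewrite a0 mul0mx => /matrixP/(_ 0 0)/eqP; rewrite !mxE eqxx eq_sym oner_eq0.
by rewrite mulmxBl -[_ *m Q *m _]mulmxA QQ mulmx1 subrr.
Qed.

End GramSchmidt.

Section LinearImages.
Context (R : realType).

Lemma differentiable_mulmxr (V : normedModType R) m l (f : V -> 'rV[R]_m) (N : 'M[R]_(m, l)) x :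
  differentiable f x -> differentiable (fun y => f y *m N) x.
Proof.
move=> df; have dN z : differentiable (fun y : 'rV[R]_m => 0 + y *m N) z.
  by have [+ _] := @affine_Ck R _ _ 1 setT (0 : 'rV[R]_l) N openT; apply.
rewrite (_ : (fun y => f y *m N) = (fun y => 0 + y *m N) \o f); last first.
  by apply/funext => y /=; rewrite add0r.
exact: differentiable_comp.
Qed.

Lemma jacobian_mulmxr k m l (f : 'rV[R]_k -> 'rV[R]_m) (N : 'M[R]_(m, l)) x :
  differentiable f x -> jacobian (fun y => f y *m N) x = jacobian f x *m N.
Proof.
move=> df; have dN z : differentiable (fun y : 'rV[R]_m => 0 + y *m N) z.
  by have [+ _] := @affine_Ck R _ _ 1 setT (0 : 'rV[R]_l) N openT; apply.
rewrite (_ : (fun y => f y *m N) = (fun y => 0 + y *m N) \o f); last first.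
  by apply/funext => y /=; rewrite add0r.
by rewrite jacobian_comp // jacobian_affine.
Qed.

Lemma scaling_block n (s : R) : scaling n s = block_mx 1%:M 0 0 (expR s)%:M.
Proof.
apply/matrixP => i j; rewrite scalingE.
case: (split_ordP i) => i' ->; case: (split_ordP j) => j' ->.
- by rewrite block_mxEul !ord1 !mxE !eqxx mul1r wt0.
- by rewrite block_mxEur mxE eq_lrshift mul0r.
- by rewrite block_mxEdl mxE eq_rlshift mul0r.
- rewrite block_mxEdr mxE /wt eq_rlshift eq_rshift.
  by case: (i' == j'); rewrite ?mul1r ?mul0r ?mulr1n ?mulr0n.
Qed.

End LinearImages.

(** * The induced metric and the two types of subgroups *)

Section Subgroup.
Context (R : realType) (n : nat) (lambda : R) (S : charted R)
  (mul : S -> S -> S) (one : S) (inv : S -> S) (iota : S -> AN R n) (g : bilinear_field S).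
Local Notation p := n.-1.
Context (l0 : 0 < lambda) (SG : lie_group mul one inv) (Sconn : connected [set: S])
  (Ssub : lie_subgroup mul (@an_mul R n lambda) iota)
  (gR : riemannian_metric g) (gP : is_pullback iota (@an_metric R n lambda) g).
Context (c0 : chart S) (c01 : dom c0 one).

Let Sm : manifold S := lie_manifold SG.
Let t (q : S) : R := iota q 0 (i0 n).
Let J0 : 'M[R]_(Defs.dim S, 1 + p) := jacobian (iota \o par c0) (crd c0 one).

Lemma iota_diff c x : cdom c x -> differentiable (iota \o par c) x.
Proof.
by move=> cx; have [+ _] := smooth_in_chart c (iota_smooth Ssub) 1%N; apply.
Qed.

Lemma iota_jacobian c x : cdom c x -> exists B,
  jacobian (iota \o par c) x = B *m (J0 *m scaling n (lambda * t (par c x))).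
Proof.
move=> [q cq <-]; rewrite (crdK Sm cq).
exact: (left_invariant_tangent SG Ssub c01 cq).
Qed.

(** The square root of the metric of AN at [iota q] is the inverse of the scaling in
    [iota_jacobian], so position in AN disappears from the induced metric. *)
Lemma metric_in_chart c x : cdom c x -> exists2 B,
  jacobian (iota \o par c) x = B *m (J0 *m scaling n (lambda * t (par c x))) &
  g c x = (B *m J0) *m (B *m J0)^T.
Proof.
move=> cx; have [B BE] := iota_jacobian cx; exists B => //.
have [q cq xE] := cx; move: BE; rewrite -xE (crdK Sm cq) => BE.
rewrite (gP (d := tt) cq) // an_metric_sqr.
have -> : tangent_mx iota c tt q = B *m (J0 *m scaling n (lambda * t q)) by exact: BE.
rewrite !mulmxA -mulmxA -trmx_mul.
rewrite -[crd _ (iota q)]/(iota q) -/(t q).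
have -> : B *m J0 *m scaling n (lambda * t q) *m scaling n (- (lambda * t q)) = B *m J0.
  by rewrite -mulmxA scalingD subrr scaling0 mulmx1.
by [].
Qed.

(** A vector killed by [J] has zero length. This makes the maps built below immersions, without the
    rank of [B]. *)
Lemma metric_row_free c x m (J : 'M[R]_(Defs.dim S, m)) (M : 'M[R]_m) : cdom c x ->
  g c x = J *m M *m J^T -> row_free J.
Proof.
move=> [q cq <-] gE; have [_ /(_ c q cq) [_ gpos] _] := gR.
apply/row_free_ker0 => v vJ; apply/eqP; apply/negPn/negP => /gpos.
by rewrite gE !mulmxA vJ !mul0mx mxE ltxx.
Qed.

Lemma linear_image_smooth m (N : 'M[R]_(1 + p, m)) :
  smooth_map ((fun q => iota q *m N) : S -> euclidean R m).
Proof.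
have [ic _] := iota_smooth Ssub.
split=> [q|c d r].
  apply: (@continuous_comp _ _ _ iota (fun y : 'rV[R]_(1 + p) => y *m N)); first exact: ic.
  apply: differentiable_continuous; apply: (@differentiable_mulmxr _ _ _ _ id) => //.
rewrite preimage_setT setIT.
have oc : open (cdom c) by exact: cdom_open.
apply: (Ck_mulmx (f := iota \o par c) (g := fun=> N) oc).
  exact: smooth_in_chart (iota_smooth Ssub) r.
exact: Ck_cst.
Qed.

(** The hypothesis says that the function iota P has differential exp(lambda t) u dt on [S].
    Subtracting the primitive of the right-hand side leaves a function with zero derivative that
    vanishes at the identity. *)
Lemma linear_image_constant (P : 'cV[R]_(1 + p)) (u : R) :
  (forall s, J0 *m scaling n s *m P = (expR s * u) *: col (i0 n) J0) ->
  forall q, (iota q *m P) 0 0 = (expR (lambda * t q) - 1) / lambda * u.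
Proof.
move=> JP q.
pose h q := (iota q *m P) 0 0 + - (u / lambda) * (expR (lambda * t q) - 1).
suff : h q = h one.
  have t1 : t one = 0 by rewrite /t (iota_one SG Ssub) mxE.
  have P1 : (iota one *m P) 0 0 = 0 by rewrite (iota_one SG Ssub) mul0mx mxE.
  rewrite /h t1 P1 mulr0 expR0 subrr mulr0 addr0 => /eqP; rewrite addr_eq0 => /eqP ->.
  by rewrite mulNr opprK mulrC mulrA mulrAC.
have di c x : cdom c x -> differentiable (fun y => iota (par c y)) x by exact: iota_diff.
have dP c x : cdom c x -> differentiable (fun y => (iota (par c y) *m P) 0 0) x.
  move=> cx; have /differentiable_mxP : differentiable (fun y => iota (par c y) *m P) x.
    exact/differentiable_mulmxr/di.
  by apply.
have dt c x : cdom c x -> differentiable (fun y => t (par c y)) x.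
  by move=> cx; have /differentiable_mxP := di c x cx; apply.
have dlt c x : cdom c x -> differentiable (fun y => lambda * t (par c y)) x.
  by move=> cx; apply: (differentiableM (differentiable_cst _ _)); exact: dt.
have de c x v : cdom c x -> differentiable (fun y => expR (lambda * t (par c y))) x /\
   'D_v (fun y => expR (lambda * t (par c y))) x =
   expR (lambda * t (par c x)) * (lambda * 'D_v (fun y => t (par c y)) x).
  move=> cx; have [d dE] := derive_scalar_comp v (dlt c x cx) (is_derive_expR _).
  by split=> //; rewrite dE derive_cmul //; exact: dt.
have de1 c x : cdom c x -> differentiable (fun y => expR (lambda * t (par c y)) - 1) x.
  by move=> cx; have [d _] := de c x 0 cx; apply: differentiableB => //; exact: differentiable_cst.
have dce1 c x : cdom c x -> differentiable (fun y => - (u / lambda) * (expR (lambda * t (par c y)) - 1)) x.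
  by move=> cx; apply: (differentiableM (differentiable_cst _ _)); exact: de1.
apply: (constant_of_derive0 Sm Sconn (h := h)) => [c x cx|c x v cx].
  by apply: differentiableD; [exact: dP | exact: dce1].
have -> : 'D_v (h \o par c) x = 'D_v (fun y => (iota (par c y) *m P) 0 0) x +
    - (u / lambda) * (expR (lambda * t (par c x)) * (lambda * 'D_v (fun y => t (par c y)) x)).
  rewrite /h /= derive_add; [|exact: dP|exact: dce1].
  rewrite derive_cmul; last exact: de1.
  have [d dE] := de c x v cx.
  by rewrite [X in _ + _ * X = _]derive_add // dE derive_cst addr0.
have [B BE] := iota_jacobian cx.
have -> : 'D_v (fun y => (iota (par c y) *m P) 0 0) x = (v *m jacobian (iota \o par c) x *m P) 0 0.
  rewrite -[LHS]derive_mxE; last exact/differentiable_mulmxr/di.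
  rewrite deriveEjacobian; last exact/differentiable_mulmxr/di.
  by rewrite jacobian_mulmxr ?mulmxA //; exact: di.
have -> : 'D_v (fun y => t (par c y)) x = (v *m jacobian (iota \o par c) x) 0 (i0 n).
  by rewrite -[LHS]derive_mxE ?deriveEjacobian //; exact: di.
rewrite BE; set s := lambda * _.
have -> : v *m (B *m (J0 *m scaling n s)) *m P = (expR s * u) *: (v *m B *m col (i0 n) J0).
  by rewrite -!mulmxA [J0 *m (_ *m _)]mulmxA JP -!scalemxAr.
have -> : (v *m (B *m (J0 *m scaling n s))) 0 (i0 n) = (v *m B *m col (i0 n) J0) 0 0.
  rewrite !mulmxA mul_mx_diag [LHS]mxE [X in _ * X]mxE wt0 mulr1.
  by rewrite colE mulmxA -colE [RHS]mxE.
rewrite [X in X + _]mxE; field; exact: lt0r_neq0.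
Qed.

Lemma normal_component r (tau : 'cV[R]_(Defs.dim S)) (Q : 'M[R]_(r, p))
    (C : 'M[R]_(Defs.dim S, r)) (U : 'rV[R]_p) :
  Q *m Q^T = 1%:M -> U *m Q^T = 0 -> J0 = row_mx tau (tau *m U + C *m Q) ->
  forall q, rsubmx (iota q) =
    ((expR (lambda * t q) - 1) / lambda) *: U + rsubmx (iota q) *m Q^T *m Q.
Proof.
(* The orthogonal projection that kills the rows of [Q] and fixes [U]; [linear_image_constant] is
   applied to each coordinate of the projected g_alpha-part. *)
move=> QQ UQ JE q; pose W := 1%:M - Q^T *m Q.
have QW : Q *m W = 0 by rewrite mulmxBr mulmx1 mulmxA QQ mul1mx subrr.
have UW : U *m W = U by rewrite mulmxBr mulmx1 mulmxA UQ mul0mx subr0.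
suff E : rsubmx (iota q) *m W = ((expR (lambda * t q) - 1) / lambda) *: U.
  by rewrite -E mulmxBr mulmx1 mulmxA subrK.
apply/rowP => j.
have JP s : J0 *m scaling n s *m col j (col_mx 0 W) = (expR s * U 0 j) *: col (i0 n) J0.
  rewrite colE mulmxA -colE scaling_block JE mul_row_block mul_row_col !mulmx0 !add0r.
  rewrite mul_mx_scalar -scalemxAl mulmxDl -!mulmxA QW UW mulmx0 addr0.
  have -> : col (i0 n) (row_mx tau (tau *m U + C *m Q)) = tau.
    by apply/matrixP => a b; rewrite mxE /i0 row_mxEl !ord1.
  by apply/matrixP => a b; rewrite !mxE big_ord1 !ord1; ring.
rewrite [RHS]mxE -(linear_image_constant JP q).
by rewrite -[in RHS](hsubmxK (iota q)) colE mulmxA mul_row_col mulmx0 add0r -colE [RHS]mxE.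
Qed.

Lemma J0_row_free : row_free J0.
Proof. by have [_ _ [_ im]] := Ssub; exact: (im c0 tt one c01 I). Qed.

Lemma metric_sym c x : cdom c x -> (g c x)^T = g c x.
Proof. by move=> [q cq <-]; have [_ /(_ c q cq) [] ] := gR. Qed.

Lemma linear_image_jacobian m (N : 'M[R]_(1 + p, m)) c x : cdom c x ->
  jacobian ((fun q => iota q *m N) \o par c) x = jacobian (iota \o par c) x *m N.
Proof. by move=> cx; exact: (jacobian_mulmxr N (iota_diff cx)). Qed.

Lemma flat_subgroup : lsubmx J0 = 0 ->
  einstein g /\ exists k, isometric g (@euclidean_metric R k).
Proof.
move=> J00.
have JV : J0 = row_mx 0 (rsubmx J0) by rewrite -J00 hsubmxK.
have Vfree : row_free (rsubmx J0).
  apply/row_free_ker0 => v vV; have /row_free_ker0 k0 := J0_row_free; apply: k0.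
  by rewrite JV mul_mx_row mulmx0 vV row_mx0.
have [Q [C [QQ VE]]] := row_free_orthonormal Vfree.
have JE : J0 = row_mx 0 (0 *m (0 : 'rV[R]_p) + C *m Q).
  by rewrite mul0mx add0r -VE.
(* The column picking the B-coordinate is annihilated by [J0], so [linear_image_constant] applies to
   it with u = 0. *)
have t0 q : t q = 0.
  have JP s : J0 *m scaling n s *m delta_mx (i0 n) 0 = (expR s * 0) *: col (i0 n) J0.
    rewrite mulr0 scale0r scaling_block JE mul_row_block !mulmx0 !mul0mx !addr0 -colE.
    by apply/matrixP => a b; rewrite mxE /i0 row_mxEl !mxE.
  have := linear_image_constant JP q; rewrite mulr0 -colE mxE; exact.
have iE q : rsubmx (iota q) = rsubmx (iota q) *m Q^T *m Q.
  by rewrite {1}(normal_component QQ (mul0mx _ _) JE q) scaler0 add0r.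
pose N : 'M[R]_(1 + p, Defs.dim S) := col_mx 0 Q^T.
pose f : S -> euclidean R (Defs.dim S) := fun q => iota q *m N.
have fE q : f q = rsubmx (iota q) *m Q^T.
  by rewrite /f /N -{1}(hsubmxK (iota q)) mul_row_col mulmx0 add0r.
have [iinj iM _] := Ssub.
have finj : injective f.
  move=> q q' /=; rewrite !fE => E; apply: iinj.
  rewrite -(hsubmxK (iota q)) -(hsubmxK (iota q')) (iE q) (iE q') E; congr row_mx.
  by apply/matrixP => a b; rewrite !ord1 !mxE -/(i0 n) -[LHS]/(t q) -[RHS]/(t q') !t0.
have fs : smooth_map f by exact: linear_image_smooth.
have gE c x : cdom c x -> g c x = jacobian (f \o par c) x *m 1%:M *m (jacobian (f \o par c) x)^T.
  move=> cx; have [B BE ->] := metric_in_chart cx.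
  rewrite linear_image_jacobian // BE t0 mulr0 scaling0 !mulmx1.
  transitivity ((B *m (J0 *m N)) *m (B *m (J0 *m N))^T); last by rewrite mulmxA.
  have -> : J0 *m N = C by rewrite JV /N mul_row_col mul0mx add0r VE -mulmxA QQ mulmx1.
  rewrite JV VE mul_mx_row mulmx0 tr_row_mx mul_row_col mul0mx add0r.
  by rewrite mulmxA trmx_mul mulmxA -[_ *m Q *m Q^T]mulmxA QQ mulmx1.
have Jfree c x : cdom c x -> row_free (jacobian (f \o par c) x).
  by move=> cx; exact: metric_row_free (gE c x cx).
split.
  exists 0 => c q cq; have cx := crd_cdom cq.
  have oc : open (cdom c) by exact: cdom_open.
  have fk r := smooth_in_chart c fs r.
  have F3 a : Ck 3 (cdom c) (fun y => f (par c y) 0 a) by exact: (Ck_mxP 3 _ oc).1 (fk 3) 0 a.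
  have gF y : cdom c y -> forall i j, g c y i j =
      \sum_a pd i (fun z => f (par c z) 0 a) y * pd j (fun z => f (par c z) 0 a) y.
    move=> cy i j; have df : differentiable (f \o par c) y by have [+ _] := fk 1%N; apply.
    rewrite gE // mulmx1 mxE; apply: eq_bigr => a _.
    by rewrite [X in _ * X]mxE; congr (_ * _); exact: jacobianE.
  have gu y : cdom c y -> g c y \in unitmx.
    by move=> cy; rewrite gE // mulmx1; apply: gram_row_free_unit; exact: Jfree.
  have curv l r i j : curvature (g c) l r i j (crd c q) =
     - 0 * (g c (crd c q) j r * (l == i)%:R - g c (crd c q) i r * (l == j)%:R).
    by rewrite oppr0 mul0r; exact: (flat_curvature erefl oc F3 gF gu).
  by rewrite (constant_curvature_ricci curv) ?oppr0 ?mul0r //; exact: metric_sym.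
exists (Defs.dim S), f; split; last first.
  by move=> c d q cq _; exact: (gE c _ (crd_cdom cq)).
apply: (bijective_immersion_diffeomorphism Sm fs finj Jfree erefl).
have [_ [_ _ _ mulV _] _ _] := SG.
apply: (homomorphism_surjective Sm fs finj Jfree erefl (mul := mul) (one := one) (inv := inv)
   (op := +%R) (e := 0) (iv := -%R)) => //.
- exact: addrA.
- exact: add0r.
- exact: addNr.
- move=> z y; have d : differentiable (cst z + id) y.
    by apply: differentiableD; [exact: differentiable_cst | by []].
  exact: differentiable_continuous d.
- by rewrite /f (iota_one SG Ssub) mul0mx.
- move=> a b; rewrite /f iM an_mulE -/(t a) t0 mulr0 scaling0 mulmx1.
  exact: mulmxDl.
Qed.

Lemma hyperbolic_subgroup : lsubmx J0 != 0 ->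
  exists (r : nat) (lambda' : R), 0 < lambda' /\
    einstein g /\ isometric g (@an_metric R r.+1 lambda').
Proof.
move=> tau0; have Jfree0 := J0_row_free; rewrite -(hsubmxK J0) in Jfree0.
have [r [Q [C [U [kr QQ UQ YE]]]]] := transversal_basis tau0 Jfree0.
set tau := lsubmx J0 in tau0 YE Jfree0.
have JE : J0 = row_mx tau (tau *m U + C *m Q) by rewrite -YE hsubmxK.
have iE := normal_component QQ UQ JE.
(* The length of (1, U): rescaled by it, the B-coordinate of the smaller group belongs to a unit
   vector. *)
pose s := Num.sqrt (1 + sqn U).
have s1 : 0 < 1 + sqn U by rewrite ltr_wpDr ?sqn_ge0.
have s0 : 0 < s by rewrite sqrtr_gt0.
have ss : s * s = 1 + sqn U by rewrite -expr2 sqr_sqrtr // ltW.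
pose lambda' := lambda / s.
have l'0 : 0 < lambda' by rewrite divr_gt0.
exists r, lambda'; split=> //.
pose N : 'M[R]_(1 + p, 1 + r) := block_mx s%:M 0 0 Q^T.
pose f : S -> AN R r.+1 := fun q => iota q *m N.
have fE q : f q = row_mx (s *: lsubmx (iota q)) (rsubmx (iota q) *m Q^T).
  rewrite /f /N -{1}(hsubmxK (iota q)) mul_row_block !mulmx0 addr0 add0r.
  by rewrite mul_mx_scalar.
have ft q : f q 0 (i0 r.+1) = s * t q by rewrite fE /i0 row_mxEl !mxE.
have l'ft q : lambda' * f q 0 (i0 r.+1) = lambda * t q.
  by rewrite ft /lambda'; field; exact: lt0r_neq0.
have [iinj iM _] := Ssub.
have finj : injective f.
  (* The component of [iota q] that the projection forgets is a function of [t q], by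
     [normal_component]. *)
  move=> q q' /=; rewrite !fE => /eq_row_mx[E1 E2]; apply: iinj.
  have El : lsubmx (iota q) = lsubmx (iota q').
    by move: E1 => /(congr1 (fun M => s^-1 *: M)); rewrite !scalerA mulVf ?scale1r // lt0r_neq0.
  have Et : t q = t q' by have /matrixP/(_ 0 0) := El; rewrite !mxE.
  rewrite -(hsubmxK (iota q)) -(hsubmxK (iota q')) El; congr row_mx.
  by rewrite (iE q) (iE q') E2 Et.
have fs : smooth_map f by exact: linear_image_smooth.
(* Together with [l'ft] this intertwines left translations of the two groups: it yields both the
   homomorphism property and the pullback formula away from the identity. *)
have NS u : scaling n u *m N = N *m scaling r.+1 u.
  rewrite !scaling_block /N !mulmx_block !mulmx0 !mul0mx !addr0 !add0r !mul1mx !mulmx1.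
  by rewrite mul_scalar_mx mul_mx_scalar.
have JN : J0 *m N = row_mx (s *: tau) C.
  rewrite JE /N mul_row_block !mulmx0 addr0 add0r mul_mx_scalar mulmxDl.
  by rewrite -!mulmxA UQ QQ mulmx0 add0r mulmx1.
(* Isometry at the identity: as U is orthogonal to the rows of Q, both sides equal (1 + |U|^2) tau
   tau^T + C C^T. *)
have JJ : J0 *m J0^T = (J0 *m N) *m (J0 *m N)^T.
  rewrite JN JE !tr_row_mx !mul_row_col !linearD /= !trmx_mul.
  have QU : Q *m U^T = 0 by apply: trmx_inj; rewrite trmx_mul trmxK UQ trmx0.
  have UU : U *m U^T = (sqn U)%:M.
    by apply/matrixP => a b; rewrite !ord1 [RHS]mxE eqxx mulr1n.
  rewrite !mulmxDl !mulmxA -[tau *m U *m U^T]mulmxA UU -[C *m Q *m U^T]mulmxA QU mulmx0 mul0mx addr0.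
  rewrite -[tau *m U *m Q^T]mulmxA UQ mulmx0 mul0mx add0r.
  rewrite -[C *m Q *m Q^T]mulmxA QQ mulmx1 addrA; congr (_ + _).
  rewrite mul_mx_scalar [(s *: tau)^T]linearZ /= -!scalemxAl -!scalemxAr scalerA ss.
  by rewrite scalerDl scale1r.
have gE c x : cdom c x -> g c x = jacobian (f \o par c) x *m
    @an_metric R r.+1 lambda' tt (f (par c x)) *m (jacobian (f \o par c) x)^T.
  move=> cx; have [B BE ->] := metric_in_chart cx.
  rewrite an_metric_sqr !mulmxA -[in RHS]mulmxA -trmx_mul l'ft.
  have -> : jacobian (f \o par c) x *m scaling r.+1 (- (lambda * t (par c x))) = B *m (J0 *m N).
    rewrite linear_image_jacobian // BE -!mulmxA [scaling n _ *m _]mulmxA NS.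
    congr (_ *m (_ *m _)); rewrite -mulmxA.
    have -> : scaling r.+1 (lambda * t (par c x)) *m scaling r.+1 (- (lambda * t (par c x))) = 1%:M.
      by rewrite scalingD subrr scaling0.
    exact: mulmx1.
  by rewrite !trmx_mul !mulmxA -[B *m J0 *m J0^T]mulmxA JJ trmx_mul !mulmxA.
have Jfree c x : cdom c x -> row_free (jacobian (f \o par c) x).
  by move=> cx; exact: metric_row_free (gE c x cx).
split.
  exists (- lambda' ^+ 2 * ((Defs.dim S)%:R - 1)) => c q cq; have cx := crd_cdom cq.
  have oc : open (cdom c) by exact: cdom_open.
  apply: constant_curvature_ricci; last exact: metric_sym.
  move=> l a i j.
  exact: (an_pullback_constant_curvature (n := r.+1) l'0 kr oc (smooth_in_chart c fs) (Jfree c) (gE c)).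
exists f; split; last first.
  by move=> c [] q cq _; have := gE c _ (crd_cdom cq); rewrite (crdK Sm cq); apply.
apply: (bijective_immersion_diffeomorphism Sm fs finj Jfree kr).
have [_ [_ _ _ mulV _] _ _] := SG.
apply: (homomorphism_surjective Sm fs finj Jfree kr (mul := mul) (one := one) (inv := inv)
   (op := @an_mul R r.+1 lambda') (e := an_one R r.+1) (iv := @an_inv R r.+1 lambda')) => //.
- exact: an_mulA.
- exact: an_mul1.
- exact: an_mulV.
- move=> z y.
  have -> : an_mul lambda' z = fun b => z + b *m scaling r.+1 (lambda' * z 0 (i0 r.+1)).
    by apply/funext => b; rewrite an_mulE.
  apply: (@affine_Ck R _ _ 0 setT z _ openT) => //.
- by rewrite /f (iota_one SG Ssub) mul0mx.
- move=> a b; rewrite an_mulE l'ft /f iM an_mulE mulmxDl -!mulmxA NS //.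
Qed.

End Subgroup.

Theorem corollary1p2 (R : realType) (n : nat) (lambda : R)
    (S : charted R) (mul : S -> S -> S) (one : S) (inv : S -> S)
    (iota : S -> AN R n) (g : bilinear_field S) :
  (1 < n)%N -> 0 < lambda ->
  lie_group mul one inv ->
  connected [set: S] ->
  lie_subgroup mul (@an_mul R n lambda) iota ->
  riemannian_metric g ->
  is_pullback iota (@an_metric R n lambda) g ->
  ricci_soliton g ->
  einstein g /\
  ((exists k : nat, isometric g (@euclidean_metric R k)) \/
   (exists (N : charted R) (h : bilinear_field N),
      real_hyperbolic_space h /\ isometric g h)).
Proof.
move=> _ l0 SG Sconn Ssub gR gP _.
have [c0 c01] := chart_at (lie_manifold SG) one.
have [J00|J00] := eqVneq (lsubmx (jacobian (iota \o par c0) (crd c0 one) : 'M[R]_(_, 1 + n.-1))) 0.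
  have [ge gi] := flat_subgroup l0 SG Sconn Ssub gR gP c01 J00.
  by split=> //; left.
(* For r = 0 the subgroup is one-dimensional; a line counts as Euclidean, since
   [real_hyperbolic_space] requires dimension at least 2, and the metric of the one-dimensional AN
   is just dt^2. *)
have [[|r] [lambda' [l'0 [ge gi]]]] := hyperbolic_subgroup l0 SG Sconn Ssub gR gP c01 J00.
  split=> //; left; exists 1%N.
  have -> : @euclidean_metric R 1 = @an_metric R 1 lambda'.
    have sc1 (u : R) : scaling 1 u = 1%:M.
      apply/matrixP => i j; have I0 (k : 'I_(1 + 1.-1)) : k = i0 1 by apply: val_inj; case: k => -[].
      by rewrite scalingE (I0 i) (I0 j) wt0 mxE eqxx mul1r.
    by apply/funext => c; apply/funext => a; rewrite an_metricE sc1.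
  exact: gi.
split; first exact: ge.
right; exists (AN R r.+2), (@an_metric R r.+2 lambda'); split; last exact: gi.
exact: an_hyperbolic.
Qed.
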